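(* Let $A=\sigma(R)\langle x_1,\dots,x_n\rangle$ be a bijective skew $PBW$ extension of a ring $R$ in $n$ variables. Then: (i) If $\mathrm{lgld}(R)<\infty$, then $\mathrm{lgld}(R)\le \mathrm{lgld}(A)\le \mathrm{lgld}(R)+n$. If $A$ is quasi-commutative, then $\mathrm{lgld}(A)=\mathrm{lgld}(R)+n$; in particular, if $A$ is quasi-commutative and $R$ is semisimple, then $\mathrm{lgld}(A)=n$. (ii) If $R$ is left Noetherian, then $\mathrm{lKdim}(R)\le \mathrm{lKdim}(A)\le \mathrm{lKdim}(R)+n$. If, in addition, $A$ is quasi-commutative, then $\mathrm{lKdim}(A)=\mathrm{lKdim}(R)+n$; in particular, if $A$ is quasi-commutative and $R=\Bbbk$ is a field, then $\mathrm{lKdim}(A)=n$. (iii) If $R$ is a left Noetherian domain, then the left Goldie dimension of $A$ is $1$, that is, $\mathrm{ludim}(A)=1$.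
   Context: Rings are associative with identity, not necessarily commutative; $\mathbb{N}=\{0,1,2,\dots\}$. Let $R$ and $A$ be rings. $A$ is a skew $PBW$ extension of $R$, written $A=\sigma(R)\langle x_1,\dots,x_n\rangle$, if: (i) $R\subseteq A$; (ii) there are finitely many elements $x_1,\dots,x_n\in A$ such that $A$ is a free left $R$-module with basis $\mathrm{Mon}(A):=\{x^\alpha=x_1^{\alpha_1}\cdots x_n^{\alpha_n}\mid \alpha=(\alpha_1,\dots,\alpha_n)\in\mathbb{N}^n\}$ (with $x_1^0\cdots x_n^0:=1$); (iii) for every $1\le i\le n$ and $r\in R-\{0\}$ there exists $c_{i,r}\in R-\{0\}$ such that $x_ir-c_{i,r}x_i\in R$; (iv) for every $1\le i,j\le n$ there exists $c_{i,j}\in R-\{0\}$ such that $x_jx_i-c_{i,j}x_ix_j\in R+Rx_1+\cdots+Rx_n$. Then for every $i$ there are an injective ring endomorphism $\sigma_i:R\to R$ (with $\sigma_i(r)=c_{i,r}$ for $r\neq 0$) and a $\sigma_i$-derivation $\delta_i:R\to R$ such that $x_ir=\sigma_i(r)x_i+\delta_i(r)$ for all $r\in R$. $A$ is called bijective if $\sigma_i$ is bijective for every $1\le i\le n$ and $c_{i,j}$ is invertible for all $1\le i<j\le n$. $A$ is called quasi-commutative if (iii) and (iv) are replaced by $x_ir=c_{i,r}x_i$ and $x_jx_i=c_{i,j}x_ix_j$ respectively. $\mathrm{lgld}$ denotes the left global dimension, $\mathrm{lKdim}$ the left Krull dimension (in the sense of Gabriel--Rentschler), and $\mathrm{ludim}$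 the left Goldie (uniform) dimension of a ring. *)

(* Defs.v *)
From HB Require Import structures.
From mathcomp Require Import all_boot all_order all_algebra.
From mathcomp Require Import boolp classical_sets constructive_ereal.

Set Implicit Arguments.
Unset Strict Implicit.
Unset Printing Implicit Defensive.

Import Order.TTheory GRing.Theory Num.Theory.

Local Open Scope classical_set_scope.
Local Open Scope ring_scope.

(** * Skew PBW extensions *)

Section SkewPBW.
Variables (R A : nzRingType) (iota : {rmorphism R -> A}).
Variables (n : nat) (x : 'I_n -> A).

(* The big product is taken in increasing order of the indices. *)
Definition pbw_mon (alpha : {ffun 'I_n -> nat}) : A :=
  \prod_(i < n) x i ^+ alpha i.

Definition pbw_basis : Prop :=
  (forall a : A, exists (s : seq {ffun 'I_n -> nat})
     (c : {ffun 'I_n -> nat} -> R),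
     a = \sum_(alpha <- s) iota (c alpha) * pbw_mon alpha) /\
  (forall (s : seq {ffun 'I_n -> nat}) (c : {ffun 'I_n -> nat} -> R),
     uniq s -> \sum_(alpha <- s) iota (c alpha) * pbw_mon alpha = 0 ->
     forall alpha, alpha \in s -> c alpha = 0).

(* R + R x_1 + ... + R x_n *)
Definition affine_span : set A :=
  [set a | exists (r0 : R) (r : 'I_n -> R),
     a = iota r0 + \sum_(i < n) iota (r i) * x i].

(* The inclusion of R in A is the injective ring morphism iota. *)
Record skew_PBW : Prop := SkewPBW {
  pbw_incl : injective iota;
  pbw_free : pbw_basis;
  pbw_scal : forall i (r : R), r != 0 ->
    exists c : R, c != 0 /\
      exists d : R, x i * iota r - iota c * x i = iota d;
  pbw_comm : forall i j,
    exists c : R, c != 0 /\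
      affine_span (x j * x i - iota c * (x i * x j)) }.

(* In a skew PBW extension, freeness over R makes s the unique function with
   this property; it is the endomorphism sigma_i, and r |-> d is delta_i. *)
Definition is_sigma (i : 'I_n) (s : R -> R) : Prop :=
  forall r : R, exists d : R, x i * iota r = iota (s r) * x i + iota d.

Definition two_sided_unit (c : R) : Prop :=
  exists d : R, c * d = 1 /\ d * c = 1.

Definition pbw_bijective : Prop :=
  (forall i, exists s : R -> R, is_sigma i s /\ bijective s) /\
  (forall i j : 'I_n, (i < j)%N ->
     exists c : R, two_sided_unit c /\
       affine_span (x j * x i - iota c * (x i * x j))).

Definition pbw_quasi_commutative : Prop :=
  (forall i (r : R), r != 0 ->
     exists c : R, c != 0 /\ x i * iota r = iota c * x i) /\
  (forall i j, exists c : R, c != 0 /\ x j * x i = iota c * (x i * x j)).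

End SkewPBW.

(** * Submodules *)

Section Modules.
Variables (R : nzRingType) (M : lmodType R).

Definition is_submodule (N : set M) : Prop :=
  N 0 /\ forall (a : R) (u v : M), N u -> N v -> N (a *: u + v).

Definition noetherian_module : Prop :=
  forall C : nat -> set M,
    (forall k, is_submodule (C k) /\ C k `<=` C k.+1) ->
    exists m, forall k, (m <= k)%N -> C k = C m.

Definition simple_submodule (S : set M) : Prop :=
  [/\ is_submodule S, S <> [set 0] &
      forall N : set M, is_submodule N -> N `<=` S -> N = [set 0] \/ N = S].

(* M is the sum of its simple submodules. *)
Definition semisimple_module : Prop :=
  forall v : M, exists s : seq M,
    v = \sum_(u <- s) u /\
    forall u, u \in s -> exists S, simple_submodule S /\ S u.

Definition uniform_submodule (U : set M) : Prop :=
  [/\ is_submodule U, U <> [set 0] &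
      forall N1 N2 : set M,
        is_submodule N1 -> N1 `<=` U -> N1 <> [set 0] ->
        is_submodule N2 -> N2 `<=` U -> N2 <> [set 0] ->
        N1 `&` N2 <> [set 0]].

Definition essential_submodule (E : set M) : Prop :=
  is_submodule E /\
  forall N : set M, is_submodule N -> N <> [set 0] -> N `&` E <> [set 0].

Definition sum_family k (U : 'I_k -> set M) : set M :=
  [set v | exists u : 'I_k -> M,
     (forall i, U i (u i)) /\ v = \sum_(i < k) u i].

Definition independent_family k (U : 'I_k -> set M) : Prop :=
  forall u : 'I_k -> M, (forall i, U i (u i)) ->
    \sum_(i < k) u i = 0 -> forall i, u i = 0.

End Modules.

(* The least element of P, or +oo when P is empty. *)
Definition nat_inf (P : set nat) : \bar int :=
  match pselect (exists k, `[< P k >]) with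
  | left exP => (Posz (ex_minn exP))%:E
  | right _ => +oo%E
  end.

(** * Goldie (uniform) dimension *)

Definition udim (R : nzRingType) (M : lmodType R) : \bar int :=
  nat_inf [set k | exists U : 'I_k -> set M,
    [/\ forall i, uniform_submodule (U i),
        independent_family U &
        essential_submodule (sum_family U)]].

Definition ludim (R : nzRingType) : \bar int := udim R^o.

(** * Global dimension *)

Definition projective_module (R : nzRingType) (P : lmodType R) : Prop :=
  forall (M N : lmodType R) (g : {linear M -> N}) (f : {linear P -> N}),
    (forall y, exists x, g x = y) ->
    exists h : {linear P -> M}, forall p, g (h p) = f p.

(* 0 -> P_d -> ... -> P_1 -> P_0 -> M -> 0, with P_i = 0 for i > d. *)
Definition proj_resolution_length (R : nzRingType) (M : lmodType R)
    (d : nat) : Prop :=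
  exists (P : nat -> lmodType R) (f : forall i, {linear P i.+1 -> P i})
         (e : {linear P 0%N -> M}),
    [/\ forall i, projective_module (P i),
        forall y, exists x, e x = y,
        forall p, e p = 0 <-> exists q, f 0%N q = p,
        forall i p, f i p = 0 <-> exists q, f i.+1 q = p &
        forall i, (d < i)%N -> forall p : P i, p = 0].

Definition pd (R : nzRingType) (M : lmodType R) : \bar int :=
  nat_inf [set d | proj_resolution_length M d].

(* The supremum of the pd M, an element of nat with +oo added, is the least
   natural number bounding all of them if there is one, and +oo otherwise. *)
Definition lgld (R : nzRingType) : \bar int :=
  nat_inf [set d | forall M : lmodType R, (pd M <= (Posz d)%:E)%E].

(** * Krull dimension *)

(* Ordinals as well-founded trees: osup f is the supremum of the successors of
   the f i. Distinct trees can represent the same ordinal; equality of ordinals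
   is ord_eq. *)
Inductive ord : Type := osup : forall X : Type, (X -> ord) -> ord.

Fixpoint ord_le (a b : ord) {struct a} : Prop :=
  match a, b with
  | osup X f, osup Y g => forall i : X, exists j : Y, ord_le (f i) (g j)
  end.

Definition ord_eq (a b : ord) : Prop := ord_le a b /\ ord_le b a.

Definition ord_zero : ord := osup (of_void ord).
Definition ord_succ (a : ord) : ord := osup (fun _ : unit => a).
Definition ord_addn (a : ord) (n : nat) : ord := iter n ord_succ a.
Definition ord_of_nat (n : nat) : ord := ord_addn ord_zero n.

Section Krull.
Variables (R : nzRingType) (M : lmodType R).

Definition descending_between (N L : set M) (C : nat -> set M) : Prop :=
  forall k, [/\ is_submodule (C k), N `<=` C k, C k `<=` L &
                C k.+1 `<=` C k].

(* The interval [N, L] of the lattice of submodules of M (that is, the lattice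
   of submodules of L / N) has deviation at most a: in every descending chain
   in it, all but finitely many factors have deviation < a. The deviation of a
   trivial interval, -1, is below every ordinal. *)
Fixpoint dev_le (a : ord) (N L : set M) {struct a} : Prop :=
  match a with
  | osup X f =>
      forall C, descending_between N L C ->
        exists m, forall k, (m <= k)%N ->
          C k = C k.+1 \/ exists i : X, dev_le (f i) (C k.+1) (C k)
  end.

(* M is nonzero and its Krull dimension exists and is the ordinal a. *)
Definition is_Kdim (a : ord) : Prop :=
  [/\ exists v : M, v <> 0, dev_le a [set 0] setT &
      forall b, dev_le b [set 0] setT -> ord_le a b].

End Krull.

Definition is_lKdim (R : nzRingType) (a : ord) : Prop := @is_Kdim R R^o a.

(** * Classes of rings *)

Definition left_noetherian (R : nzRingType) : Prop :=
  @noetherian_module R R^o.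

Definition semisimple_ring (R : nzRingType) : Prop :=
  @semisimple_module R R^o.

Definition is_domain (R : nzRingType) : Prop :=
  GRing.integral_domain_axiom R.

Definition is_field (R : nzRingType) : Prop :=
  commutative (@GRing.mul R) /\
  forall r : R, r != 0 -> exists s : R, s * r = 1.

(* Main.v *)
(* A product of standard monomials is, up to terms of lower total degree, a unit
   times a standard monomial, and the same holds for a monomial times a scalar;
   so leading terms are available, and A is free over R on either side.

   (i) A module that is projective over R becomes free over R after adding a
   free A-module (Eilenberg's swindle). A module with an R-basis has a free
   A-resolution of length n built as in Schreyer's theorem: each syzygy module
   has an R-basis of monomials x^m g in which m only involves the variables of
   index at least h(g), and h decreases from one syzygy module to the next.
   Shifting dimensions, lgld A <= lgld R + n. Conversely an R-module M embeds in
   A (x) M, and when lgld R is finite this gives lgld R <= lgld A. In the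
   quasi-commutative case the last variable z is normal and regular, A/zA is an
   extension of the same kind in one variable less, and for an A/zA-module
   M = F/K with F free over A, the embedding of zF/zK, a twist of M, in K/zK
   shows that lgld (A/zA) < lgld A when both are finite.

   (ii) The leading coefficients of a left ideal of A, taken on the right of the
   monomials, form an increasing family of left ideals of R indexed by N^n, and
   this map is strictly monotone. Each factor N raises the deviation of a
   Noetherian poset by exactly one. Quasi-commutativity provides a strictly
   monotone map back; in general there is J |-> AJ.

   (iii) The same map shows that A is left Noetherian and leading terms show
   that it is a domain, so any two nonzero left ideals of A meet. *)
Require Import Defs.
From HB Require Import structures.
From mathcomp Require Import all_boot all_order all_algebra.
From mathcomp Require Import boolp classical_sets constructive_ereal.

Set Implicit Arguments.
Unset Strict Implicit.
Unset Printing Implicit Defensive.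

Import Order.TTheory GRing.Theory Num.Theory.
Local Open Scope ring_scope.

(** * Submodules, quotients and free modules *)

(** No Ext or Tor occurs: dimension shifting is done with kernels of covers, Schanuel's lemma and
    the horseshoe lemma. Both lower bounds on [lgld] lower a known finite bound one unit at a time
    through [pdle_sub]: once every module has dimension at most d+1, a submodule of a module of
    dimension at most d again has dimension at most d. This is where finiteness of [lgld R] enters.
    Schreyer's construction starts from an [R]-basis, while an [A]-module that is projective over
    [R] may have none; the swindle removes this obstacle. Degree alone does not make its rewriting
    terminate, since a product [x j *: g i] may rewrite to terms of the same degree; the weight [t]
    breaks these ties. Deviation is developed for the part of a preordered type cut out by a
    predicate. Increasing families and finite powers can then be plain functions, and two lattices
    are compared by any map that is monotone and reflects the reverse comparison on an interval. *)

Section LinearMaps.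
Variable R : nzRingType.

Definition mklin (M N : lmodType R) (f : M -> N) (hf : linear f) :
  {linear M -> N} := HB.pack f (GRing.isLinear.Build R M N *:%R f hf).

Lemma mklinE (M N : lmodType R) (f : M -> N) (hf : linear f) m :
  mklin hf m = f m.
Proof. by []. Qed.

Lemma is_submodule_ker (M N : lmodType R) (f : {linear M -> N}) :
  is_submodule (fun m => f m = 0).
Proof.
by split=> [|a u v fu fv]; rewrite ?linear0 // linearP fu fv scaler0 addr0.
Qed.

Lemma is_submodule_range (M N : lmodType R) (f : {linear M -> N}) :
  is_submodule (fun n => exists m, f m = n).
Proof.
split=> [|a _ _ [u <-] [v <-]]; first by exists 0; rewrite linear0.
by exists (a *: u + v); rewrite linearP.
Qed.

Section Closure.
Variables (M : lmodType R) (N : set M) (hN : is_submodule N).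

Lemma sub0 : N 0. Proof. by case: hN. Qed.

Lemma subD u v : N u -> N v -> N (u + v).
Proof. by move=> Nu Nv; rewrite -[u]scale1r; case: hN => _; apply. Qed.

Lemma subZ a u : N u -> N (a *: u).
Proof. by move=> Nu; rewrite -[_ *: _]addr0; case: hN => N0; apply. Qed.

Lemma subN u : N u -> N (- u).
Proof. by rewrite -scaleN1r; apply: subZ. Qed.

Lemma subB u v : N u -> N v -> N (u - v).
Proof. by move=> Nu Nv; apply: subD => //; apply: subN. Qed.

Lemma sub_sum (I : eqType) (r : seq I) (F : I -> M) :
  (forall i, i \in r -> N (F i)) -> N (\sum_(i <- r) F i).
Proof.
elim: r => [|i r IH] Fr; first by rewrite big_nil; apply: sub0.
rewrite big_cons; apply: subD; first by apply: Fr; rewrite mem_head.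
by apply: IH => j jr; apply: Fr; rewrite in_cons jr orbT.
Qed.

End Closure.

Section Submodule.
Variables (M : lmodType R) (N : set M).

Definition sub_pred (hN : is_submodule N) : {pred M} := fun m => `[< N m >].

Variable hN : is_submodule N.

Lemma sub_pred_closed : GRing.submod_closed (sub_pred hN).
Proof.
split=> [|a u v /asboolP Nu /asboolP Nv]; apply/asboolP; first exact: sub0.
by case: hN => _; apply.
Qed.

HB.instance Definition _ :=
  GRing.isSubmodClosed.Build R M (sub_pred hN) sub_pred_closed.

Record sub_mod := SubMod { sub_val : M; _ : sub_val \in sub_pred hN }.
HB.instance Definition _ := [isSub for sub_val].
HB.instance Definition _ := [Choice of sub_mod by <:].
HB.instance Definition _ := [SubChoice_isSubLmodule of sub_mod by <:].

Lemma submodule_exists : exists (K : lmodType R) (i : {linear K -> M}),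
  injective i /\ forall m, N m <-> exists k, i k = m.
Proof.
exists sub_mod, (\val : {linear sub_mod -> M}); split; first exact: val_inj.
move=> m; split=> [Nm|[k <-]]; last by apply/asboolP/(valP k).
have Pm : m \in sub_pred hN by apply/asboolP.
by exists (SubMod Pm).
Qed.

End Submodule.

Section Quotient.
Variables (M : lmodType R) (N : set M).

(* The proof argument makes the module structure on the quotient inferable. *)
Definition submodule_rep (h : is_submodule N) (x : M) : M :=
  xget 0 (fun y => N (x - y)).

Variable hN : is_submodule N.
Local Notation coset_rep := (submodule_rep hN).

Lemma coset_repP x : N (x - coset_rep x).
Proof.
by apply: (xgetPex 0 (P := fun y => N (x - y))); exists x; rewrite subrr; apply: sub0.
Qed.

(** Congruent elements have the same set of candidates, by extensionality, and the choice depends on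
    that set only. *)
Lemma coset_rep_eq x y : N (x - y) -> coset_rep x = coset_rep y.
Proof.
move=> Nxy; congr (xget 0 _); apply/funext=> z; apply/propext; split=> Nz.
  by rewrite -(subrK x y) -addrA; apply: subD => //; rewrite -opprB; apply: subN.
by rewrite -(subrK y x) -addrA; apply: subD.
Qed.

Lemma coset_rep_id x : coset_rep (coset_rep x) = coset_rep x.
Proof. by apply/esym/coset_rep_eq/coset_repP. Qed.

(** Cosets are encoded by their chosen representatives, so that equality in the quotient is Leibniz
    equality. *)
Record quot_mod := QuotMod
  { quot_val : M; _ : quot_val == coset_rep quot_val }.
HB.instance Definition _ := [isSub for quot_val].
HB.instance Definition _ := [Choice of quot_mod by <:].

Definition quot_pi (x : M) : quot_mod :=
  @QuotMod (coset_rep x) (introT eqP (esym (coset_rep_id x))).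

Lemma quot_piP x y : quot_pi x = quot_pi y <-> N (x - y).
Proof.
split=> [/(congr1 quot_val) /= e|Nxy]; last exact/val_inj/coset_rep_eq.
rewrite -(subrK (coset_rep x) x) -addrA; apply: subD => //.
  exact: coset_repP.
by rewrite e -opprB; apply: subN => //; apply: coset_repP.
Qed.

Lemma quot_valK q : quot_pi (quot_val q) = q.
Proof. by apply/val_inj => /=; case: q => x /= /eqP. Qed.

Lemma quot_val_pi x : N (quot_val (quot_pi x) - x).
Proof. by rewrite -opprB; apply: subN => //; apply: coset_repP. Qed.

Definition quot_add p q := quot_pi (quot_val p + quot_val q).
Definition quot_opp p := quot_pi (- quot_val p).
Definition quot_scale a p := quot_pi (a *: quot_val p).

Lemma quot_addE x y : quot_add (quot_pi x) (quot_pi y) = quot_pi (x + y).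
Proof.
by apply/quot_piP; rewrite opprD addrACA; apply: subD => //; apply: quot_val_pi.
Qed.

Lemma quot_oppE x : quot_opp (quot_pi x) = quot_pi (- x).
Proof.
by apply/quot_piP; rewrite -opprD; apply: subN => //; apply: quot_val_pi.
Qed.

Lemma quot_scaleE a x : quot_scale a (quot_pi x) = quot_pi (a *: x).
Proof.
by apply/quot_piP; rewrite -scalerBr; apply: subZ => //; apply: quot_val_pi.
Qed.

Lemma quot_ind (P : quot_mod -> Prop) : (forall x, P (quot_pi x)) -> forall q, P q.
Proof. by move=> Px q; rewrite -(quot_valK q). Qed.

Fact quot_addA : associative quot_add.
Proof.
elim/quot_ind=> x; elim/quot_ind=> y; elim/quot_ind=> z.
by rewrite !quot_addE addrA.
Qed.
Fact quot_addC : commutative quot_add.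
Proof. by elim/quot_ind=> x; elim/quot_ind=> y; rewrite !quot_addE addrC. Qed.
Fact quot_add0 : left_id (quot_pi 0) quot_add.
Proof. by elim/quot_ind=> x; rewrite quot_addE add0r. Qed.
Fact quot_addN : left_inverse (quot_pi 0) quot_opp quot_add.
Proof. by elim/quot_ind=> x; rewrite quot_oppE quot_addE addNr. Qed.

HB.instance Definition _ :=
  GRing.isZmodule.Build quot_mod quot_addA quot_addC quot_add0 quot_addN.

Fact quot_scaleA a b v : quot_scale a (quot_scale b v) = quot_scale (a * b) v.
Proof. by elim/quot_ind: v => x; rewrite !quot_scaleE scalerA. Qed.
Fact quot_scale1 : left_id 1 quot_scale.
Proof. by elim/quot_ind=> x; rewrite quot_scaleE scale1r. Qed.
Fact quot_scaleDr : right_distributive quot_scale +%R.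
Proof.
move=> a; elim/quot_ind=> x; elim/quot_ind=> y.
by rewrite [_ + _]quot_addE !quot_scaleE scalerDr [in RHS]/+%R /= quot_addE.
Qed.
Fact quot_scaleDl v : {morph quot_scale^~ v : a b / a + b}.
Proof.
move=> a b; elim/quot_ind: v => x.
by rewrite !quot_scaleE scalerDl [in RHS]/+%R /= quot_addE.
Qed.

HB.instance Definition _ := GRing.Zmodule_isLmodule.Build R quot_mod
  quot_scaleA quot_scale1 quot_scaleDr quot_scaleDl.

Fact quot_pi_linear : linear quot_pi.
Proof. by move=> a x y; rewrite -quot_addE -quot_scaleE. Qed.

End Quotient.

Lemma quotient_exists (M : lmodType R) (N : set M) : is_submodule N ->
  exists (Q : lmodType R) (p : {linear M -> Q}),
    (forall q, exists m, p m = q) /\ forall m, p m = 0 <-> N m.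
Proof.
move=> hN; exists (quot_mod hN), (mklin (quot_pi_linear hN)); split.
  by move=> q; exists (quot_val q); rewrite mklinE quot_valK.
by move=> m; rewrite mklinE -[X in _ <-> N X]subr0; apply: quot_piP.
Qed.

Lemma factor_surj (M Q N : lmodType R) (p : {linear M -> Q}) (f : {linear M -> N}) :
  (forall q, exists m, p m = q) -> (forall m, p m = 0 -> f m = 0) ->
  exists g : {linear Q -> N}, forall m, g (p m) = f m.
Proof.
move=> sp kp; pose s q := sval (cid (sp q)).
have sK q : p (s q) = q by rewrite /s; case: cid.
have fE m1 m2 : p m1 = p m2 -> f m1 = f m2.
  by move=> e; apply/eqP; rewrite -subr_eq0 -linearB kp // linearB e subrr.
have lin : linear (fun q => f (s q)).
  by move=> a u v; rewrite -linearP; apply: fE; rewrite linearP !sK.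
by exists (mklin lin) => m; rewrite mklinE; apply: fE; rewrite sK.
Qed.

Lemma factor_inj (K M N : lmodType R) (i : {linear K -> M}) (f : {linear N -> M}) :
  injective i -> (forall n, exists k, i k = f n) ->
  exists g : {linear N -> K}, forall n, i (g n) = f n.
Proof.
move=> ii sf; pose s n := sval (cid (sf n)).
have sK n : i (s n) = f n by rewrite /s; case: cid.
have lin : linear s by move=> a u v; apply: ii; rewrite linearP !sK linearP.
by exists (mklin lin).
Qed.

Lemma inv_linear (M N : lmodType R) (f : {linear M -> N}) :
  injective f -> (forall n, exists m, f m = n) ->
  exists g : {linear N -> M}, cancel g f /\ cancel f g.
Proof.
move=> fi fs; have [g gK] := factor_inj (f := idfun : {linear N -> N}) fi fs.
by exists g; split=> // m; apply: fi; apply: gK.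
Qed.

End LinearMaps.

Section FreeModule.
Variables (R : nzRingType) (K : choiceType).

Definition finsupp (f : K -> R) : Prop :=
  exists s : seq K, forall k, k \notin s -> f k = 0.

(** Finiteness of the support is a boolean, so its proofs are irrelevant and an element is
    determined by its coefficients. *)
Record free_mod := FreeMod { co : K -> R; _ : `[< finsupp co >] }.
HB.instance Definition _ := [isSub for co].
HB.instance Definition _ := gen_eqMixin free_mod.
HB.instance Definition _ := gen_choiceMixin free_mod.

Lemma co_inj f g : co f =1 co g -> f = g.
Proof. by move=> e; apply/val_inj/funext. Qed.

Lemma finsupp_co f : finsupp (co f).
Proof. exact/asboolP/(valP f). Qed.

Definition mkfree (f : K -> R) (h : finsupp f) : free_mod :=
  FreeMod (introT (asboolP _) h).

Fact finsupp0 : finsupp (fun=> 0). Proof. by exists [::]. Qed.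
Fact finsuppD f g : finsupp (fun k => co f k + co g k).
Proof.
have [s Hs] := finsupp_co f; have [t Ht] := finsupp_co g; exists (s ++ t) => k.
by rewrite mem_cat negb_or => /andP[/Hs -> /Ht ->]; rewrite addr0.
Qed.
Fact finsuppN f : finsupp (fun k => - co f k).
Proof. by have [s Hs] := finsupp_co f; exists s => k /Hs ->; rewrite oppr0. Qed.
Fact finsuppZ a f : finsupp (fun k => a * co f k).
Proof. by have [s Hs] := finsupp_co f; exists s => k /Hs ->; rewrite mulr0. Qed.
Fact finsuppU a k : finsupp (fun l => if l == k then a else 0).
Proof. by exists [:: k] => l; rewrite inE => /negPf ->. Qed.

Definition free_add f g := mkfree (finsuppD f g).
Definition free_opp f := mkfree (finsuppN f).
Definition free_scale a f := mkfree (finsuppZ a f).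
Definition fgen a k := mkfree (finsuppU a k).

Fact free_addA : associative free_add.
Proof. by move=> f g h; apply: co_inj => k /=; rewrite addrA. Qed.
Fact free_addC : commutative free_add.
Proof. by move=> f g; apply: co_inj => k /=; rewrite addrC. Qed.
Fact free_add0 : left_id (mkfree finsupp0) free_add.
Proof. by move=> f; apply: co_inj => k /=; rewrite add0r. Qed.
Fact free_addN : left_inverse (mkfree finsupp0) free_opp free_add.
Proof. by move=> f; apply: co_inj => k /=; rewrite addNr. Qed.
HB.instance Definition _ :=
  GRing.isZmodule.Build free_mod free_addA free_addC free_add0 free_addN.

Fact free_scaleA a b v : free_scale a (free_scale b v) = free_scale (a * b) v.
Proof. by apply: co_inj => k /=; rewrite mulrA. Qed.
Fact free_scale1 : left_id 1 free_scale.
Proof. by move=> f; apply: co_inj => k /=; rewrite mul1r. Qed.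
Fact free_scaleDr : right_distributive free_scale +%R.
Proof. by move=> a f g; apply: co_inj => k /=; rewrite mulrDr. Qed.
Fact free_scaleDl v : {morph free_scale^~ v : a b / a + b}.
Proof. by move=> a b; apply: co_inj => k /=; rewrite mulrDl. Qed.
HB.instance Definition _ := GRing.Zmodule_isLmodule.Build R free_mod
  free_scaleA free_scale1 free_scaleDr free_scaleDl.

Arguments co : simpl never.

Lemma co0 k : co 0 k = 0. Proof. by []. Qed.
Lemma coD f g k : co (f + g) k = co f k + co g k. Proof. by []. Qed.
Lemma coN f k : co (- f) k = - co f k. Proof. by []. Qed.
Lemma coB f g k : co (f - g) k = co f k - co g k. Proof. by []. Qed.
Lemma coZ a f k : co (a *: f) k = a * co f k. Proof. by []. Qed.
Lemma coU a k l : co (fgen a k) l = if l == k then a else 0. Proof. by []. Qed.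
Lemma coUU a k : co (fgen a k) k = a. Proof. by rewrite coU eqxx. Qed.

Lemma co_sum (I : Type) (r : seq I) (P : pred I) (F : I -> free_mod) k :
  co (\sum_(i <- r | P i) F i) k = \sum_(i <- r | P i) co (F i) k.
Proof. exact: (big_morph (fun f => co f k) (fun f g => coD f g k) (co0 k)). Qed.

Lemma fgenD a b k : fgen (a + b) k = fgen a k + fgen b k.
Proof. by apply: co_inj => l; rewrite coD !coU; case: ifP; rewrite ?addr0. Qed.

Lemma fgenZ a b k : a *: fgen b k = fgen (a * b) k.
Proof. by apply: co_inj => l; rewrite coZ !coU; case: ifP; rewrite ?mulr0. Qed.

Lemma fgen0 k : fgen 0 k = 0.
Proof. by apply: co_inj => l; rewrite coU if_same. Qed.

Lemma fsupp_exists f : exists s : seq K, uniq s /\ forall k, k \notin s -> co f k = 0.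
Proof.
have [s Hs] := finsupp_co f; exists (undup s); split; first exact: undup_uniq.
by move=> k; rewrite mem_undup; apply: Hs.
Qed.

Definition fsupp f := sval (cid (fsupp_exists f)).

Lemma fsupp_uniq f : uniq (fsupp f).
Proof. by rewrite /fsupp; case: cid => s []. Qed.

Lemma fsupp_out f k : k \notin fsupp f -> co f k = 0.
Proof. by rewrite /fsupp; case: cid => s [] /= _; apply. Qed.

Lemma free_sumE s f : uniq s -> (forall k, k \notin s -> co f k = 0) ->
  f = \sum_(k <- s) fgen (co f k) k.
Proof.
move=> us Hs; apply: co_inj => k; rewrite co_sum.
have [ks|ks] := boolP (k \in s).
  rewrite (bigD1_seq k) //= coUU big1 ?addr0 // => l /negPf lk.
  by rewrite coU eq_sym lk.
rewrite Hs // big1_seq // => l /andP[_ ls]; rewrite coU.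
by case: eqP ls ks => // -> ->.
Qed.

Lemma free_ind (P : free_mod -> Prop) :
  P 0 -> (forall f g, P f -> P g -> P (f + g)) ->
  forall f, (forall k, co f k != 0 -> P (fgen (co f k) k)) -> P f.
Proof.
move=> P0 PD f Pf; rewrite (free_sumE (fsupp_uniq f) (@fsupp_out f)).
elim/big_ind: _ => // k _.
by have [->|/Pf//] := eqVneq (co f k) 0; rewrite fgen0.
Qed.

Section Extension.
Variables (V : zmodType) (phi : K -> R -> V).
Hypothesis phiD : forall k a b, phi k (a + b) = phi k a + phi k b.

(** Only additivity of [phi k] is asked: later uses are linear over [R] on the left, on the right,
    or merely additive. *)
Definition fext f := \sum_(k <- fsupp f) phi k (co f k).

Let phi0 k : phi k 0 = 0.
Proof. by apply: (addrI (phi k 0)); rewrite -phiD !addr0. Qed.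

Lemma fextE s f : uniq s -> (forall k, k \notin s -> co f k = 0) ->
  fext f = \sum_(k <- s) phi k (co f k).
Proof.
have sub s1 s2 : uniq s1 -> uniq s2 -> {subset s1 <= s2} ->
    (forall k, k \notin s1 -> co f k = 0) ->
    \sum_(k <- s1) phi k (co f k) = \sum_(k <- s2) phi k (co f k).
  move=> u1 u2 s12 H; rewrite [RHS](bigID (mem s1)) /= [X in _ + X]big1 ?addr0.
    rewrite -[RHS]big_filter; apply: perm_big; apply: uniq_perm => //.
      exact: filter_uniq.
    by move=> k; rewrite mem_filter; case: (boolP (k \in s1)) => // /s12.
  by move=> k /H ->.
move=> us Hs; set t := undup (fsupp f ++ s).
rewrite /fext (sub _ t (fsupp_uniq f) (undup_uniq _)) ?(sub s t) ?undup_uniq //.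
- by move=> k ks; rewrite mem_undup mem_cat ks orbT.
- by move=> k ks; rewrite mem_undup mem_cat ks.
- exact: fsupp_out.
Qed.

Lemma fext0 : fext 0 = 0.
Proof. by rewrite (@fextE [::]) ?big_nil. Qed.

Lemma fextD f g : fext (f + g) = fext f + fext g.
Proof.
set t := undup (fsupp f ++ fsupp g).
have Ht k : k \notin t -> co f k = 0 /\ co g k = 0.
  by rewrite mem_undup mem_cat negb_or => /andP[/fsupp_out -> /fsupp_out ->].
rewrite !(@fextE t) ?undup_uniq //; try by move=> k /Ht[].
  by rewrite -big_split; apply: eq_bigr => k _; rewrite coD phiD.
by move=> k /Ht[e1 e2]; rewrite coD e1 e2 addr0.
Qed.

Lemma fextU a k : fext (fgen a k) = phi k a.
Proof.
rewrite (@fextE [:: k]) ?big_seq1 ?coUU // => l.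
by rewrite inE coU => /negPf ->.
Qed.

End Extension.

Section LinearExtension.
Variables (N : lmodType R) (g : K -> N).

Let phiD k (a b : R) : (a + b) *: g k = a *: g k + b *: g k.
Proof. exact: scalerDl. Qed.

Fact flin_linear : linear (fext (fun k a => a *: g k)).
Proof.
move=> a f h; rewrite fextD //; congr (_ + _).
rewrite !(@fextE _ _ _ (fsupp f)) ?fsupp_uniq //; last 2 first.
- exact: fsupp_out.
- by move=> k /fsupp_out; rewrite coZ => ->; rewrite mulr0.
by rewrite scaler_sumr; apply: eq_bigr => k _; rewrite scalerA.
Qed.

Definition flin : {linear free_mod -> N} := mklin flin_linear.

Lemma flinU a k : flin (fgen a k) = a *: g k.
Proof. by rewrite mklinE fextU. Qed.

End LinearExtension.

End FreeModule.
Arguments co : simpl never.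

(** * Projective dimension *)

Section Homological.
Variable R : nzRingType.
Implicit Types M N P Q K A B C X Y Z : lmodType R.

Definition surj (T U : Type) (f : T -> U) := forall y, exists x, f x = y.

Definition ses K M N (i : {linear K -> M}) (p : {linear M -> N}) : Prop :=
  [/\ injective i, surj p & forall m, p m = 0 <-> exists k, i k = m].

Lemma linear_inj0 M N (f : {linear M -> N}) :
  (forall m, f m = 0 -> m = 0) -> injective f.
Proof.
move=> f0 u v e; apply/eqP; rewrite -subr_eq0; apply/eqP/f0.
by rewrite linearB e subrr.
Qed.

Lemma linear_inj_eq0 M N (f : {linear M -> N}) m :
  injective f -> f m = 0 -> m = 0.
Proof. by move=> fi; rewrite -[RHS](linear0 f) => /fi. Qed.

Lemma ses_ker M N (p : {linear M -> N}) : surj p ->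
  exists K (i : {linear K -> M}), ses i p.
Proof.
move=> sp; have [K [i [ii ik]]] := submodule_exists (is_submodule_ker p).
by exists K, i; split.
Qed.

Lemma projective_lift P M N (g : {linear M -> N}) (f : {linear P -> N}) :
  projective_module P -> surj g ->
  exists h : {linear P -> M}, forall x, g (h x) = f x.
Proof. by move=> hP sg; apply: hP. Qed.

Lemma projective_section P M (p : {linear M -> P}) :
  projective_module P -> surj p -> exists s : {linear P -> M}, cancel s p.
Proof.
by move=> hP sp; have [s sK] := hP _ _ p (idfun : {linear P -> P}) sp; exists s.
Qed.

Lemma projective_retract P M (s : {linear M -> P}) (p : {linear P -> M}) :
  cancel s p -> projective_module P -> projective_module M.
Proof.
move=> sK hP X Y g f sg.
have [h hE] := hP _ _ g (f \o p : {linear P -> Y}) sg.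
by exists (h \o s : {linear M -> X}) => m; rewrite /= hE /= sK.
Qed.

Lemma projective_free (I : choiceType) : projective_module (free_mod R I).
Proof.
move=> X Y g f sg; pose h i := sval (cid (sg (f (fgen 1 i)))).
have hE i : g (h i) = f (fgen 1 i) by rewrite /h; case: cid.
exists (flin h) => x.
apply: (free_ind (P := fun x => g (flin h x) = f x)) => [|u v hu hv|k _].
- by rewrite !linear0.
- by rewrite !linearD hu hv.
- by rewrite flinU linearZ hE -linearZ fgenZ mulr1.
Qed.

Definition free_cover M : {linear free_mod R M -> M} := flin (fun m : M => m).

Lemma free_cover_surj M : surj (free_cover M).
Proof. by move=> m; exists (fgen 1 m); rewrite flinU scale1r. Qed.

Fact pair_map_linear P Q M (f : {linear P -> M}) (g : {linear Q -> M}) :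
  linear (fun z : (P * Q)%type => f z.1 + g z.2).
Proof. by move=> a u v /=; rewrite !linearP scalerDr addrACA. Qed.
Definition pair_map P Q M (f : {linear P -> M}) (g : {linear Q -> M}) :
  {linear (P * Q)%type -> M} := mklin (pair_map_linear f g).

Fact pair_mk_linear P Q M (f : {linear M -> P}) (g : {linear M -> Q}) :
  linear (fun m => (f m, g m)).
Proof. by move=> a u v; rewrite !linearP. Qed.
Definition pair_mk P Q M (f : {linear M -> P}) (g : {linear M -> Q}) :
  {linear M -> (P * Q)%type} := mklin (pair_mk_linear f g).

Lemma projective_prod P Q :
  projective_module P -> projective_module Q ->
  projective_module (P * Q)%type.
Proof.
move=> hP hQ X Y g f sg.
have i1 : linear (fun x : P => (x, 0) : P * Q).
  by move=> a u v; congr (_, _); rewrite /= scaler0 addr0.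
have i2 : linear (fun x : Q => (0, x) : P * Q).
  by move=> a u v; congr (_, _); rewrite /= scaler0 addr0.
have [h1 e1] := projective_lift (f \o mklin i1 : {linear P -> Y}) hP sg.
have [h2 e2] := projective_lift (f \o mklin i2 : {linear Q -> Y}) hQ sg.
exists (pair_map h1 h2) => -[x y].
rewrite ?mklinE linearD e1 e2 /= -linearD; congr (f (_, _)).
  by rewrite /= addr0.
by rewrite /= add0r.
Qed.

(** Projective dimension at most [d], one short exact sequence at a time, so that dimension shifting
    is induction on [d]. The link with resolutions is [resolution_pdle] and [pdle_resolution]. *)
Fixpoint pdle (d : nat) M : Prop :=
  if d is d'.+1 then
    exists P K (i : {linear K -> P}) (p : {linear P -> M}),
      [/\ projective_module P, ses i p & pdle d' K]
  else projective_module M.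

Lemma ses_iso K P M N (i : {linear K -> P}) (p : {linear P -> M})
  (f : {linear M -> N}) : bijective f -> ses i p -> ses i (f \o p).
Proof.
move=> [g gK fK] [ii sp ek]; split=> // [y|m /=].
  by have [x e] := sp (g y); exists x; rewrite /= e fK.
rewrite -ek; split=> [e|->]; last by rewrite linear0.
by apply: (can_inj gK); rewrite e linear0.
Qed.

Lemma pdle_iso d M N (f : {linear M -> N}) :
  bijective f -> pdle d M -> pdle d N.
Proof.
case: d => [|d] /= bf.
  have fs : surj f by case: bf => g _ fK y; exists (g y).
  have [h [hK fK]] := inv_linear (bij_inj bf) fs.
  exact: projective_retract hK.
move=> [P [K [i [p [hP hs hK]]]]].
by exists P, K, i, (f \o p : {linear P -> N}); split=> //; apply: ses_iso.
Qed.

Lemma ses_split K X P (i : {linear K -> X}) (p : {linear X -> P}) :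
  ses i p -> projective_module P ->
  exists f : {linear (K * P)%type -> X}, bijective f.
Proof.
move=> [ii sp ek] hP; have [s sK] := projective_section hP sp.
have pi0 k : p (i k) = 0 by apply/ek; exists k.
have inj : injective (pair_map i s).
  apply: linear_inj0 => -[k x] /=; rewrite /= => e.
  have x0 : x = 0.
    by move/(congr1 p): e; rewrite linearD pi0 add0r sK linear0.
  by move: e; rewrite x0 linear0 addr0 => /(linear_inj_eq0 ii) ->.
have srj : surj (pair_map i s).
  move=> x; have [k ik] : exists k, i k = x - s (p x).
    by apply/ek; rewrite linearB sK subrr.
  by exists (k, p x); rewrite /= ik subrK.
by have [g [g1 g2]] := inv_linear inj srj; exists (pair_map i s), g.
Qed.

Lemma pdle_prod_projective d M Q :
  projective_module Q -> pdle d M -> pdle d (M * Q)%type.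
Proof.
case: d => [|d] hQ /=; first by move=> hM; apply: projective_prod.
move=> [P [K [i [p [hP [ii sp ek] hK]]]]].
have li : linear (fun k => (i k, 0) : P * Q).
  by move=> a u v; congr (_, _); rewrite /= ?linearP // scaler0 addr0.
have lp : linear (fun z : P * Q => (p z.1, z.2)).
  by move=> a [u u'] [v v'] /=; rewrite linearP.
exists (P * Q)%type, K, (mklin li), (mklin lp); split=> //.
  exact: projective_prod.
split=> [u v [/ii]//|[m q]|[x q]].
  by have [x <-] := sp m; exists (x, q).
rewrite /=; split=> [[/ek[k <-] ->]|[k [<- <-]]]; first by exists k.
by congr (_, _); apply/ek; exists k.
Qed.

(** A cover [P -> M * Q] followed by the projection to [Q] splits. The kernel [P1] of the composite
    is a retract of [P], and it covers [M] with the same kernel [K]. *)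
Lemma pdle_prod_cancel d M Q :
  projective_module Q -> pdle d (M * Q)%type -> pdle d M.
Proof.
move=> hQ.
have l1 : linear (fun m : M => (m, 0) : M * Q).
  by move=> a u v; congr (_, _); rewrite /= scaler0 addr0.
have f1 : linear (fun z : M * Q => z.1) by move=> a [? ?] [? ?].
have f2 : linear (fun z : M * Q => z.2) by move=> a [? ?] [? ?].
case: d => [|d] /=.
  by apply: (projective_retract (s := mklin l1) (p := mklin f1)).
move=> [P [K [i [p [hP [ii sp ek] hK]]]]].
pose p2 := mklin f2 \o p : {linear P -> Q}.
have sp2 : surj p2 by move=> q; have [x e] := sp (0, q); exists x; rewrite /= e.
have [s sK] := projective_section hQ sp2.
have [P1 [j [ji _ jk]]] := ses_ker sp2.
have lr : linear (fun x => x - s (p2 x)).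
  by move=> a u v; rewrite (linearP p2) (linearP s) scalerBr opprD addrACA.
have [r rE] := factor_inj (f := mklin lr) ji (fun x => (proj1 (jk _))
  (eq_trans (linearB p2 _ _) (eq_trans (congr1 (+%R _ \o -%R) (sK _)) (subrr _)))).
have rj : cancel j r.
  move=> x; apply: ji; rewrite rE mklinE.
  have -> : p2 (j x) = 0 by apply/jk; exists x.
  by rewrite linear0 subr0.
have ik k : exists x, j x = i k.
  apply/jk; rewrite /p2 /=; have -> : p (i k) = 0 by apply/ek; exists k.
  by rewrite linear0.
have [i1 i1E] := factor_inj ji ik.
exists P1, K, i1, (mklin f1 \o (p \o j) : {linear P1 -> M}); split=> //.
  exact: projective_retract hP.
split=> [u v e|m|x]; first by apply: ii; rewrite -!i1E e.
  have [x e] := sp (m, 0); have [y yE] : exists y, j y = x.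
    by apply/jk; rewrite /= e.
  by exists y; rewrite /= yE e.
rewrite /=; split=> [e|[k <-]]; last first.
  by rewrite i1E; have -> : p (i k) = 0 by apply/ek; exists k.
have [k kE] : exists k, i k = j x.
  apply/ek; have : p2 (j x) = 0 by apply/jk; exists x.
  by rewrite /p2 /=; case: (p (j x)) e => /= a b -> ->.
by exists k; apply: ji; rewrite i1E.
Qed.

(** The pullback [X] of the two covers is an extension of [P] by [K'] and of [P'] by [K]. Both
    split, so [K' * P] and [K * P'] are isomorphic, and [P'] is cancelled. *)
Lemma schanuel d M P K (i : {linear K -> P}) (p : {linear P -> M}) :
  projective_module P -> ses i p -> pdle d.+1 M -> pdle d K.
Proof.
move=> hP [ii sp ek] [P' [K' [i' [p' [hP' [ii' sp' ek'] hK']]]]].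
have lg : linear (fun z : P * P' => p z.1 - p' z.2).
  by move=> a [? ?] [? ?] /=; rewrite (linearP p) (linearP p') scalerBr opprD addrACA.
have [X [j [ji jk]]] := submodule_exists (is_submodule_ker (mklin lg)).
have f1 : linear (fun z : P * P' => z.1) by move=> a [? ?] [? ?].
have f2 : linear (fun z : P * P' => z.2) by move=> a [? ?] [? ?].
have jE x : p (j x).1 = p' (j x).2.
  by apply/eqP; rewrite -subr_eq0; apply/eqP/jk; exists x.
have inX u v : p u = p' v -> exists x, j x = (u, v).
  by move=> e; apply/jk; rewrite /= e subrr.
have l1 : linear (fun k' => (0, i' k') : P * P').
  by move=> a u v; congr (_, _); rewrite /= ?linearP // scaler0 addr0.
have l2 : linear (fun k => (i k, 0) : P * P').
  by move=> a u v; congr (_, _); rewrite /= ?linearP // scaler0 addr0.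
have [a aE] : exists a : {linear K' -> X}, forall k, j (a k) = mklin l1 k.
  apply: factor_inj => // k; apply: inX; rewrite linear0; apply/esym/ek'.
  by exists k.
have [b bE] : exists b : {linear K -> X}, forall k, j (b k) = mklin l2 k.
  by apply: factor_inj => // k; apply: inX; rewrite linear0; apply/ek; exists k.
have sesa : ses a (mklin f1 \o j : {linear X -> P}).
  split=> [u v e|u|x /=]; rewrite ?mklinE.
  - have : mklin l1 u = mklin l1 v by rewrite -!aE e.
    by rewrite ?mklinE => -[/ii'].
  - by have [v e] := sp' (p u); have [x jx] := inX u v (esym e); exists x; rewrite /= jx.
  - split=> [e|[k <-]]; last by rewrite aE.
    have [k kE] : exists k, i' k = (j x).2 by apply/ek'; rewrite -jE e linear0.
    exists k; apply: ji; rewrite aE mklinE kE.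
    by case: (j x) e => /= ? ? ->.
have sesb : ses b (mklin f2 \o j : {linear X -> P'}).
  split=> [u v e|u|x /=]; rewrite ?mklinE.
  - have : mklin l2 u = mklin l2 v by rewrite -!bE e.
    by rewrite ?mklinE => -[/ii].
  - by have [v e] := sp (p' u); have [x jx] := inX v u e; exists x; rewrite /= jx.
  - split=> [e|[k <-]]; last by rewrite bE.
    have [k kE] : exists k, i k = (j x).1 by apply/ek; rewrite jE e linear0.
    exists k; apply: ji; rewrite bE mklinE kE.
    by case: (j x) e => /= ? ? ->.
have [f bf] := ses_split sesa hP; have [g bg] := ses_split sesb hP'.
have gs : surj g by case: bg => h _ gK y; exists (h y).
have [g' [g'K gK]] := inv_linear (bij_inj bg) gs.
apply: (pdle_prod_cancel hP'); apply: (pdle_iso (f := g')); first by exists g.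
by apply: (pdle_iso bf); apply: pdle_prod_projective.
Qed.

Lemma pdle_succ d M : pdle d M -> pdle d.+1 M.
Proof.
elim: d M => [|d IH] M hM; last first.
  move: hM => [P [K [i [p [hP hs hK]]]]].
  by exists P, K, i, p; split=> //; apply: IH.
have sid : surj (idfun : {linear M -> M}) by move=> y; exists y.
have [K [i hi]] := ses_ker sid.
exists M, K, i, (idfun : {linear M -> M}); split=> //= X Y g f sg.
have l0 : linear (fun _ : K => 0 : X).
  by move=> a u v; rewrite scaler0 addr0.
exists (mklin l0) => k; rewrite ?mklinE linear0.
have -> : k = 0.
  have [ii _ ek] := hi; apply: (linear_inj_eq0 ii).
  by apply: (proj2 (ek (i k))); exists k.
by rewrite linear0.
Qed.

Lemma pdle_mono d e M : (d <= e)%N -> pdle d M -> pdle e M.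
Proof.
by move=> /subnKC <-; elim: (e - d)%N => [|k IH]; rewrite ?addn0 // addnS => /IH/pdle_succ.
Qed.

(** Horseshoe lemma: the cover of [C] lifts to [B], so [P * Q] covers [B], and its kernel is an
    extension of [C1] by [A1]. *)
Lemma pdle_ses_mid d A B C (i : {linear A -> B}) (p : {linear B -> C}) :
  ses i p -> pdle d A -> pdle d C -> pdle d B.
Proof.
elim: d A B C i p => [|d IH] A B C i p hs.
  move=> hA hC; have [f bf] := ses_split hs hC.
  by apply: (@pdle_iso 0 _ _ f) => //; apply: projective_prod.
have [ii sp ek] := hs.
move=> [P [A1 [ia [pa [hP [iai spa eka] hA1]]]]].
move=> [Q [C1 [ic [pc [hQ [ici spc ekc] hC1]]]]].
have [f fE] := projective_lift pc hQ sp.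
pose g := pair_map (i \o pa : {linear P -> B}) f.
have pi0 a : p (i a) = 0 by apply/ek; exists a.
have sg : surj g.
  move=> b; have [y yE] := spc (p b).
  have [a aE] : exists a, i a = b - f y by apply/ek; rewrite linearB fE yE subrr.
  have [x xE] := spa a; exists (x, y).
  by rewrite /= xE aE subrK.
have [K [j [ji _ jk]]] := ses_ker sg.
have jE k : i (pa (j k).1) + f (j k).2 = 0 by apply: (proj2 (jk _)); exists k.
have l1 : linear (fun a => (ia a, 0) : P * Q).
  by move=> a u v; congr (_, _); rewrite /= ?linearP // scaler0 addr0.
have f2 : linear (fun z : P * Q => z.2) by move=> a [? ?] [? ?].
have [u uE] : exists u : {linear A1 -> K}, forall k, j (u k) = mklin l1 k.
  apply: factor_inj => // k; apply/jk; rewrite /= linear0 addr0.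
  by have -> : pa (ia k) = 0; [apply/eka; exists k | rewrite linear0].
have [v vE] : exists v : {linear K -> C1}, forall k, ic (v k) = (mklin f2 \o j) k.
  apply: factor_inj => // k; apply/ekc; rewrite /=.
  move/(congr1 p): (jE k); rewrite linearD pi0 add0r fE linear0.
  by move=> e; apply: e.
exists (P * Q)%type, K, j, g; split=> //; first exact: projective_prod.
apply: (IH _ _ _ u v) hA1 hC1; split=> [x y e|c|k].
- have : mklin l1 x = mklin l1 y by rewrite -!uE e.
  by rewrite ?mklinE => -[/iai].
- have pc0 : pc (ic c) = 0 by apply/ekc; exists c.
  have [a aE] : exists a, i a = f (ic c) by apply/ek; rewrite fE.
  have [x xE] := spa a.
  have [k kE] : exists k, j k = (- x, ic c).
    by apply/jk; rewrite /= !linearN xE aE addNr.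
  by exists k; apply: ici; rewrite vE /= kE.
- split=> [v0|[a <-]].
    have k2 : (j k).2 = 0 by have := vE k; rewrite v0 linear0 /=.
    have k1 : pa (j k).1 = 0.
      by apply: (linear_inj_eq0 ii); have := jE k; rewrite k2 linear0 addr0.
    have [a aE] := proj1 (eka _) k1; exists a.
    by apply: ji; rewrite uE mklinE aE; case: (j k) k2 => /= ? ? ->.
  by apply: (linear_inj_eq0 ici); rewrite vE /= uE !mklinE.
Qed.

(** The kernel of the composite cover [Q -> B -> C] is an extension of [A] by the kernel of
    [Q -> B]. The next two lemmas use this diagram in place of a long exact sequence. *)
Lemma ses_ker_comp A B C Q B' (i : {linear A -> B}) (p : {linear B -> C})
  (ib : {linear B' -> Q}) (pb : {linear Q -> B}) :
  ses i p -> ses ib pb ->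
  exists C' (j : {linear C' -> Q}) (u : {linear B' -> C'}) (v : {linear C' -> A}),
    ses j (p \o pb : {linear Q -> C}) /\ ses u v.
Proof.
move=> [ii sp ek] [ibi spb ekb].
have s : surj (p \o pb : {linear Q -> C}).
  by move=> c; have [b <-] := sp c; have [q <-] := spb b; exists q.
have [C' [j hj]] := ses_ker s; have [ji _ jk] := hj.
have [u uE] : exists u : {linear B' -> C'}, forall b, j (u b) = ib b.
  apply: factor_inj => // b; apply/jk => /=.
  by have -> : pb (ib b) = 0; [apply/ekb; exists b | rewrite linear0].
have [v vE] : exists v : {linear C' -> A}, forall c, i (v c) = (pb \o j) c.
  by apply: factor_inj => // c; apply/ek; apply: (proj2 (jk (j c))); exists c.
exists C', j, u, v; split=> //; split=> [x y e|a|c].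
- by apply: ibi; rewrite -!uE e.
- have [q qE] := spb (i a); have [c cE] : exists c, j c = q.
    by apply/jk; rewrite /= qE; apply/ek; exists a.
  by exists c; apply: ii; rewrite vE /= cE.
- split=> [v0|[b <-]].
    have [b bE] : exists b, ib b = j c by apply/ekb; rewrite -[LHS]vE v0 linear0.
    by exists b; apply: ji; rewrite uE.
  by apply: (linear_inj_eq0 ii); rewrite vE /= uE; apply/ekb; exists b.
Qed.

Lemma pdle_ses_right d A B C (i : {linear A -> B}) (p : {linear B -> C}) :
  ses i p -> pdle d A -> pdle d.+1 B -> pdle d.+1 C.
Proof.
move=> hs hA [Q [B' [ib [pb [hQ hb hB']]]]].
have [C' [j [u [v [hj huv]]]]] := ses_ker_comp hs hb.
exists Q, C', j, (p \o pb : {linear Q -> C}); split=> //.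
exact: pdle_ses_mid huv hB' hA.
Qed.

Lemma pdle_ses_left d A B C (i : {linear A -> B}) (p : {linear B -> C}) :
  ses i p -> pdle d B -> pdle d.+1 C -> pdle d A.
Proof.
case: d => [|d] hs; first by move=> hB; apply: schanuel hs.
move=> [Q [B' [ib [pb [hQ hb hB']]]]] hC.
have [C' [j [u [v [hj huv]]]]] := ses_ker_comp hs hb.
by apply: pdle_ses_right huv hB' _; apply: schanuel hj hC.
Qed.

(** The cokernel has dimension at most [d.+1] by the global bound, which is just enough for
    [pdle_ses_left]. *)
Lemma pdle_sub d A B (i : {linear A -> B}) :
  (forall M, pdle d.+1 M) -> injective i -> pdle d B -> pdle d A.
Proof.
move=> hR ii hB.
have [C [p [sp kp]]] := quotient_exists (is_submodule_range i).
have hs : ses i p by split.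
exact: pdle_ses_left hs hB (hR C).
Qed.

Lemma zero_module_exists : exists Z : lmodType R, forall z : Z, z = 0.
Proof. by exists 'rV[R]_0 => z; apply/rowP=> -[]. Qed.

Lemma linear_zero M N : linear (fun _ : M => 0 : N).
Proof. by move=> a u v; rewrite scaler0 addr0. Qed.

Lemma projective_zero Z : (forall z : Z, z = 0) -> projective_module Z.
Proof.
move=> Z0 X Y g f _; exists (mklin (@linear_zero Z X)) => z.
by rewrite ?mklinE linear0 (Z0 z) linear0.
Qed.

Lemma resolution_pdle d M : proj_resolution_length M d -> pdle d M.
Proof.
elim: d M => [|d IH] M [P [f [e [hP se ke kf hd]]]].
  have ei : injective e.
    apply: linear_inj0 => x /ke [q <-].
    by rewrite (hd 1%N _ q) // linear0.
  have [g [gK eK]] := inv_linear ei se.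
  by apply: (@pdle_iso 0 _ _ e); [exists g | apply: hP].
have [K [i hi]] := ses_ker se; have [ii _ ik] := hi.
have [e' e'E] : exists e' : {linear P 1%N -> K}, forall q, i (e' q) = f 0%N q.
  by apply: factor_inj => // q; apply/ik/ke; exists q.
exists (P 0%N), K, i, e; split=> //; apply: IH.
exists (fun k => P k.+1), (fun k => f k.+1), e'; split=> //.
- by move=> k; have [q qE] := proj1 (ke _) (proj2 (ik (i k)) (ex_intro _ k erefl));
     exists q; apply: ii; rewrite e'E.
- move=> q; rewrite -kf -e'E; split=> [->|/(linear_inj_eq0 ii)//].
  exact: linear0.
- by move=> k kd; apply: hd.
Qed.

Lemma pdle_resolution d M : pdle d M -> proj_resolution_length M d.
Proof.
have [Z Z0] := zero_module_exists.
elim: d M => [|d IH] M.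
  move=> hM; pose P k := if k is _.+1 then Z else M.
  exists P, (fun k => mklin (@linear_zero (P k.+1) (P k))),
    (idfun : {linear P 0%N -> M}); split=> //.
  - by case=> [|k] //; apply: projective_zero.
  - by move=> y; exists y.
  - by move=> p /=; split=> [->|[q <-]]; first by exists 0.
  - by move=> k p; split=> _; [exists 0; rewrite ?mklinE (Z0 p)|rewrite ?mklinE].
  - by case.
move=> [P0 [K [i [p [hP0 [ii sp ek] /IH [P' [f' [e' [hP se ke kf hd]]]]]]]]].
pose P k := if k is k'.+1 then P' k' else P0.
pose f k : {linear P k.+1 -> P k} :=
  match k return {linear P k.+1 -> P k} with
  | 0%N => (i \o e' : {linear P' 0%N -> P0})
  | k'.+1 => f' k'
  end.
exists P, f, p; split=> //.
- by case.
- move=> x; rewrite ek; split=> [[k <-]|[q <-]]; last by exists (e' q).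
  by have [q <-] := se k; exists q.
- case=> [|k] q; last exact: kf.
  rewrite /= -ke; split=> [/(linear_inj_eq0 ii)//|->]; exact: linear0.
- by case=> // k kd; apply: hd.
Qed.

Lemma nat_infP (P : set nat) d : (forall k l, (k <= l)%N -> P k -> P l) ->
  (nat_inf P <= (Posz d)%:E)%E <-> P d.
Proof.
move=> mP; rewrite /nat_inf; case: pselect => [ex|nex]; last first.
  by split=> [//|Pd]; case: nex; exists d; apply/asboolP.
case: ex_minnP => m /asboolP Pm mmin; rewrite lee_fin lez_nat; split=> [md|Pd].
  exact: mP Pm.
by apply/mmin/asboolP.
Qed.

Lemma nat_inf_cases (P : set nat) :
  nat_inf P = +oo%E \/ exists2 d, P d & nat_inf P = (Posz d)%:E.
Proof.
rewrite /nat_inf; case: pselect => [ex|nex]; last by left.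
by right; case: ex_minnP => m /asboolP Pm _; exists m.
Qed.

Lemma pdP d M : (pd M <= (Posz d)%:E)%E <-> pdle d M.
Proof.
rewrite nat_infP => [|k l kl /resolution_pdle h]; last first.
  by apply: pdle_resolution; apply: pdle_mono kl h.
by split=> [/resolution_pdle|/pdle_resolution].
Qed.

Lemma lgldP d : (lgld R <= (Posz d)%:E)%E <-> forall M, pdle d M.
Proof.
rewrite nat_infP => [|k l kl h M]; last first.
  by apply: le_trans (h M) _; rewrite lee_fin lez_nat.
by split=> h M; apply/pdP/h.
Qed.

Lemma lgld_cases : lgld R = +oo%E \/ exists d, lgld R = (Posz d)%:E.
Proof.
rewrite /lgld; set S := (X in nat_inf X).
by have [->|[d _ ->]] := nat_inf_cases S; [left|right; exists d].
Qed.

End Homological.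

(** * Multiplication of standard monomials *)

Section Exponents.
Variable n : nat.
Local Notation mn := {ffun 'I_n -> nat}.
Implicit Types a b c : mn.

Definition mzero : mn := [ffun=> 0%N].
Definition munit (i : 'I_n) : mn := [ffun k => nat_of_bool (k == i)].
Definition madd (a b : mn) : mn := [ffun k => (a k + b k)%N].
Definition mpred (i : 'I_n) (a : mn) : mn := [ffun k => (a k - (k == i))%N].
Definition mdeg (a : mn) : nat := \sum_(i < n) a i.

Lemma maddC a b : madd a b = madd b a.
Proof. by apply/ffunP=> k; rewrite !ffunE addnC. Qed.

Lemma maddA a b c : madd a (madd b c) = madd (madd a b) c.
Proof. by apply/ffunP=> k; rewrite !ffunE addnA. Qed.

Lemma maddCA a b c : madd a (madd b c) = madd b (madd a c).
Proof. by apply/ffunP=> k; rewrite !ffunE addnCA. Qed.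

Lemma madd0 a : madd a mzero = a.
Proof. by apply/ffunP=> k; rewrite !ffunE addn0. Qed.

Lemma mdegD a b : mdeg (madd a b) = (mdeg a + mdeg b)%N.
Proof. by rewrite /mdeg -big_split; apply: eq_bigr => k _; rewrite ffunE. Qed.

Lemma mdegU i : mdeg (munit i) = 1%N.
Proof.
rewrite /mdeg (bigD1 i) //= ffunE eqxx big1 // => k /negPf ki.
by rewrite ffunE ki.
Qed.

Lemma mdeg0 : mdeg mzero = 0%N.
Proof. by rewrite /mdeg big1 // => k _; rewrite ffunE. Qed.

Lemma mdeg_eq0 a : mdeg a = 0%N -> a = mzero.
Proof.
move/eqP; rewrite sum_nat_eq0 => /forallP h.
by apply/ffunP=> k; rewrite ffunE; apply/eqP/(implyP (h k)).
Qed.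

Lemma mpredK i a : (0 < a i)%N -> madd (munit i) (mpred i a) = a.
Proof.
move=> ai; apply/ffunP=> k; rewrite !ffunE.
by case: eqVneq => [->|_]; rewrite ?subn0 // subnKC.
Qed.

Lemma madd_munitK i a : mpred i (madd (munit i) a) = a.
Proof. by apply/ffunP=> k; rewrite !ffunE addKn. Qed.

Lemma msupp_min (P : pred 'I_n) i : P i ->
  exists2 j, P j & forall k : 'I_n, (k < j)%N -> ~~ P k.
Proof.
move=> Pi; case: (arg_minnP (fun k : 'I_n => val k) Pi) => j Pj jmin.
by exists j => // k kj; apply: contraL kj => /jmin; rewrite -leqNgt.
Qed.

Lemma mneq0_min a : (0 < mdeg a)%N ->
  exists2 j, (0 < a j)%N & forall k : 'I_n, (k < j)%N -> a k = 0%N.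
Proof.
move=> da; have /existsP[i ai] : [exists i, (0 < a i)%N].
  apply: contraLR da; rewrite negb_exists -leqNgt => /forallP a0.
  by rewrite leqn0 sum_nat_eq0; apply/forallP=> i; rewrite /= -leqn0 leqNgt a0.
have [j aj jmin] := msupp_min (P := fun i => (0 < a i)%N) ai.
by exists j => // k /jmin; rewrite lt0n negbK => /eqP.
Qed.

Lemma mdeg_mpred j a : (0 < a j)%N -> mdeg a = (mdeg (mpred j a)).+1.
Proof. by move=> aj; rewrite -{1}(mpredK aj) mdegD mdegU. Qed.

End Exponents.

Section PBW.
Variables (R A : nzRingType) (iota : {rmorphism R -> A}).
Variables (n : nat) (x : 'I_n -> A).
Local Notation mn := {ffun 'I_n -> nat}.
Local Notation mon := (pbw_mon x).

Lemma mon0 : mon (mzero n) = 1.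
Proof. by rewrite /pbw_mon big1 // => i _; rewrite ffunE expr0. Qed.

(** Monomials list the variables in increasing order, so a front factor [x j] is already in place
    when no smaller variable occurs; there are no lower terms. Sorted lists of indices make an
    induction possible. *)
Lemma mon_step (j : 'I_n) (a : mn) : (forall k : 'I_n, (k < j)%N -> a k = 0%N) ->
  x j * mon a = mon (madd (munit j) a).
Proof.
move=> aj; rewrite /pbw_mon.
have -> : index_enum 'I_n = enum 'I_n by rewrite [index_enum _]unlock enumT.
suff H (s : seq 'I_n) : sorted ltn (map val s) -> j \in s ->
    x j * \prod_(i <- s) x i ^+ a i = \prod_(i <- s) x i ^+ madd (munit j) a i.
  by apply: H; rewrite ?mem_enum // val_enum_ord iota_ltn_sorted.
elim: s => // i s IH; rewrite /= (path_sortedE ltn_trans) => /andP[/allP is' ss].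
rewrite in_cons !big_cons ffunE [munit j i]ffunE mulrA.
case: eqVneq => [ij _|ij /= js]; last first.
  have lij : (i < j)%N by apply: is'; apply: map_f.
  by rewrite aj // !expr0 mulr1 mul1r IH.
rewrite -ij -exprS add1n; congr (_ * _); apply: eq_big_seq => k ks.
rewrite !ffunE; have : (i < k)%N by apply: is'; apply: map_f.
by rewrite ltn_neqAle eq_sym => /andP[/negPf ki _]; rewrite -val_eqE /= ij ki.
Qed.

Lemma monU i : mon (munit i) = x i.
Proof.
rewrite -(madd0 (munit i)) -mon_step ?mon0 ?mulr1 // => k _.
by rewrite ffunE.
Qed.

Hypothesis hfree : pbw_basis iota x.

Definition pbw_eval (f : free_mod R mn) : A :=
  fext (fun a r => iota r * mon a) f.

Let phiD (a : mn) (r s : R) : iota (r + s) * mon a = iota r * mon a + iota s * mon a.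
Proof. by rewrite rmorphD mulrDl. Qed.

Lemma pbw_eval0 : pbw_eval 0 = 0.
Proof. exact: fext0. Qed.

Lemma pbw_evalD f g : pbw_eval (f + g) = pbw_eval f + pbw_eval g.
Proof. exact: fextD. Qed.

Lemma pbw_evalU r a : pbw_eval (fgen r a) = iota r * mon a.
Proof. exact: fextU. Qed.

Lemma pbw_evalN f : pbw_eval (- f) = - pbw_eval f.
Proof. by apply/eqP; rewrite -addr_eq0 -pbw_evalD addNr pbw_eval0. Qed.

Lemma pbw_evalZ r f : pbw_eval (r *: f) = iota r * pbw_eval f.
Proof.
apply: (free_ind (P := fun f => pbw_eval (r *: f) = iota r * pbw_eval f)).
- by rewrite scaler0 pbw_eval0 mulr0.
- by move=> g h hg hh; rewrite scalerDr !pbw_evalD hg hh mulrDr.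
- by move=> k _; rewrite fgenZ !pbw_evalU rmorphM mulrA.
Qed.

Lemma pbw_eval_inj f : pbw_eval f = 0 -> f = 0.
Proof.
move=> e; apply: co_inj => a; rewrite co0.
have [s [us Hs]] := fsupp_exists f.
have [as'|/Hs//] := boolP (a \in s).
apply: (proj2 hfree s (co f)) as' => //.
by rewrite -[RHS]e /pbw_eval (fextE _ us Hs).
Qed.

Lemma pbw_eval_surj a : exists f, pbw_eval f = a.
Proof.
have [s [c ->]] := proj1 hfree a; elim: s => [|b s [f fE]].
  by exists 0; rewrite big_nil pbw_eval0.
by exists (fgen (c b) b + f); rewrite big_cons pbw_evalD pbw_evalU fE.
Qed.

Definition pbw_coef (a : A) : free_mod R mn := sval (cid (pbw_eval_surj a)).

Lemma pbw_coefK a : pbw_eval (pbw_coef a) = a.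
Proof. by rewrite /pbw_coef; case: cid. Qed.

Lemma pbw_evalK f : pbw_coef (pbw_eval f) = f.
Proof.
apply/eqP; rewrite -subr_eq0; apply/eqP/pbw_eval_inj.
by rewrite pbw_evalD pbw_evalN pbw_coefK subrr.
Qed.

Definition cf (a : A) (m : mn) : R := co (pbw_coef a) m.

Lemma cfE a m : cf a m = co (pbw_coef a) m. Proof. by []. Qed.

Lemma cf_ext a b : cf a =1 cf b -> a = b.
Proof. by move=> e; rewrite -(pbw_coefK a) -(pbw_coefK b); congr pbw_eval; apply: co_inj. Qed.

Lemma pbw_coefD a b : pbw_coef (a + b) = pbw_coef a + pbw_coef b.
Proof. by rewrite -{1}(pbw_coefK a) -{1}(pbw_coefK b) -pbw_evalD pbw_evalK. Qed.

Lemma pbw_coefZ r a : pbw_coef (iota r * a) = r *: pbw_coef a.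
Proof. by rewrite -{1}(pbw_coefK a) -pbw_evalZ pbw_evalK. Qed.

Lemma cfD a b m : cf (a + b) m = cf a m + cf b m.
Proof. by rewrite /cf pbw_coefD coD. Qed.

Lemma cfZ r a m : cf (iota r * a) m = r * cf a m.
Proof. by rewrite /cf pbw_coefZ coZ. Qed.

Lemma cf0 m : cf 0 m = 0.
Proof. by rewrite -(mul0r 1) -(rmorph0 iota) cfZ mul0r. Qed.

Lemma cfN a m : cf (- a) m = - cf a m.
Proof. by apply/eqP; rewrite -addr_eq0 -cfD addNr cf0. Qed.

Lemma cfB a b m : cf (a - b) m = cf a m - cf b m.
Proof. by rewrite cfD cfN. Qed.

Lemma cfU r m l : cf (iota r * mon m) l = if l == m then r else 0.
Proof. by rewrite /cf -pbw_evalU pbw_evalK coU. Qed.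

Lemma cf_mon m l : cf (mon m) l = if l == m then 1 else 0.
Proof. by rewrite -cfU rmorph1 mul1r. Qed.

Lemma cf_supp a : exists s : seq mn, forall m, m \notin s -> cf a m = 0.
Proof. exact: finsupp_co. Qed.

Definition sp (Q : mn -> Prop) (a : A) : Prop := forall m, cf a m != 0 -> Q m.

(** Reduces an additive statement about elements with support in [Q] to single terms; most support
    estimates below go through it. *)
Lemma sp_ind (Q : mn -> Prop) (P : A -> Prop) : P 0 ->
  (forall a b, P a -> P b -> P (a + b)) ->
  (forall r m, Q m -> P (iota r * mon m)) -> forall a, sp Q a -> P a.
Proof.
move=> P0 PD PQ a Qa; rewrite -(pbw_coefK a).
apply: (free_ind (P := fun f => P (pbw_eval f))) => [|f g|k ck].
- by rewrite pbw_eval0.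
- by rewrite pbw_evalD; apply: PD.
- by rewrite pbw_evalU; apply/PQ/Qa.
Qed.

Lemma sp_0 Q : sp Q 0.
Proof. by move=> m; rewrite cf0 eqxx. Qed.

Lemma sp_D Q a b : sp Q a -> sp Q b -> sp Q (a + b).
Proof.
move=> ha hb m; rewrite cfD => h.
have [e|/ha//] := eqVneq (cf a m) 0; apply: hb; by rewrite e add0r in h.
Qed.

Lemma sp_Z Q r a : sp Q a -> sp Q (iota r * a).
Proof.
move=> ha m; rewrite cfZ => h; apply: ha.
by apply: contraNneq h => ->; rewrite mulr0.
Qed.

Lemma sp_N Q a : sp Q a -> sp Q (- a).
Proof. by move=> ha m; rewrite cfN oppr_eq0; apply: ha. Qed.

Lemma sp_B Q a b : sp Q a -> sp Q b -> sp Q (a - b).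
Proof. by move=> ha hb; apply: sp_D => //; apply: sp_N. Qed.

Lemma sp_U (Q : mn -> Prop) r m : Q m -> sp Q (iota r * mon m).
Proof. by move=> Qm l; rewrite cfU; case: (l =P m) => [->|_] //; rewrite eqxx. Qed.

Lemma sp_mon (Q : mn -> Prop) m : Q m -> sp Q (mon m).
Proof. by move=> Qm; rewrite -[mon m]mul1r -(rmorph1 iota); apply: sp_U. Qed.

Lemma sp_sub (Q Q' : mn -> Prop) a : (forall m, Q m -> Q' m) -> sp Q a -> sp Q' a.
Proof. by move=> QQ' ha m /ha/QQ'. Qed.

Lemma sp_sum Q (I : Type) (r : seq I) (P : pred I) (F : I -> A) :
  (forall i, P i -> sp Q (F i)) -> sp Q (\sum_(i <- r | P i) F i).
Proof. by move=> h; apply: big_ind; [apply: sp_0|move=> *; apply: sp_D|]. Qed.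

Hypothesis hbij : pbw_bijective iota x.

Definition sig (i : 'I_n) : R -> R := sval (cid (proj1 hbij i)).

Lemma sigP i r : exists d, x i * iota r = iota (sig i r) * x i + iota d.
Proof. by rewrite /sig; case: cid => s hs; apply: (proj1 hs). Qed.

Lemma sig_bij i : bijective (sig i).
Proof. by rewrite /sig; case: cid => s hs; apply: (proj2 hs). Qed.

Definition delta i r : R := sval (cid (sigP i r)).

Lemma xiota i r : x i * iota r = iota (sig i r) * x i + iota (delta i r).
Proof. by rewrite /delta; case: cid. Qed.

Lemma cf_iota r m : cf (iota r) m = if m == mzero n then r else 0.
Proof. by rewrite -(mulr1 (iota r)) -mon0 cfU. Qed.

Lemma munit_neq0 i : (munit i == mzero n) = false.
Proof. by apply/eqP=> /(congr1 (@mdeg n)); rewrite mdegU mdeg0. Qed.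

(** Freeness determines [sig i], so its additivity and multiplicativity are read off from any
    rewriting of [x i * iota r]. *)
Lemma sig_uniq i r s d : x i * iota r = iota s * x i + iota d -> s = sig i r.
Proof.
rewrite xiota -monU => /(congr1 (fun a => cf a (munit i))).
by rewrite !cfD !cfU !cf_iota munit_neq0 eqxx !addr0.
Qed.

Lemma sigD i r s : sig i (r + s) = sig i r + sig i s.
Proof.
apply/esym/(@sig_uniq _ _ _ (delta i r + delta i s)).
by rewrite rmorphD mulrDr !xiota !rmorphD mulrDl addrACA.
Qed.

Lemma sigM i r s : sig i (r * s) = sig i r * sig i s.
Proof.
apply/esym/(@sig_uniq _ _ _ (sig i r * delta i s + delta i r * s)).
rewrite rmorphM mulrA xiota mulrDl -mulrA xiota mulrDr.
by rewrite mulrA -!rmorphM -addrA -rmorphD.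
Qed.

Lemma sig1 i : sig i 1 = 1.
Proof.
by apply/esym/(@sig_uniq _ _ _ 0); rewrite !rmorph1 rmorph0 mulr1 mul1r addr0.
Qed.

Lemma sig0 i : sig i 0 = 0.
Proof. by apply: (addrI (sig i 0)); rewrite -sigD !addr0. Qed.

Lemma sig_unit i r : two_sided_unit r -> two_sided_unit (sig i r).
Proof. by move=> [s [rs sr]]; exists (sig i s); rewrite -!sigM rs sr sig1. Qed.

Lemma unit_mul (r s : R) :
  two_sided_unit r -> two_sided_unit s -> two_sided_unit (r * s).
Proof.
move=> [r' [rr' r'r]] [s' [ss' s's]]; exists (s' * r'); split.
  by rewrite mulrA -(mulrA r) ss' mulr1.
by rewrite mulrA -(mulrA s') r'r mulr1.
Qed.

Lemma unit1 : two_sided_unit (1 : R).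
Proof. by exists 1; rewrite mulr1. Qed.

Lemma unit_mul_neq0 (u r : R) : two_sided_unit u -> r != 0 -> r * u != 0.
Proof.
move=> [v [uv _]]; apply: contraNneq => /(congr1 (fun y => y * v)).
by rewrite -mulrA uv mulr1 mul0r => ->.
Qed.

Definition lo d := sp (fun m => (mdeg m < d)%N).

Lemma lo_le d e a : (d <= e)%N -> lo d a -> lo e a.
Proof. by move=> de; apply: sp_sub => m h; apply: leq_trans h de. Qed.

(** Sorting, by induction on the degree of [b]. If the least variable [j] of [b] precedes [i],
    exchanging [x i] and [x j] costs the unit [c] and an affine error, and the unit [u] of the
    inductive step becomes [sig j u] when it passes [x j]. *)
Lemma x_mon i (b : mn) : exists u, two_sided_unit u /\
  lo (mdeg b).+1 (x i * mon b - iota u * mon (madd (munit i) b)).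
Proof.
have [m] := ubnP (mdeg b); elim: m i b => // m IH i b; rewrite ltnS => bm.
have exact_case : (forall k : 'I_n, (k < i)%N -> b k = 0%N) ->
    exists u, two_sided_unit u /\
      lo (mdeg b).+1 (x i * mon b - iota u * mon (madd (munit i) b)).
  move=> h; exists 1; split; first exact: unit1.
  by rewrite mon_step // rmorph1 mul1r subrr; apply: sp_0.
have [/mdeg_eq0 b0|b_gt0] := posnP (mdeg b).
  by apply: exact_case => k _; rewrite b0 ffunE.
have [j bj bmin] := mneq0_min b_gt0.
have [ij|ji] := leqP i j.
  by apply: exact_case => k ki; apply: bmin; apply: leq_trans ki ij.
set b' := mpred j b.
have db : mdeg b = (mdeg b').+1 by apply: mdeg_mpred.
have xj : mon b = x j * mon b'.
  rewrite mon_step ?mpredK // => k kj.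
  by rewrite ffunE bmin.
(* This is [x_lo] in the degrees that the induction hypothesis covers. *)
have step k d c : (d <= mdeg b)%N -> lo d c -> lo d.+1 (x k * c).
  move=> dm; apply: (sp_ind (P := fun c => lo d.+1 (x k * c))) => [|p q|r l ld].
  - by rewrite mulr0; apply: sp_0.
  - by rewrite mulrDr; apply: sp_D.
  - rewrite mulrA xiota mulrDl; apply: sp_D; last first.
      by apply: sp_U; apply: ltnW.
    rewrite -mulrA; apply: sp_Z.
    have [u [_ hu]] := IH k l (leq_trans ld (leq_trans dm bm)).
    rewrite -(subrK (iota u * mon (madd (munit k) l)) (_ * _)).
    apply: sp_D; first by apply: lo_le hu; apply: ltnW.
    by apply: sp_U; rewrite mdegD mdegU add1n.
have [c [uc [r0 [r cE]]]] := proj2 hbij j i ji.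
have b'm : (mdeg b' < m)%N by rewrite -db.
have [u [uu hu]] := IH i b' b'm.
exists (c * sig j u); split; first by apply: unit_mul => //; apply: sig_unit.
have aff : lo (mdeg b).+1 ((x i * x j - iota c * (x j * x i)) * mon b').
  rewrite cE mulrDl; apply: sp_D.
    by apply: sp_U; rewrite ltnS db ltnW.
  rewrite mulr_suml; apply: sp_sum => k _; rewrite -mulrA; apply: sp_Z.
  by apply: step; rewrite ?db //; apply: sp_mon.
have e1 : x j * mon (madd (munit i) b') = mon (madd (munit i) b).
  rewrite mon_step ?[madd (munit j) _]maddCA ?mpredK // => k kj.
  rewrite !ffunE bmin // sub0n addn0; case: eqP => // ki.
  by move: kj; rewrite ki ltnNge ltnW.
have e2 : iota c * (x j * (x i * mon b' - iota u * mon (madd (munit i) b'))) =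
    iota c * (x j * (x i * mon b')) - iota (c * sig j u) * mon (madd (munit i) b)
    - iota (c * delta j u) * mon (madd (munit i) b').
  rewrite [x j * (_ - _)]mulrBr [x j * (iota u * _)]mulrA xiota mulrDl -!mulrA e1.
  by rewrite mulrBr mulrDr opprD !mulrA -!rmorphM addrA.
have -> : x i * mon b - iota (c * sig j u) * mon (madd (munit i) b) =
    (x i * x j - iota c * (x j * x i)) * mon b' +
    (iota c * (x j * (x i * mon b' - iota u * mon (madd (munit i) b')))
     + iota (c * delta j u) * mon (madd (munit i) b')).
  by rewrite e2 subrK xj mulrBl !mulrA addrA subrK.
apply: sp_D => //; apply: sp_D.
  by apply: sp_Z; rewrite db; apply: step; rewrite ?db.
by apply: sp_U; rewrite mdegD mdegU add1n db.
Qed.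

Lemma x_lo i d a : lo d a -> lo d.+1 (x i * a).
Proof.
apply: (sp_ind (P := fun a => lo d.+1 (x i * a))) => [|p q|r l ld].
- by rewrite mulr0; apply: sp_0.
- by rewrite mulrDr; apply: sp_D.
- rewrite mulrA xiota mulrDl; apply: sp_D; last by apply: sp_U; apply: ltnW.
  rewrite -mulrA; apply: sp_Z; have [u [_ hu]] := x_mon i l.
  rewrite -(subrK (iota u * mon (madd (munit i) l)) (_ * _)).
  apply: sp_D; first by apply: lo_le hu; apply: ltnW.
  by apply: sp_U; rewrite mdegD mdegU add1n.
Qed.

Lemma mon_pred (j : 'I_n) (a : mn) : (0 < a j)%N -> (forall k : 'I_n, (k < j)%N -> a k = 0%N) ->
  mon a = x j * mon (mpred j a).
Proof.
move=> aj amin; rewrite mon_step ?mpredK // => k kj.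
by rewrite ffunE amin.
Qed.

(** The least variable is the one removed, so that [mon_step] applies at each step. *)
Lemma mon_ind (P : mn -> Prop) : P (mzero n) ->
  (forall (j : 'I_n) (a : mn), (forall k : 'I_n, (k < j)%N -> a k = 0%N) ->
     P a -> P (madd (munit j) a)) -> forall a, P a.
Proof.
move=> P0 PS a; have [m] := ubnP (mdeg a); elim: m a => // m IH a.
rewrite ltnS => am; have [/mdeg_eq0 ->//|a_gt0] := posnP (mdeg a).
have [j aj amin] := mneq0_min a_gt0; rewrite -(mpredK aj); apply: PS.
  by move=> k kj; rewrite ffunE amin.
by apply: IH; rewrite -(mdeg_mpred aj).
Qed.

Lemma mon_lo a d c : lo d c -> lo (mdeg a + d) (mon a * c).
Proof.
elim/mon_ind: a => [|j a aj IH] hc; first by rewrite mon0 mul1r mdeg0.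
rewrite -mon_step // -mulrA mdegD mdegU; apply: x_lo; exact: IH.
Qed.

Lemma mon_mon (a b : mn) : exists u, two_sided_unit u /\
  lo (mdeg a + mdeg b) (mon a * mon b - iota u * mon (madd a b)).
Proof.
elim/mon_ind: a => [|j a aj [u [uu hu]]].
  exists 1; split; first exact: unit1.
  by rewrite mon0 !mul1r rmorph1 maddC madd0 mul1r subrr; apply: sp_0.
have [v [uv hv]] := x_mon j (madd a b).
exists (sig j u * v); split; first by apply: unit_mul => //; apply: sig_unit.
rewrite -mon_step // -mulrA mdegD mdegU add1n -maddA rmorphM -[X in _ - X]mulrA.
have -> : x j * (mon a * mon b) - iota (sig j u) * (iota v * mon (madd (munit j) (madd a b)))
  = x j * (mon a * mon b - iota u * mon (madd a b)) +
    (iota (delta j u) * mon (madd a b) +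
     iota (sig j u) * (x j * mon (madd a b) - iota v * mon (madd (munit j) (madd a b)))).
  rewrite mulrBr [x j * (iota u * _)]mulrA xiota mulrDl -[_ * _ * mon _]mulrA mulrBr.
  by rewrite opprD !addrA !subrK.
apply: sp_D; first by apply: x_lo.
apply: sp_D; first by apply: sp_U; rewrite mdegD.
by apply: sp_Z; rewrite mdegD in hv.
Qed.

Lemma mon_iota_ex (a : mn) : exists s : R -> R, bijective s /\
  forall r, lo (mdeg a) (mon a * iota r - iota (s r) * mon a).
Proof.
elim/mon_ind: a => [|j a aj [s [bs hs]]].
  exists id; split; first by exists id.
  by move=> r; rewrite mon0 mul1r mulr1 subrr; apply: sp_0.
exists (sig j \o s); split; first by apply: bij_comp => //; apply: sig_bij.
move=> r; rewrite -mon_step // mdegD mdegU add1n /=.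
have -> : x j * mon a * iota r - iota (sig j (s r)) * (x j * mon a) =
  x j * (mon a * iota r - iota (s r) * mon a) + iota (delta j (s r)) * mon a.
  by rewrite mulrBr [x j * (iota _ * _)]mulrA xiota mulrDl opprD addrA subrK !mulrA.
by apply: sp_D; [apply: x_lo | apply: sp_U].
Qed.

Definition sg a : R -> R := sval (cid (mon_iota_ex a)).

Lemma mon_iota a r : lo (mdeg a) (mon a * iota r - iota (sg a r) * mon a).
Proof. by rewrite /sg; case: cid => s hs; apply: (proj2 hs). Qed.

Lemma sg_bij a : bijective (sg a).
Proof. by rewrite /sg; case: cid => s hs; apply: (proj1 hs). Qed.

Lemma lo_iota d c r : lo d c -> lo d (c * iota r).
Proof.
apply: (sp_ind (P := fun c => lo d (c * iota r))) => [|p q|s l ld].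
  by rewrite mul0r; apply: sp_0.
- by rewrite mulrDl; apply: sp_D.
rewrite -mulrA; apply: sp_Z.
rewrite -(subrK (iota (sg l r) * mon l) (_ * _)); apply: sp_D; last exact: sp_U.
by apply: lo_le (@mon_iota l r); apply: ltnW.
Qed.

Lemma cf_lo d a m : lo d a -> (d <= mdeg m)%N -> cf a m = 0.
Proof.
move=> h dm; apply/eqP; apply: contraLR dm => /h.
by rewrite -ltnNge.
Qed.

(** The twist [sg a] was obtained by choice; as a coefficient of [mon a * iota r] it is seen to be
    additive. *)
Lemma sg_cf a r : sg a r = cf (mon a * iota r) a.
Proof.
have := cf_lo (@mon_iota a r) (leqnn _).
by rewrite cfB cfU eqxx => /eqP; rewrite subr_eq0 => /eqP.
Qed.

Lemma sgD a r s : sg a (r + s) = sg a r + sg a s.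
Proof. by rewrite !sg_cf rmorphD mulrDr cfD. Qed.

Lemma sg0 a : sg a 0 = 0.
Proof. by rewrite sg_cf rmorph0 mulr0 cf0. Qed.

Lemma sg_eq0 a r : (sg a r == 0) = (r == 0).
Proof. by rewrite -[RHS](inj_eq (bij_inj (sg_bij a))) sg0. Qed.

End PBW.

(** * Schreyer resolutions *)

Lemma seq_maximum (T : eqType) (le : rel T) (P : T -> Prop) (s : seq T) x :
  total le -> transitive le -> x \in s -> P x ->
  exists y, [/\ y \in s, P y & forall z, z \in s -> P z -> le z y].
Proof.
move=> tot tr; elim: s x => // a s IH x.
have [[b [bs Pb]] _ _|nex] := pselect (exists b, b \in s /\ P b); last first.
  rewrite in_cons => /predU1P[-> Pa|xs Px]; last by case: nex; exists x.
  exists a; rewrite mem_head; split=> // z; rewrite in_cons.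
  move=> /predU1P[->|zs] Pz; first by case/orP: (tot a a).
  by case: nex; exists z.
have [y [ys Py ymax]] := IH b bs Pb.
have [[Pa ya]|nPa] := pselect (P a /\ le y a).
  exists a; rewrite mem_head; split=> // z; rewrite in_cons.
  move=> /predU1P[->|zs] Pz; first by case/orP: (tot a a).
  by apply: tr ya; apply: ymax.
exists y; rewrite in_cons ys orbT; split=> // z; rewrite in_cons.
move=> /predU1P[->|zs] Pz; last exact: ymax.
by case/orP: (tot a y) => // ya; case: nPa.
Qed.

Section Schreyer.
Variables (R A : nzRingType) (iota : {rmorphism R -> A}).
Variables (n : nat) (x : 'I_n -> A).
Hypotheses (hfree : pbw_basis iota x) (hbij : pbw_bijective iota x).
Local Notation mn := {ffun 'I_n -> nat}.
Local Notation mon := (pbw_mon x).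
Local Notation cf := (cf hfree).

Section Coefficients.
Variable I : choiceType.
Local Notation F := (free_mod A I).
Implicit Types (f g : F) (i : I) (m : mn).

Definition Sp (Q : I -> mn -> Prop) f : Prop :=
  forall i m, cf (co f i) m != 0 -> Q i m.

Lemma Sp_0 Q : Sp Q 0.
Proof. by move=> i; apply: sp_0. Qed.

Lemma Sp_D Q f g : Sp Q f -> Sp Q g -> Sp Q (f + g).
Proof. by move=> hf hg i; rewrite coD; apply: sp_D; [apply: hf|apply: hg]. Qed.

Lemma Sp_N Q f : Sp Q f -> Sp Q (- f).
Proof. by move=> hf i; rewrite coN; apply: sp_N; apply: hf. Qed.

Lemma Sp_B Q f g : Sp Q f -> Sp Q g -> Sp Q (f - g).
Proof. by move=> hf hg; apply: Sp_D => //; apply: Sp_N. Qed.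

Lemma Sp_Z Q r f : Sp Q f -> Sp Q (iota r *: f).
Proof. by move=> hf i; rewrite coZ; apply: sp_Z; apply: hf. Qed.

Lemma Sp_gen (Q : I -> mn -> Prop) a i : sp hfree (Q i) a -> Sp Q (fgen a i).
Proof.
move=> ha k m; rewrite coU; case: (k =P i) => [->|_]; first exact: ha.
by rewrite cf0 eqxx.
Qed.

Lemma Sp_sub (Q Q' : I -> mn -> Prop) f :
  (forall i m, Q i m -> Q' i m) -> Sp Q f -> Sp Q' f.
Proof. by move=> QQ' hf i m /hf/QQ'. Qed.

Lemma Sp_ind (Q : I -> mn -> Prop) (P : F -> Prop) : P 0 ->
  (forall f g, P f -> P g -> P (f + g)) ->
  (forall r i m, Q i m -> P (fgen (iota r * mon m) i)) ->
  forall f, Sp Q f -> P f.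
Proof.
move=> P0 PD PQ f Qf; apply: free_ind => // i _.
apply: (sp_ind (P := fun a => P (fgen a i)) _ _ _ (Qf i)) => [|a b|r m].
- by rewrite fgen0.
- by rewrite fgenD; apply: PD.
- exact: PQ.
Qed.

Lemma Sp_bound f : exists s : seq (I * mn),
  forall i m, cf (co f i) m != 0 -> (i, m) \in s.
Proof.
pose sm i := sval (cid (cf_supp hfree (co f i))).
exists [seq (i, m) | i <- fsupp f, m <- sm i] => i m cn.
apply/allpairsPdep; exists i, m; split=> //.
  apply: contraR cn => /fsupp_out ->; by rewrite cf0.
by apply: contraR cn; rewrite /sm; case: cid => s /= hs /hs ->.
Qed.

End Coefficients.

Section Orders.
Variable I : choiceType.
Variables h d t : I -> nat.

Definition nrm (i : I) (m : mn) : Prop := forall j : 'I_n, (j < h i)%N -> m j = 0%N.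

Definition below (D T : nat) (i : I) (m : mn) : Prop :=
  (mdeg m + d i < D)%N \/ (mdeg m + d i = D)%N /\ (t i < T)%N.

Lemma mon_below m D T (f : free_mod A I) :
  Sp (below D T) f -> Sp (below (mdeg m + D) T) (mon m *: f).
Proof.
apply: (Sp_ind (P := fun f => Sp (below (mdeg m + D) T) (mon m *: f))) => [|f1 f2|r i l il].
- by rewrite scaler0; apply: Sp_0.
- by rewrite scalerDr; apply: Sp_D.
- rewrite fgenZ; apply: Sp_gen.
  have h1 : lo hfree (mdeg l).+1 (iota r * mon l) by apply: sp_U.
  apply: sp_sub (mon_lo hbij h1) => k; rewrite addnS ltnS => hk.
  case: il => [lD|[<- lT]].
    left; apply: (leq_ltn_trans (n := (mdeg m + mdeg l) + d i)); first by rewrite leq_add2r.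
    by rewrite -addnA ltn_add2l.
  have : (mdeg k + d i <= mdeg m + (mdeg l + d i))%N by rewrite addnA leq_add2r.
  by rewrite leq_eqVlt => /predU1P[e|e]; [right|left].
Qed.

Lemma below_le D T D' T' i m : (D < D')%N \/ D = D' /\ (T <= T')%N ->
  below D T i m -> below D' T' i m.
Proof.
move=> [DD [b|[e _]]|[<- TT] [b|[e b]]]; [left|left|left|right] => //.
- exact: ltn_trans b DD.
- by rewrite e.
- by split=> //; apply: leq_trans b TT.
Qed.

End Orders.

(* The monomials [mon m *: g i] with [m] vanishing below the index [h i] form a
   left basis over [R], and the products [x j *: g i] with [j < h i] rewrite to
   such normal monomials that are smaller than [x j *: g i] for the order
   given by the degree, shifted by [d], and then by the weight [t]. *)
Record schreyer (N : lmodType A) (I : choiceType) (h d t : I -> nat)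
  (g : I -> N) : Prop := Schreyer {
  sch_gen : forall y, exists f, Sp (nrm h) f /\ flin g f = y;
  sch_indep : forall f, Sp (nrm h) f -> flin g f = 0 -> f = 0;
  sch_red : forall i (j : 'I_n), (j < h i)%N -> exists f,
    [/\ Sp (nrm h) f, Sp (below d t (d i).+1 (t i)) f & flin g f = x j *: g i] }.

Section Step.
Variables (N : lmodType A) (I : choiceType) (h d t : I -> nat) (g : I -> N).
Hypothesis hs : schreyer h d t g.
Local Notation F := (free_mod A I).
Local Notation J := {p : 'I_n * I | (p.1 < h p.2)%N}.
Local Notation ji := (fun p : J => (val p).1).
Local Notation li := (fun p : J => (val p).2).

Let L (p : J) : F := sval (cid (sch_red hs (valP p))).
Let L_below p : Sp (below d t (d (li p)).+1 (t (li p))) (L p).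
Proof. by rewrite /L; case: cid => f []. Qed.
Let L_eq p : flin g (L p) = x (ji p) *: g (li p).
Proof. by rewrite /L; case: cid => f []. Qed.

(** The syzygies that express the rewriting of [x j *: g i]. They generate the kernel of [flin g] by
    [reduce_ker], and are the generators of the next stage. *)
Let kap (p : J) : F := fgen (x (ji p)) (li p) - L p.
Let psi : {linear free_mod A J -> F} := flin kap.

Let kap_ker p : flin g (kap p) = 0.
Proof. by rewrite linearB L_eq flinU subrr. Qed.

Let psi_ker f : flin g (psi f) = 0.
Proof.
apply: (free_ind (P := fun f => flin g (psi f) = 0)) => [|u v hu hv|p _].
- by rewrite !linear0.
- by rewrite !linearD hu hv addr0.
- by rewrite flinU linearZZ kap_ker scaler0.
Qed.

(** [d'] is the shifted degree of the leading term of [kap p]. As [ji p < n], the weight [t']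
    encodes the lexicographic order on the pairs of [t (li p)] and [ji p]. *)
Let h' (p : J) : nat := ji p.
Let d' (p : J) : nat := (d (li p)).+1.
Let t' (p : J) : nat := (t (li p) * n + ji p)%N.

Definition kap_lead (p : J) (m : mn) : mn := madd m (munit (ji p)).
Let below1 D T (p : J) (m : mn) := below d t D T (li p) (kap_lead p m).

Let mdeg_lead p m : mdeg (kap_lead p m) = (mdeg m).+1.
Proof. by rewrite mdegD mdegU addn1. Qed.

Let psi_lead (p : J) m : exists u, two_sided_unit u /\
  Sp (below d t ((mdeg m).+1 + d (li p)) (t (li p)))
    (psi (fgen (mon m) p) - fgen (iota u * mon (kap_lead p m)) (li p)).
Proof.
have [u [uu hu]] := mon_mon hfree hbij m (munit (ji p)).
exists u; split=> //; rewrite flinU scalerBr fgenZ addrAC; apply: Sp_B; last first.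
  by rewrite addSnnS; apply: mon_below.
have -> : fgen (mon m * x (ji p)) (li p) - fgen (iota u * mon (kap_lead p m)) (li p)
    = fgen (mon m * mon (munit (ji p)) - iota u * mon (kap_lead p m)) (li p).
  by rewrite fgenD -scaleN1r fgenZ mulN1r monU.
apply: Sp_gen; apply: sp_sub hu => k; rewrite mdegU addn1 => hk; left.
by rewrite ltn_add2r.
Qed.

(* Division by the leading terms of the syzygies [kap p]. *)
Let reduce D T f : Sp (below d t D T) f -> exists f',
  [/\ Sp (nrm h') f', Sp (below1 D T) f' & Sp (nrm h) (f - psi f')].
Proof.
elim/ltn_ind: D T f => D IHD T; elim/ltn_ind: T => T IHT f.
apply: (Sp_ind (P := fun f => exists f', [/\ Sp (nrm h') f', Sp (below1 D T) f'
  & Sp (nrm h) (f - psi f')])) => [|f1 f2 [g1 [a1 b1 c1]] [g2 [a2 b2 c2]]|r i a ia].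
- by exists 0; rewrite linear0 subr0; split; apply: Sp_0.
- exists (g1 + g2); rewrite linearD opprD addrACA; split; exact: Sp_D.
have [nia|nnia] := pselect (nrm h i a).
  exists 0; rewrite linear0 subr0; split; [exact: Sp_0|exact: Sp_0|].
  by apply: Sp_gen; apply: sp_U.
have [k [kh ak]] : exists k : 'I_n, (k < h i)%N /\ (0 < a k)%N.
  apply: contrapT => nex; apply: nnia => k kh; apply: contrapT => ak.
  by apply: nex; exists k; split=> //; rewrite lt0n; apply/eqP.
(* With [j] the least variable of [a], what remains after removing one [j] has no variable below
   [j], so it is normal for [p]. *)
have [j aj jmin] := msupp_min (P := fun k : 'I_n => (0 < a k)%N) ak.
have jh : (j < h i)%N.
  by apply: leq_ltn_trans kh; rewrite leqNgt; apply/negP => /jmin; rewrite ak.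
pose p : J := exist _ (j, i) jh; pose b := mpred j a.
have lpb : kap_lead p b = a by rewrite /kap_lead maddC mpredK.
have [u [[v [uv vu]] hu]] := psi_lead p b.
have da : (mdeg b).+1 = mdeg a by rewrite (mdeg_mpred aj).
rewrite lpb da /= in hu.
set rest := (X in Sp _ X) in hu.
(* [v] inverts the unit [u] in the leading coefficient of [mon b] times [kap p], so the leading
   terms cancel and a multiple of [rest] is left. *)
pose f1 := iota (r * v) *: fgen (mon b) p : free_mod A J.
have e1 : fgen (iota r * mon a) i - psi f1 = - (iota (r * v) *: rest).
  rewrite /rest scalerBr fgenZ mulrA -rmorphM -mulrA vu mulr1 opprB.
  by congr (_ - _); rewrite /psi linearZZ.
have [f2 [n2 b2 c2]] : exists f', [/\ Sp (nrm h') f',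
    Sp (below1 (mdeg a + d i) (t i)) f' & Sp (nrm h) (- (iota (r * v) *: rest) - psi f')].
  have hr : Sp (below d t (mdeg a + d i) (t i)) (- (iota (r * v) *: rest)).
    by apply: Sp_N; apply: Sp_Z.
  case: ia => [lD|[eD lT]]; first exact: IHD.
  by rewrite eD; apply: IHT => //; rewrite -eD.
exists (f1 + f2); split.
- apply: Sp_D => //; apply: Sp_Z; apply: Sp_gen; apply: sp_mon => l lj.
  by rewrite ffunE; have := jmin l lj; rewrite lt0n negbK => /eqP ->.
- apply: Sp_D; last first.
    apply: Sp_sub b2 => q m; apply: below_le.
    by case: ia => [lD|[eD lT]]; [left|right; split=> //; apply: ltnW].
  by apply: Sp_Z; apply: Sp_gen; apply: sp_mon; rewrite /below1 lpb.
- by rewrite linearD opprD addrA e1.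
Qed.

Let reduce_ker D T f : Sp (below d t D T) f -> flin g f = 0 -> exists f',
  [/\ Sp (nrm h') f', Sp (below1 D T) f' & f = psi f'].
Proof.
move=> hf f0; have [f' [a b c]] := reduce hf; exists f'; split=> //.
apply/eqP; rewrite -subr_eq0; apply/eqP; apply: (sch_indep hs) => //.
by rewrite linearB f0 psi_ker subr0.
Qed.

Let Sp_below f : exists D, Sp (below d t D 0) f.
Proof.
have [s hf] := Sp_bound f.
exists (\max_(q <- s) (mdeg q.2 + d q.1)).+1 => i m /hf ms; left.
by rewrite ltnS; apply: (leq_bigmax_seq (F := fun q : I * mn => mdeg q.2 + d q.1)%N (i, m)).
Qed.

(** When [m] is normal for [p], the index [ji p] is the least variable of [kap_lead p m]; hence both
    [p] and [m] can be recovered. *)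
Let lead_inj p q (m l : mn) : nrm h' p m -> nrm h' q l -> li p = li q ->
  kap_lead p m = kap_lead q l -> p = q /\ m = l.
Proof.
have lt p1 p2 (m1 m2 : mn) : nrm h' p2 m2 -> kap_lead p1 m1 = kap_lead p2 m2 ->
    (ji p1 < ji p2)%N -> False.
  move=> n2 /ffunP/(_ (ji p1)) e lt; move: e; rewrite !ffunE eqxx n2 //.
  by case: eqP => [e|_]; [rewrite e ltnn in lt|rewrite addn1].
move=> np nq el e; have ej : ji p = ji q.
  case: (ltngtP (ji p) (ji q)) => [l1|l1|/ord_inj//].
    by case: (lt _ _ _ _ nq e l1).
  by case: (lt _ _ _ _ np (esym e) l1).
split.
  case: p q {np nq e} el ej => [[j1 i1] h1] [[j2 i2] h2] /= el ej.
  by move: h1 h2; rewrite el ej => h1 h2; congr exist; apply: bool_irrelevance.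
rewrite -(madd_munitK (ji p) m) -(madd_munitK (ji q) l).
by rewrite ![madd (munit _) _]maddC [madd m _]e ej.
Qed.

Let key_le (q1 q2 : J * mn) : bool :=
  (mdeg q1.2 + d (li q1.1) < mdeg q2.2 + d (li q2.1))%N ||
  ((mdeg q1.2 + d (li q1.1) == mdeg q2.2 + d (li q2.1)) &&
   (t (li q1.1) <= t (li q2.1)))%N.

Let key_total : total key_le.
Proof.
move=> q1 q2; rewrite /key_le.
case: (ltngtP (mdeg q1.2 + d (li q1.1)) (mdeg q2.2 + d (li q2.1))) => //= _.
exact: leq_total.
Qed.

Let key_trans : transitive key_le.
Proof.
move=> q2 q1 q3 /orP[l12|/andP[/eqP e12 t12]] /orP[l23|/andP[/eqP e23 t23]].
- by rewrite /key_le (ltn_trans l12 l23).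
- by rewrite /key_le -e23 l12.
- by rewrite /key_le e12 l23.
- by rewrite /key_le e12 e23 eqxx (leq_trans t12 t23) orbT.
Qed.

(** Among the terms of [f], take one that is maximal for [key_le]. By [lead_inj] no other normal
    term has the same leading position, and lower terms lie strictly below it, so nothing cancels
    its leading coefficient. *)
Let psi_indep f : Sp (nrm h') f -> psi f = 0 -> f = 0.
Proof.
move=> nf pf; apply: contrapT => f0.
have [[p1 m1] c1] : exists q, cf (co f q.1) q.2 != 0.
  apply: contrapT => nex; apply: f0; apply: co_inj => p; apply: (cf_ext (hfree := hfree)) => m.
  rewrite cf0; apply: contrapT => /eqP c; by apply: nex; exists (p, m).
have [s hsf] := Sp_bound f.
have [[p0 m0] [_ c0 mx]] := seq_maximum
  (P := fun q : J * mn => cf (co f q.1) q.2 != 0) key_total key_trans (hsf _ _ c1) c1.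
rewrite /= in c0 mx; set c := cf (co f p0) m0 in c0.
pose Q p (m : mn) := [/\ nrm h' p m, (p, m) <> (p0, m0) & key_le (p, m) (p0, m0)].
have hrest : Sp Q (f - fgen (iota c * mon m0) p0).
  move=> p m; rewrite coB coU cfB.
  have [-> {p}|pp] := eqVneq p p0; last first.
    rewrite cf0 subr0 => ce; split; [exact: nf|by case=> e; rewrite e eqxx in pp|].
    by apply: mx => //; apply: hsf.
  rewrite cfU; case: (m =P m0) => [->|mm]; first by rewrite subrr eqxx.
  rewrite subr0 => ce; split; [exact: nf|by case|].
  by apply: mx => //; apply: hsf.
have coef r p m : nrm h' p m -> key_le (p, m) (p0, m0) -> exists u, two_sided_unit u /\
    cf (co (psi (fgen (iota r * mon m) p)) (li p0)) (kap_lead p0 m0) =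
    if `[< (p, m) = (p0, m0) >] then r * u else 0.
  move=> np kp; have [u [uu hu]] := psi_lead p m; exists u; split=> //.
  rewrite -fgenZ linearZZ coZ cfZ.
  rewrite -(subrK (fgen (iota u * mon (kap_lead p m)) (li p)) (psi _)) coD cfD.
  set y := cf (co (_ - _) _) _.
  have -> : y = 0.
    apply: contrapT => /eqP /hu; rewrite /below mdeg_lead !addSn ltnS => bl.
    move: kp; rewrite /key_le /=; case: bl => [k3|[[k3] k4]].
      rewrite ltnNge (ltnW k3) /= => /andP[/eqP e _].
      by rewrite e ltnn in k3.
    by rewrite k3 ltnn eqxx /= leqNgt k4.
  rewrite add0r coU; case: asboolP => [[-> ->]|ne].
    by rewrite eqxx cfU eqxx.
  case: eqP => [el|_]; last by rewrite cf0 mulr0.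
  rewrite cfU; case: eqP => [e|_]; last by rewrite mulr0.
  by case: ne; have [-> ->] := lead_inj np (nf _ _ c0) (esym el) (esym e).
have r0 : cf (co (psi (f - fgen (iota c * mon m0) p0)) (li p0)) (kap_lead p0 m0) = 0.
  apply: (Sp_ind (P := fun f => cf (co (psi f) (li p0)) (kap_lead p0 m0) = 0) _ _ _ hrest).
  - by rewrite linear0 cf0.
  - by move=> f1 f2 e1 e2; rewrite linearD coD cfD e1 e2 addr0.
  - move=> r p m [np ne kp]; have [u [_ ->]] := coef r p m np kp.
    by case: asboolP.
have [u [uu e]] := coef c p0 m0 (nf _ _ c0) (mx _ (hsf _ _ c0) c0).
rewrite linearB coB cfB pf co0 cf0 e sub0r in r0.
move: r0; case: asboolP => // _ /eqP; rewrite oppr_eq0.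
by rewrite (negPf (unit_mul_neq0 uu c0)).
Qed.

Lemma schreyer_step k : (forall i, (h i <= k.+1)%N) ->
  exists (K : lmodType A) (i : {linear K -> F}), ses i (flin g) /\
  exists (I' : choiceType) (h1 d1 t1 : I' -> nat) (g1 : I' -> K),
    schreyer h1 d1 t1 g1 /\ forall p, (h1 p <= k)%N.
Proof.
move=> hk.
have sg : surj (flin g) by move=> y; have [f [_ fy]] := sch_gen hs y; exists f.
have [K [i hi]] := ses_ker sg; have [ii _ ik] := hi.
exists K, i; split=> //.
pose g1 p := sval (cid (proj1 (ik _) (kap_ker p))).
have g1E p : i (g1 p) = kap p by rewrite /g1; case: cid.
have psiE f : i (flin g1 f) = psi f.
  apply: (free_ind (P := fun f => i (flin g1 f) = psi f)) => [|u v hu hv|p _].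
  - by rewrite !linear0.
  - by rewrite !linearD hu hv.
  - by rewrite !flinU linearZZ g1E.
exists J, h', d', t', g1; split; last first.
  by move=> p; rewrite -ltnS; apply: leq_trans (valP p) (hk _).
split.
- move=> y; have [D hD] := Sp_below (i y).
  have y0 : flin g (i y) = 0 by apply/ik; exists y.
  have [f [nf _ fE]] := reduce_ker hD y0; exists f; split=> //.
  by apply: ii; rewrite psiE.
- by move=> f nf f0; apply: psi_indep => //; rewrite -psiE f0 linear0.
- move=> p l lp.
  have lh : (l < h (li p))%N by apply: ltn_trans lp (valP p).
  (* An S-pair: [x l] times [kap p] and [x (ji p)] times [kap q] have the same leading exponent. The
     factor [u * w] equalizes their leading coefficients, and the difference reduces to smaller
     syzygies. *)
  pose q : J := exist _ (l, li p) lh.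
  have [u [uu hu]] := psi_lead p (munit l).
  have [v [[w [vw wv]] hv]] := psi_lead q (munit (ji p)).
  have elq : kap_lead q (munit (ji p)) = kap_lead p (munit l) by rewrite /kap_lead maddC.
  rewrite elq !mdegU /= in hu hv.
  pose f1 := iota (u * w) *: fgen (mon (munit (ji p))) q : free_mod A J.
  have hrest : Sp (below d t (2 + d (li p)) (t (li p)))
      (psi (fgen (mon (munit l)) p) - psi f1).
    set e := fgen (mon (kap_lead p (munit l))) (li p).
    have -> : psi (fgen (mon (munit l)) p) - psi f1 =
        (psi (fgen (mon (munit l)) p) - iota u *: e) -
        iota (u * w) *: (psi (fgen (mon (munit (ji p))) q) - iota v *: e).
      rewrite scalerBr scalerA -rmorphM -mulrA wv mulr1 opprB addrA subrK.
      by rewrite /f1 [psi (iota _ *: _)]linearZZ.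
    by apply: Sp_B; [|apply: Sp_Z]; rewrite /e fgenZ.
  have [|f2 [n2 b2 e2]] := reduce_ker hrest.
    by rewrite linearB !psi_ker subr0.
  exists (f1 + f2); split.
  + apply: Sp_D => //; apply: Sp_Z; apply: Sp_gen; apply: sp_mon => k1 k1l.
    rewrite ffunE; case: eqP => // e; move: k1l; rewrite e /h' /=.
    by rewrite ltnNge ltnW.
  + apply: Sp_D.
      apply: Sp_Z; apply: Sp_gen; apply: sp_mon; right; rewrite mdegU /d' /t' /=.
      by split; rewrite ?add1n // ltn_add2l.
    apply: Sp_sub b2 => k1 m; rewrite /below1 /below mdeg_lead /d' /t' addSnnS.
    case=> [b|[b1 b2]]; [by left|right]; split=> //.
    (* A drop of [t] by one outweighs any change of [ji], which stays below [n]. *)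
    apply: (@leq_trans ((t (li k1)).+1 * n)).
      by rewrite mulSn addnC ltn_add2r.
    by apply: leq_trans (leq_addr _ _); rewrite leq_mul2r b2 orbT.
  + apply: ii; rewrite psiE linearD -e2 addrC subrK.
    by rewrite -psiE flinU monU.
Qed.

End Step.

(** At bound 0 every monomial is normal, so [g] is an [A]-basis of [N]; each syzygy step lowers the
    bound by one. *)
Lemma schreyer_pdle k (N : lmodType A) (I : choiceType) (h d t : I -> nat)
  (g : I -> N) : schreyer h d t g -> (forall i, (h i <= k)%N) -> pdle k N.
Proof.
elim: k N I h d t g => [|k IH] N I h d t g hs hk; last first.
  have [K [i [hi [I' [h1 [d1 [t1 [g1 [hs1 hk1]]]]]]]]] := schreyer_step hs hk.
  exists (free_mod A I), K, i, (flin g); split=> //; first exact: projective_free.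
  exact: IH hs1 hk1.
have nrmT f : Sp (nrm h) f by move=> i m _ j; rewrite ltnNge (leq_trans (hk i)).
have inj : injective (flin g) by apply: linear_inj0 => f; apply: (sch_indep hs).
have srj : surj (flin g) by move=> y; have [f [_ fy]] := sch_gen hs y; exists f.
have [s [sK fK]] := inv_linear inj srj.
by apply: projective_retract sK _; apply: projective_free.
Qed.

End Schreyer.

(** * Restriction of scalars *)

Section Restriction.
Variables (S B : nzRingType) (f : {rmorphism S -> B}).

Definition restr of {rmorphism S -> B} := fun M : lmodType B => M : Type.

Section Module.
Variable M : lmodType B.
Local Notation restr := (restr f M).

HB.instance Definition _ := GRing.Zmodule.copy restr M.

Definition restr_scale (s : S) (m : restr) : restr := (f s : B) *: (m : M).

Fact restr_scaleA a b v : restr_scale a (restr_scale b v) = restr_scale (a * b) v.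
Proof. by rewrite /restr_scale scalerA rmorphM. Qed.
Fact restr_scale1 : left_id 1 restr_scale.
Proof. by move=> v; rewrite /restr_scale rmorph1 scale1r. Qed.
Fact restr_scaleDr : right_distributive restr_scale +%R.
Proof. by move=> a u v; rewrite /restr_scale scalerDr. Qed.
Fact restr_scaleDl v : {morph restr_scale^~ v : a b / a + b}.
Proof. by move=> a b; rewrite /restr_scale rmorphD scalerDl. Qed.
HB.instance Definition _ := GRing.Zmodule_isLmodule.Build S restr
  restr_scaleA restr_scale1 restr_scaleDr restr_scaleDl.

Lemma restr_scaleE (s : S) (m : restr) : s *: m = (f s *: (m : M) : M).
Proof. by []. Qed.

End Module.

Lemma restr_linear (M N : lmodType B) (g : {linear M -> N}) :
  linear (g : restr f M -> restr f N).
Proof. by move=> a u v; rewrite !restr_scaleE -linearP. Qed.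

Definition restr_map (M N : lmodType B) (g : {linear M -> N}) :
  {linear restr f M -> restr f N} := mklin (restr_linear g).

Lemma ses_restr (K M N : lmodType B) (i : {linear K -> M}) (p : {linear M -> N}) :
  ses i p -> ses (restr_map i) (restr_map p).
Proof. by []. Qed.

Lemma pdle_restr d (M : lmodType B) :
  (forall P : lmodType B, projective_module P -> projective_module (restr f P)) ->
  pdle d M -> pdle d (restr f M).
Proof.
move=> hP; elim: d M => [|d IH] M /=; first exact: hP.
move=> [P [K [i [p [pP hs hK]]]]].
exists (restr f P), (restr f K), (restr_map i), (restr_map p).
by split; [apply: hP|apply: ses_restr|apply: IH].
Qed.

End Restriction.

Section Swindle.
Variables (R : nzRingType) (M : lmodType R) (hM : projective_module M).
Local Notation P := (free_mod R M).
Local Notation U := (free_mod R (nat * M)%type).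

(* Eilenberg's swindle: if [M] is a retract of [P] then [M * U] is isomorphic
   to [U], the direct sum of countably many copies of [P]. *)
Lemma swindle : exists (th : {linear (M * U)%type -> U})
  (th' : {linear U -> (M * U)%type}), cancel th th' /\ cancel th' th.
Proof.
have [s sK] := projective_section hM (free_cover_surj (M := M)).
have [p ps] : exists p : {linear P -> M}, cancel s p by exists (free_cover M).
have [e eE] : exists e : {linear P -> P}, forall z, e z = s (p z) by exists (s \o p).
have ee z : e (e z) = e z by rewrite !eE ps.
have es m : e (s m) = s m by rewrite eE ps.
have pe z : p (e z) = p z by rewrite eE ps.
have [inj injE] : exists inj : nat -> {linear P -> U},
    forall k r y, inj k (fgen r y) = fgen r (k, y).
  exists (fun k => flin (fun y : M => fgen 1 (k, y))) => k r y.
  by rewrite flinU fgenZ mulr1.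
have [injp [injp0 injpS]] : exists injp : nat -> {linear P -> U},
    (forall z, injp 0%N z = 0) /\ forall k z, injp k.+1 z = inj k z.
  by exists (fun k => if k is k'.+1 then inj k' else mklin (@linear_zero R P U)).
have ext (f : nat -> {linear P -> U}) (g : nat -> {linear P -> U}) :
    exists T : {linear U -> U}, forall q, T (fgen 1 q) =
      f q.1 (e (fgen 1 q.2)) - g q.1 (e (fgen 1 q.2)).
  exists (flin (fun q : nat * M => f q.1 (e (fgen 1 q.2)) - g q.1 (e (fgen 1 q.2)))).
  by move=> q; rewrite flinU scale1r.
(* The idempotent [e] cuts the summand [M] out of each copy of [P]. Then [idfun \+ T] moves these
   summands up by one copy and fixes their complements, leaving that of copy 0 free for the new
   factor [M]; [idfun \+ T'] moves them down and drops the one of copy 0. *)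
have [T T1] := ext (fun k => inj k.+1) inj.
have [T' T'1] := ext injp inj.
have [c c1] : exists c : {linear U -> P}, forall q,
    c (fgen 1 q) = if q.1 == 0%N then fgen 1 q.2 else 0.
  exists (flin (fun q : nat * M => if q.1 == 0%N then fgen 1 q.2 else 0)) => q.
  by rewrite flinU scale1r.
have P_ind (V : lmodType R) (f g : {linear P -> V}) :
    (forall y, f (fgen 1 y) = g (fgen 1 y)) -> f =1 g.
  move=> h z; apply: (free_ind (P := fun z => f z = g z)) => [|u v hu hv|y _].
  - by rewrite !linear0.
  - by rewrite !linearD hu hv.
  - by rewrite -[co z y]mulr1 -fgenZ !linearZZ h.
have U_ind (V : lmodType R) (f g : {linear U -> V}) :
    (forall k z, f (inj k z) = g (inj k z)) -> f =1 g.
  move=> h z; apply: (free_ind (P := fun z => f z = g z)) => [|u v hu hv|[k y] _].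
  - by rewrite !linear0.
  - by rewrite !linearD hu hv.
  - have := h k (fgen (co z (k, y)) y).
    by rewrite injE.
have inj1 k y : inj k (fgen 1 y) = fgen 1 (k, y) by [].
have TE k z : T (inj k z) = inj k.+1 (e z) - inj k (e z).
  by apply: (P_ind _ (T \o inj k : {linear P -> U}) ((inj k.+1 \o e) \- (inj k \o e) :
    {linear P -> U})) => y; rewrite [LHS](congr1 T (inj1 _ _)) T1.
have T'E k z : T' (inj k z) = injp k (e z) - inj k (e z).
  by apply: (P_ind _ (T' \o inj k : {linear P -> U}) ((injp k \o e) \- (inj k \o e) :
    {linear P -> U})) => y; rewrite [LHS](congr1 T' (inj1 _ _)) T'1.
have cE k z : c (inj k z) = if k == 0%N then z else 0.
  have lin : linear (fun z : P => if k == 0%N then z else 0).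
    by move=> a u v; case: ifP => _; rewrite // scaler0 addr0.
  by apply: (P_ind _ (c \o inj k : {linear P -> P}) (mklin lin)) => y;
    rewrite [LHS](congr1 c (inj1 _ _)) c1.
have zero1 (a b d : U) : (d - b) + (a - b) + ((b - a) - (d - b)) = 0.
  by rewrite -[b - a]opprB -opprD [X in _ - X]addrC subrr.
have TT' u : T' u + T u + T' (T u) = 0.
  apply: (U_ind _ (T' \+ T \+ (T' \o T) : {linear U -> U})
    (mklin (@linear_zero R U U))) => k z.
  change (T' (inj k z) + T (inj k z) + T' (T (inj k z)) = 0).
  by rewrite TE T'E linearB !T'E !ee injpS zero1.
have T'T u : T' u + T u + T (T' u) = - inj 0%N (e (c u)).
  apply: (U_ind _ (T' \+ T \+ (T \o T') : {linear U -> U})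
    (-%R \o (inj 0%N \o (e \o c)) : {linear U -> U})) => k z.
  change (T' (inj k z) + T (inj k z) + T (T' (inj k z)) = - inj 0%N (e (c (inj k z)))).
  rewrite TE T'E linearB TE cE !ee; case: k => [|k] /=.
    by rewrite injp0 linear0 !sub0r addrK.
  by rewrite injpS TE ee [X in X + _]addrC zero1 !linear0 ?oppr0.
have cT v : c (T v) = - e (c v).
  apply: (U_ind _ (c \o T : {linear U -> P}) (-%R \o (e \o c) : {linear U -> P})) => k z.
  change (c (T (inj k z)) = - e (c (inj k z))).
  by rewrite TE linearB !cE; case: k => [|k] /=; rewrite sub0r ?linear0.
exists (pair_map (inj 0%N \o s : {linear M -> U}) (idfun \+ T : {linear U -> U})),
  (pair_mk (p \o c : {linear U -> M}) (idfun \+ T' : {linear U -> U})).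
split=> [[m v]|q].
  change ((p (c (inj 0%N (s m) + (v + T v))),
    inj 0%N (s m) + (v + T v) + T' (inj 0%N (s m) + (v + T v))) = (m, v)).
  congr (_, _).
    by rewrite !linearD cT cE /= linearN pe addrN addr0 ps.
  set w := inj 0%N (s m).
  have T'w : T' w = - w by rewrite /w T'E es injp0 sub0r.
  rewrite !linearD T'w addrACA subrr add0r -addrA.
  by rewrite [T v + _]addrA [T v + _]addrC TT' addr0.
change (inj 0%N (s (p (c q))) + ((q + T' q) + T (q + T' q)) = q).
rewrite -eE -[X in X + _]opprK -T'T [T (q + _)]linearD.
rewrite -[q + _ + _]addrA [T' q + (_ + _)]addrA.
by rewrite addrCA addNr addr0.
Qed.

End Swindle.

(** * Bounds on the global dimension *)

Section GlobalDimension.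
Variables (R A : nzRingType) (iota : {rmorphism R -> A}).
Variables (n : nat) (x : 'I_n -> A).
Hypotheses (hfree : pbw_basis iota x) (hbij : pbw_bijective iota x).
Local Notation mn := {ffun 'I_n -> nat}.
Local Notation mon := (pbw_mon x).
Local Notation cf := (cf hfree).
Local Notation restr := (restr iota).

Section RestrictedFree.
Variable I : choiceType.
Local Notation G := (free_mod A I).
Local Notation B := (free_mod R (mn * I)%type).

Definition basis_map : {linear B -> restr G} :=
  flin (fun q : mn * I => fgen (mon q.1) q.2 : restr G).

Lemma basis_mapU r m i : basis_map (fgen r (m, i)) = fgen (iota r * mon m) i.
Proof. by rewrite flinU restr_scaleE fgenZ. Qed.

Lemma basis_map_co f i m : cf (co (basis_map f : G) i) m = co f (m, i).
Proof.
apply: (free_ind (P := fun f => cf (co (basis_map f : G) i) m = co f (m, i))).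
- by rewrite linear0 co0 cf0.
- by move=> u v hu hv; rewrite linearD !coD cfD hu hv.
- move=> [l j] _; rewrite basis_mapU !coU xpair_eqE andbC.
  by case: eqP => _ /=; rewrite ?cf0 // cfU.
Qed.

Lemma basis_map_surj : surj basis_map.
Proof.
move=> v; apply: (Sp_ind (hfree := hfree) (Q := fun _ _ => True)
  (P := fun v : G => exists f, basis_map f = v)) => //.
- by exists 0; rewrite linear0.
- by move=> _ _ [f <-] [g <-]; exists (f + g); rewrite linearD.
- by move=> r i m _; exists (fgen r (m, i)); rewrite basis_mapU.
Qed.

Lemma basis_map_inj : injective basis_map.
Proof.
apply: linear_inj0 => f f0; apply: co_inj => -[m i].
by rewrite -basis_map_co f0 co0 cf0.
Qed.

Lemma projective_restr_free : projective_module (restr G).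
Proof.
have [g [gK fK]] := inv_linear basis_map_inj basis_map_surj.
by apply: projective_retract gK _; apply: projective_free.
Qed.

End RestrictedFree.

Lemma projective_restr (P : lmodType A) :
  projective_module P -> projective_module (restr P).
Proof.
move=> hP; have [s sK] := projective_section hP (free_cover_surj (M := P)).
apply: (projective_retract (s := restr_map iota s) (p := restr_map iota (free_cover P))).
  exact: sK.
exact: projective_restr_free.
Qed.

Lemma pdle_restr_pbw d (M : lmodType A) : pdle d M -> pdle d (restr M).
Proof. exact: pdle_restr projective_restr. Qed.

(** Start of the Schreyer construction: with [h] constantly [n] the only normal monomial is 1, and
    [x j *: b i], of degree 1, rewrites to an [R]-combination of the generators, of degree 0. *)
Lemma free_restr_pdle (N : lmodType A) (I : choiceType)
  (Psi : {linear free_mod R I -> restr N}) :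
  injective Psi -> surj Psi -> pdle n N.
Proof.
move=> Pi Ps; pose b i : N := Psi (fgen 1 i).
pose E (f : free_mod R I) : free_mod A I := fext (fun i r => fgen (iota r) i) f.
have ED f g : E (f + g) = E f + E g.
  by apply: fextD => i r s; rewrite rmorphD fgenD.
have EU r i : E (fgen r i) = fgen (iota r) i.
  by apply: fextU => k s t; rewrite rmorphD fgenD.
have E0 : E 0 = 0 by apply: fext0 => k s t; rewrite rmorphD fgenD.
have bE f : flin b (E f) = Psi f.
  apply: (free_ind (P := fun f => flin b (E f) = Psi f)) => [|u v hu hv|i _].
  - by rewrite E0 !linear0.
  - by rewrite ED !linearD hu hv.
  - by rewrite EU flinU -[co f i in RHS]mulr1 -fgenZ linearZZ.
have E_nrm f : Sp hfree (nrm (fun _ : I => n)) (E f) /\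
    Sp hfree (below (fun=> 0%N) (fun _ : I => 0%N) 1 0) (E f).
  apply: (free_ind (P := fun f => Sp hfree (nrm (fun _ : I => n)) (E f) /\
    Sp hfree (below (fun=> 0%N) (fun _ : I => 0%N) 1 0) (E f)))
     => [|u v [u1 u2] [v1 v2]|i _].
  - by rewrite E0; split; apply: Sp_0.
  - by rewrite ED; split; apply: Sp_D.
  - rewrite EU -[iota _]mulr1 -(mon0 x); split; apply: Sp_gen; apply: sp_U.
      by move=> j _; rewrite ffunE.
    by left; rewrite mdeg0.
have nrm_E f : Sp hfree (nrm (fun _ : I => n)) f -> exists g, f = E g.
  apply: (Sp_ind (P := fun f => exists g, f = E g)) => [|u v [u' ->] [v' ->]|r i m im].
  - by exists 0; rewrite E0.
  - by exists (u' + v'); rewrite ED.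
  - exists (fgen r i); rewrite EU; have -> : m = mzero n.
      by apply/ffunP=> j; rewrite ffunE im.
    by rewrite mon0 mulr1.
apply: (@schreyer_pdle _ _ _ _ _ hfree hbij n N I (fun=> n) (fun=> 0%N) (fun=> 0%N) b) => //.
split=> [y|f /nrm_E[g ->]|i j _].
- have [f fy] := Ps y; exists (E f); split; first by case: (E_nrm f).
  by rewrite bE.
- by rewrite bE => /(linear_inj_eq0 Pi) ->; rewrite E0.
- have [f fy] := Ps (x j *: b i); exists (E f); have [h1 h2] := E_nrm f; split=> //.
  by rewrite bE.
Qed.

(** Over [R], the free module [G] contains as a summand the free module [U] on the same generators,
    embedded by [J] and read off by [C] as the coefficients of the monomial 1. The swindle absorbs
    [M] into this summand, so [M * G] is isomorphic to [G] over [R] and has an [R]-basis. *)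
Lemma projective_restr_pdle (M : lmodType A) :
  projective_module (restr M) -> pdle n M.
Proof.
move=> hM; pose G := free_mod A (nat * M)%type.
have hG : projective_module G by apply: projective_free.
apply: (pdle_prod_cancel hG).
have [th [th' [thK th'K]]] := swindle hM.
pose U := free_mod R (nat * M)%type.
have cfin (v : G) : finsupp (fun q => cf (co v q) (mzero n)).
  by have [s hs] := finsupp_co v; exists s => q /hs ->; rewrite cf0.
have Clin : linear (fun v : restr G => mkfree (cfin v) : U).
  move=> a u v; apply: co_inj => q.
  transitivity (cf (co (iota a *: (u : G) + (v : G)) q) (mzero n)) => //.
  by rewrite coD coZ cfD cfZ.
pose C := mklin Clin.
pose J : {linear U -> restr G} := flin (fun q => fgen 1 q : restr G).
have CJ u : C (J u) = u.
  apply: (free_ind (P := fun u => C (J u) = u)) => [|f g hf hg|q _].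
  - by rewrite !linear0.
  - by rewrite !linearD hf hg.
  - rewrite /J flinU restr_scaleE fgenZ mulr1; apply: co_inj => k; rewrite {1}/co /= !coU.
    by case: eqP => _; rewrite ?cf0 // cf_iota eqxx.
have Cc : exists C' : {linear restr G -> U}, forall u, C' (J u) = u by exists C.
have {C CJ Clin cfin Cc} [C CJ] := Cc.
have [th1 th1E] : exists f : {linear U -> restr M}, forall u, f u = (th' u).1.
  by have l : linear (fun z : restr M * U => z.1) by []; exists (mklin l \o th').
have [th2 th2E] : exists f : {linear U -> U}, forall u, f u = (th' u).2.
  by have l : linear (fun z : restr M * U => z.2) by []; exists (mklin l \o th').
(* Replaces the [U]-part [C q] of [q] by the second component of its image in [M * U]; the
   complement is untouched. *)
pose om2 : {linear restr G -> restr G} := (idfun \- (J \o C)) \+ (J \o (th2 \o C)).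
have omlin : linear ((fun q => (th1 (C q), om2 q)) : restr G -> restr (M * G)%type).
  move=> a u v; transitivity ((a *: th1 (C u) + th1 (C v), a *: om2 u + om2 v)) => //.
  by rewrite !linearP.
have om2C q : C (om2 q) = th2 (C q).
  transitivity (C (q - J (C q) + J (th2 (C q)))) => //.
  by rewrite linearD linearB !CJ subrr add0r.
have om2K q : om2 q - J (th2 (C q)) = q - J (C q) by apply: addrK.
have thE m u : th' (th (m, u)) = (m, u) by apply: thK.
pose om : {linear restr G -> restr (M * G)%type} := mklin omlin.
pose Psi : {linear free_mod R (mn * (nat * M))%type -> restr (M * G)%type} :=
  om \o basis_map (nat * M)%type.
have om_inj : injective om.
  apply: linear_inj0 => q e.
  have e1 : th1 (C q) = 0 := congr1 fst e.
  have e2 : om2 q = 0 := congr1 snd e.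
  have Cq : C q = 0.
    rewrite -(th'K (C q)) (surjective_pairing (th' (C q))) -th1E -th2E -om2C.
    by rewrite e1 e2 (linear0 C); exact: (linear0 th).
  by have := om2K q; rewrite Cq e2 (linear0 th2) (linear0 J) !subr0.
have om_surj : surj om.
  move=> [m v]; pose u := th (m, C v).
  have u1 : th1 u = m by rewrite th1E /u thE.
  have u2 : th2 u = C v by rewrite th2E /u thE.
  exists (v - J (C v) + J u).
  have Cu : C (v - J (C v) + J u) = u by rewrite linearD linearB !CJ subrr add0r.
  congr (_, _); first by rewrite Cu u1.
  transitivity ((v - J (C v) + J u) - J (C (v - J (C v) + J u)) + J (th2 (C (v - J (C v) + J u)))) => //.
  by rewrite Cu u2 addrK subrK.
apply: (@free_restr_pdle _ _ Psi).
  exact: inj_comp om_inj (@basis_map_inj _).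
move=> z; have [q <-] := om_surj z; have [f <-] := basis_map_surj q.
by exists f.
Qed.

Lemma pdle_upper d (M : lmodType A) : pdle d (restr M) -> pdle (d + n) M.
Proof.
elim: d M => [|d IH] M hM; first exact: projective_restr_pdle.
have [K [i hi]] := ses_ker (free_cover_surj (M := M)).
exists (free_mod A M), K, i, (free_cover M); split=> //; first exact: projective_free.
apply: IH; apply: schanuel hM; last exact: (ses_restr iota hi).
exact: projective_restr_free.
Qed.

Definition right_eval (f : free_mod R mn) : A := fext (fun m r => mon m * iota r) f.

Let phiD (m : mn) (r s : R) : mon m * iota (r + s) = mon m * iota r + mon m * iota s.
Proof. by rewrite rmorphD mulrDr. Qed.

Lemma right_evalD f g : right_eval (f + g) = right_eval f + right_eval g.
Proof. exact: fextD. Qed.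

Lemma right_evalU r m : right_eval (fgen r m) = mon m * iota r.
Proof. exact: fextU. Qed.

Lemma right_eval0 : right_eval 0 = 0. Proof. exact: fext0. Qed.

(** Since [sg m] is onto, a term [iota r * mon m] equals [mon m * iota (s r)] up to lower degree,
    and induction on the degree finishes. *)
Lemma right_eval_surj a : exists f, right_eval f = a.
Proof.
have [d ad] : exists d, lo hfree d a.
  have [s hs] := cf_supp hfree a; exists (\max_(m <- s) mdeg m).+1 => m am.
  have ms : m \in s by apply: contraR am => /hs ->.
  by rewrite ltnS; apply: leq_bigmax_seq.
elim: d a ad => [|d IH] a.
  by move=> a0; exists 0; rewrite right_eval0; apply: (cf_ext (hfree := hfree)) => m;
     rewrite cf0 (cf_lo a0).
apply: (sp_ind (P := fun a => exists f, right_eval f = a)).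
- by exists 0; rewrite right_eval0.
- by move=> _ _ [f <-] [g <-]; exists (f + g); rewrite right_evalD.
- move=> r m; rewrite ltnS => md; have [s sK Ks] := sg_bij hfree hbij m.
  have [f fE] := IH _ (lo_le md (@mon_iota _ _ _ _ _ hfree hbij m (s r))).
  by exists (fgen (s r) m - f); rewrite right_evalD right_evalU;
     rewrite Ks in fE; have -> : right_eval (- f) = - right_eval f;
     [apply/eqP; rewrite -addr_eq0 -right_evalD addNr right_eval0
     | rewrite fE opprB addrC subrK].
Qed.

(** At a monomial [m0] of maximal degree in the support, the left coefficient of the value is
    [sg m0 (co f m0)], which is nonzero. *)
Lemma right_eval_inj f : right_eval f = 0 -> f = 0.
Proof.
move=> e; apply: contrapT => f0.
have [m1 c1] : exists m, co f m != 0.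
  apply: contrapT => nex; apply: f0; apply: co_inj => m; rewrite co0.
  by apply: contrapT => /eqP c; apply: nex; exists m.
have fs m : co f m != 0 -> m \in fsupp f.
  by move=> c; apply: contraR c => /fsupp_out ->.
have [m0 [_ c0 mx]] := seq_maximum (le := fun a b : mn => (mdeg a <= mdeg b)%N)
  (P := fun m => co f m != 0) (fun a b => leq_total _ _)
  (fun b a c => @leq_trans _ _ _) (fs _ c1) c1.
have : cf (right_eval f) m0 = 0 by rewrite e cf0.
have cfs (s : seq mn) (F : mn -> A) : cf (\sum_(m <- s) F m) m0 = \sum_(m <- s) cf (F m) m0.
  exact: (big_morph (fun a => cf a m0) (fun a b => cfD hfree a b m0) (cf0 hfree m0)).
rewrite /right_eval /fext cfs (bigD1_seq m0) ?fsupp_uniq ?fs //= big1_seq.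
  rewrite addr0 -sg_cf => /eqP; rewrite sg_eq0; exact/negP.
move=> m /andP[mm ms]; have [->|cm] := eqVneq (co f m) 0.
  by rewrite rmorph0 mulr0 cf0.
have := cf_lo (@mon_iota _ _ _ _ _ hfree hbij m (co f m)) (mx m ms cm).
rewrite cfB cfU; case: (m0 =P m) => [mE|_]; last by rewrite subr0.
by rewrite mE eqxx in mm.
Qed.

(** The coefficient of 1 in the right basis of monomials. It makes [R] a right direct summand of
    [A], on which rest both the embedding of an [R]-module in an [A]-module and the recovery of a
    left ideal J from AJ. *)
Lemma right_retraction : exists rho : A -> R,
  [/\ forall a b, rho (a + b) = rho a + rho b,
      forall a r, rho (a * iota r) = rho a * r & rho 1 = 1].
Proof.
pose co1 a := sval (cid (right_eval_surj a)).
have co1K a : right_eval (co1 a) = a by rewrite /co1; case: cid.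
have evN f : right_eval (- f) = - right_eval f.
  by apply/eqP; rewrite -addr_eq0 -right_evalD addNr right_eval0.
have inj f g : right_eval f = right_eval g -> f = g.
  move=> e; apply/eqP; rewrite -subr_eq0; apply/eqP/right_eval_inj.
  by rewrite right_evalD evN e subrr.
have fin (f : free_mod R mn) r : finsupp (fun m => co f m * r).
  by have [s hs] := finsupp_co f; exists s => m /hs ->; rewrite mul0r.
have evM f r : right_eval (mkfree (fin f r)) = right_eval f * iota r.
  have fE := free_sumE (fsupp_uniq f) (@fsupp_out _ _ f).
  rewrite /right_eval (fextE phiD (s := fsupp f)) ?fsupp_uniq //; last first.
    by move=> k /fsupp_out h; change (co f k * r = 0); rewrite h mul0r.
  by rewrite /fext mulr_suml; apply: eq_bigr => k _; rewrite -mulrA -rmorphM.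
exists (fun a => co (co1 a) (mzero n)); split=> [a b|a r|].
- by rewrite -coD; congr (co _ _); apply: inj; rewrite right_evalD !co1K.
- transitivity (co (mkfree (fin (co1 a) r)) (mzero n)) => //.
  by congr (co _ _); apply: inj; rewrite evM !co1K.
- have -> : co1 1 = fgen 1 (mzero n).
    by apply: inj; rewrite co1K right_evalU mon0 rmorph1 mulr1.
  by rewrite coUU.
Qed.

Lemma embed_restr (M : lmodType R) : exists (N : lmodType A)
  (i : {linear M -> restr N}), injective i.
Proof.
have [rho [rhoD rhoM rho1]] := right_retraction.
have rho0 : rho 0 = 0 by apply: (addrI (rho 0)); rewrite -rhoD !addr0.
pose G := free_mod A M.
(* The map from A (x) M to M induced by [rho], written on the free module on [M]. *)
pose Phi (v : G) : M := fext (fun m a => rho a *: m) v.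
have phD (m : M) (a b : A) : rho (a + b) *: m = rho a *: m + rho b *: m.
  by rewrite rhoD scalerDl.
have PhiD u v : Phi (u + v) = Phi u + Phi v by apply: fextD.
have PhiU a m : Phi (fgen a m) = rho a *: m by apply: fextU.
have Phi0 : Phi 0 = 0 by apply: fext0.
(* [S] is the largest A-submodule of the kernel of [Phi]; the quotient by [S]
   stands in for the tensor product of A and M over R. *)
pose S : set G := fun v => forall b : A, Phi (b *: v) = 0.
have hS : is_submodule S.
  split=> [b|a u v hu hv b]; first by rewrite scaler0.
  by rewrite scalerDr scalerA PhiD hu hv addr0.
have [N [p [ps pk]]] := quotient_exists hS.
have lin : linear ((fun m => p (fgen 1 m)) : M -> restr N).
  move=> a u v; rewrite restr_scaleE.
  apply/eqP; rewrite -subr_eq0; apply/eqP.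
  transitivity (p (fgen 1 (a *: u + v) - (iota a *: fgen 1 u + fgen 1 v))).
    by rewrite [RHS](linearB p) (linearD p) (linearZZ p).
  apply/pk => b; rewrite scalerBr scalerDr scalerA !fgenZ !mulr1.
  have PhiN w : Phi (- w) = - Phi w.
    by apply/eqP; rewrite -addr_eq0 -PhiD addNr Phi0.
  by rewrite PhiD PhiN PhiD !PhiU rhoM scalerDr scalerA subrr.
exists N, (mklin lin); apply: linear_inj0 => m /pk /(_ 1).
by rewrite scale1r PhiU rho1 scale1r.
Qed.

Lemma pdle_lower d : (forall M : lmodType R, pdle d.+1 M) ->
  (forall N : lmodType A, pdle d N) -> forall M : lmodType R, pdle d M.
Proof.
move=> hR hA M; have [N [i ii]] := embed_restr M.
by apply: (pdle_sub hR ii); apply: pdle_restr_pbw.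
Qed.

Lemma lgld_upper : (lgld A <= lgld R + (Posz n)%:E)%E.
Proof.
have [->|[d e]] := lgld_cases R; first by rewrite addye ?leey.
have hR : forall M : lmodType R, pdle d M by apply/lgldP; rewrite e.
by rewrite e -EFinD -PoszD; apply/lgldP => M; apply: pdle_upper.
Qed.

(** [pdle_lower] gains one unit, so it is repeated downwards from the finite bound [d + k] for [R]
    to the bound [d] of [A]. *)
Lemma pdle_lower_iter d k : (forall M : lmodType R, pdle (d + k) M) ->
  (forall N : lmodType A, pdle d N) -> forall M : lmodType R, pdle d M.
Proof.
elim: k => [|k IH]; first by rewrite addn0.
rewrite addnS => hR hA; apply: IH => //; apply: pdle_lower => // N.
exact: pdle_mono (leq_addr _ _) (hA N).
Qed.

Lemma lgld_lower : (lgld R < +oo)%E -> (lgld R <= lgld A)%E.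
Proof.
have [->|[d e]] := lgld_cases R; first by rewrite ltxx.
move=> _; have [->|[d' e']] := lgld_cases A; first by rewrite leey.
have hR : forall M : lmodType R, pdle d M by apply/lgldP; rewrite e.
have hA : forall M : lmodType A, pdle d' M by apply/lgldP; rewrite e'.
rewrite e'; apply/lgldP; apply: (@pdle_lower_iter d' d) => // M.
exact: pdle_mono (leq_addl _ _) (hR M).
Qed.

End GlobalDimension.

(** * Change of rings for a regular normal element *)

Section RingMorphisms.
Variables (S B : nzRingType) (f : S -> B).
Hypotheses (fD : forall a b, f (a + b) = f a + f b)
  (fM : forall a b, f (a * b) = f a * f b) (f1 : f 1 = 1).

Fact mkrmorph_zmod : zmod_morphism f.
Proof.
have f0 : f 0 = 0 by apply: (addrI (f 0)); rewrite -fD !addr0.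
move=> a b; rewrite fD; congr (_ + _); apply/eqP.
by rewrite -addr_eq0 -fD addNr f0.
Qed.

Fact mkrmorph_monoid : monoid_morphism f.
Proof. by split. Qed.

Definition mkrmorph : {rmorphism S -> B} :=
  HB.pack f (GRing.isZmodMorphism.Build S B f mkrmorph_zmod)
    (GRing.isMonoidMorphism.Build S B f mkrmorph_monoid).

End RingMorphisms.

Section Kaplansky.
Variables (A S : nzRingType) (pi : {rmorphism A -> S}) (j : {rmorphism S -> A}).
Variables (z : A) (tau : {rmorphism A -> A}).
Hypotheses (piK : cancel j pi) (pi_z : pi z = 0).
Hypothesis ker_pi : forall a, pi a = 0 -> exists b, a = z * b.
Hypothesis z_lreg : forall a, z * a = 0 -> a = 0.
Hypothesis z_rreg : forall a, a * z = 0 -> a = 0.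
Hypothesis tauE : forall a, tau a * z = z * a.
Hypothesis tau_surj : forall a, exists b, tau b = a.

Definition torsion_free (M : lmodType A) : Prop :=
  forall m : M, z *: m = 0 -> m = 0.

Lemma torsion_free_projective (P : lmodType A) :
  projective_module P -> torsion_free P.
Proof.
move=> hP m zm; have [s sK] := projective_section hP (free_cover_surj (M := P)).
rewrite -(sK m); have -> : s m = 0; last exact: linear0.
apply: co_inj => k; apply: z_lreg.
by rewrite -coZ -linearZZ zm linear0.
Qed.

Definition zsub (M : lmodType A) : set M := fun m => exists m', m = z *: m'.

(** Normality of [z]: if [tau b = a], then [a * z = z * b]. *)
Lemma zsub_submodule (M : lmodType A) : is_submodule (@zsub M).
Proof.
split=> [|a _ _ [u ->] [v ->]]; first by exists 0; rewrite scaler0.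
have [b <-] := tau_surj a; exists (b *: u + v).
by rewrite scalerA tauE scalerDr scalerA.
Qed.

(** Since [z] kills [Q], an element [a] acts on [Q] as [j (pi a)]; restriction along the section [j]
    is thus the [S]-structure of K/zK, and a lifting problem over [S] becomes one over [A] along
    [pi]. *)
Lemma zquot_proj (K Q : lmodType A) (q : {linear K -> Q}) :
  surj q -> (forall k, q k = 0 <-> zsub k) -> projective_module K ->
  projective_module (restr j Q).
Proof.
move=> sq kq hK X Y g f sg.
have q_pi a k : q (a *: k) = q (j (pi a) *: k).
  apply/eqP; rewrite -subr_eq0 -linearB; apply/eqP/kq; rewrite -scalerBl.
  have [|b ->] := @ker_pi (a - j (pi a)); first by rewrite rmorphB piK subrr.
  by exists (b *: k); rewrite scalerA.
have lin : linear ((fun k => f (q k)) : K -> restr pi Y).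
  move=> a u v; rewrite restr_scaleE -linearP; congr (f _).
  by rewrite linearD q_pi linearZZ.
have [h hE] := projective_lift (mklin lin) hK
  (sg : surj (restr_map pi g)).
have [h' h'E] : exists h' : {linear Q -> restr pi X}, forall k, h' (q k) = h k.
  apply: factor_surj => // _ /kq [k ->].
  by rewrite linearZZ restr_scaleE pi_z scale0r.
have lin' : linear (h' : restr j Q -> X).
  move=> s u v; rewrite restr_scaleE linearP restr_scaleE piK.
  by [].
exists (mklin lin') => q0; have [k <-] := sq q0.
by rewrite mklinE h'E; apply: hE.
Qed.

(** Reduction modulo [z] keeps the sequence exact because [K] has no [z]-torsion: if [i l = z *: u],
    then [p u] is killed by [z], so [u] comes from [L] and [l] lies in [z L]. *)
Lemma zquot_pdle d (K Q : lmodType A) (q : {linear K -> Q}) :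
  surj q -> (forall k, q k = 0 <-> zsub k) -> torsion_free K ->
  pdle d K -> pdle d (restr j Q).
Proof.
elim: d K Q q => [|d IH] K Q q sq kq tK; first exact: zquot_proj.
move=> [P [L [i [p [hP [ii sp ek] hL]]]]].
have tP := torsion_free_projective hP.
have tL : torsion_free L.
  by move=> l zl; apply: (linear_inj_eq0 ii); apply: tP; rewrite -linearZZ zl linear0.
have [QP [qP [sqP kqP]]] := quotient_exists (@zsub_submodule P).
have [QL [qL [sqL kqL]]] := quotient_exists (@zsub_submodule L).
have [p' p'E] : exists p' : {linear QP -> Q}, forall x, p' (qP x) = q (p x).
  apply: (factor_surj (f := q \o p : {linear P -> Q})) => // _ /kqP[x ->].
  by apply/kq; exists (p x); rewrite linearZZ.
have [i' i'E] : exists i' : {linear QL -> QP}, forall x, i' (qL x) = qP (i x).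
  apply: (factor_surj (f := qP \o i : {linear L -> QP})) => // _ /kqL[x ->].
  by apply/kqP; exists (i x); rewrite linearZZ.
have pi0 l : p (i l) = 0 by apply/ek; exists l.
exists (restr j QP), (restr j QL), (restr_map j i'), (restr_map j p'); split.
- exact: zquot_proj hP.
- apply: ses_restr; split.
  + apply: linear_inj0 => y; have [l <-] := sqL y.
    rewrite i'E => /kqP[u e]; apply/kqL.
    have pu : p u = 0 by apply: tK; rewrite -linearZZ -e pi0.
    have [l' l'E] := proj1 (ek u) pu; exists l'; apply: ii.
    by rewrite linearZZ l'E.
  + by move=> y; have [k <-] := sq y; have [u <-] := sp k; exists (qP u).
  + move=> y; have [u <-] := sqP y; rewrite p'E; split.
      move=> /kq[k e]; have [u' u'E] := sp k.
      have [l lE] : exists l, i l = u - z *: u'.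
        by apply/ek; rewrite linearB linearZZ e u'E subrr.
      exists (qL l); rewrite i'E lE linearB.
      by have -> : qP (z *: u') = 0; [apply/kqP; exists u' | rewrite subr0].
    move=> [y' e]; move: e; have [l <-] := sqL y'; rewrite i'E => e.
    by rewrite -p'E -e p'E pi0 linear0.
- exact: (IH _ _ qL).
Qed.

Lemma tau_z : tau z = z.
Proof. by apply/eqP; rewrite -subr_eq0; apply/eqP/z_rreg; rewrite mulrBl tauE subrr. Qed.

(* For an S-module [M], viewed as an A-module through [pi \o tau], and a free
   cover [F -> M] with kernel [K], multiplication by [z] embeds M = F/K as
   zF/zK in K/zK, whose projective dimension over S is at most that of K. *)
Lemma kaplansky_step d : (forall M : lmodType S, pdle d.+1 M) ->
  (forall N : lmodType A, pdle d.+1 N) -> forall M : lmodType S, pdle d M.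
Proof.
move=> hS hA M; pose Mt := restr (pi \o tau : {rmorphism A -> S}) M.
pose F := free_mod A Mt; pose p : {linear F -> Mt} := free_cover Mt.
have sp : surj p by apply: free_cover_surj.
have [K [i hi]] := ses_ker sp; have [ii _ ek] := hi.
have hF : projective_module F by apply: projective_free.
have tF := torsion_free_projective hF.
have tK : torsion_free K.
  by move=> l zl; apply: (linear_inj_eq0 ii); apply: tF; rewrite -linearZZ zl linear0.
have hK : pdle d K by apply: schanuel hF hi (hA Mt).
have [Q [q [sq kq]]] := quotient_exists (@zsub_submodule K).
have hQ := zquot_pdle sq kq tK hK.
have zin m : exists k, i k = z *: fgen 1 (m : Mt).
  apply/ek; rewrite linearZZ flinU scale1r.
  transitivity (pi (tau z) *: m) => //.
  by rewrite tau_z pi_z scale0r.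
pose k m := sval (cid (zin m)); have kE m : i (k m) = z *: fgen 1 (m : Mt).
  by rewrite /k; case: cid.
have lin : linear ((fun m => q (k m)) : M -> restr j Q).
  move=> s u v; rewrite restr_scaleE -linearP.
  (* Here [j s * z = z * b], so the twist by [tau] in [Mt] compensates the one caused by moving a
     scalar past [z]. *)
  have [b bE] := tau_surj (j s).
  apply/eqP; rewrite -subr_eq0 -linearB; apply/eqP/kq.
  have [k' k'E] : exists k', i k' = fgen 1 (s *: u + v : Mt) - (b *: fgen 1 (u : Mt) + fgen 1 (v : Mt)).
    apply/ek; rewrite linearB linearD linearZZ !flinU !scale1r restr_scaleE /= bE piK.
    exact: subrr.
  exists k'; apply: ii; rewrite linearB linearP !kE linearZZ k'E scalerBr.
  by rewrite scalerDr !scalerA -tauE bE.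
apply: (pdle_sub (i := mklin lin) hS) hQ.
apply: linear_inj0 => m; rewrite mklinE => /kq[k' e].
have : fgen 1 (m : Mt) - i k' = 0.
  by apply: tF; rewrite scalerBr -kE e linearZZ subrr.
move/(congr1 p); rewrite linearB linear0 flinU scale1r.
have -> : p (i k') = 0 by apply/ek; exists k'.
by rewrite subr0.
Qed.

(** [S], as an [A]-module through [pi], is nonzero and killed by [z], whereas projective modules are
    torsion free. *)
Lemma not_pdle0 : ~ forall N : lmodType A, pdle 0 N.
Proof.
move=> /(_ (restr pi S^o)) /torsion_free_projective /(_ (1 : S)).
rewrite restr_scaleE pi_z scale0r => /(_ erefl) /eqP.
by rewrite oner_eq0.
Qed.

(** The bound [e + d] for [S] is a finite starting point, lowered by [kaplansky_step] to one below
    the bound for [A]. *)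
Lemma kaplansky d e : (forall M : lmodType S, pdle (e + d) M) ->
  (forall N : lmodType A, pdle e N) ->
  exists e', e = e'.+1 /\ forall M : lmodType S, pdle e' M.
Proof.
case: e => [|e] hS hA; first by case: not_pdle0.
exists e; split=> //; elim: d hS => [|d IH] hS.
  by apply: kaplansky_step hA; rewrite addn0 in hS.
apply: IH; rewrite addnS in hS; apply: kaplansky_step hS _ => N.
by apply: pdle_mono (hA N); rewrite addSn ltnS ltnW // ltnS leq_addr.
Qed.

End Kaplansky.

(** * Quasi-commutative extensions *)

Section QuasiCommutative.
Variables (R A : nzRingType) (iota : {rmorphism R -> A}).
Variables (n : nat) (x : 'I_n -> A).
Hypotheses (hfree : pbw_basis iota x) (hbij : pbw_bijective iota x).
Hypothesis hqc : pbw_quasi_commutative iota x.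
Local Notation mn := {ffun 'I_n -> nat}.
Local Notation mon := (pbw_mon x).
Local Notation cf := (cf hfree).
Local Notation sp := (sp hfree).

Lemma qc_xiota i r : exists c, x i * iota r = iota c * x i.
Proof.
have [->|r0] := eqVneq r 0; first by exists 0; rewrite !rmorph0 mulr0 mul0r.
by have [c [_ e]] := proj1 hqc i r r0; exists c.
Qed.

Lemma qc_xmon i (b : mn) : sp (fun m => m = madd (munit i) b) (x i * mon b).
Proof.
have [m] := ubnP (mdeg b); elim: m i b => // m IH i b; rewrite ltnS => bm.
have exact_case : (forall k : 'I_n, (k < i)%N -> b k = 0%N) ->
    sp (fun m => m = madd (munit i) b) (x i * mon b).
  by move=> h; rewrite mon_step //; apply: sp_mon.
have [/mdeg_eq0 b0|b_gt0] := posnP (mdeg b).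
  by apply: exact_case => k _; rewrite b0 ffunE.
have [j bj bmin] := mneq0_min b_gt0.
have [ij|ji] := leqP i j.
  by apply: exact_case => k ki; apply: bmin; apply: leq_trans ki ij.
have db := mdeg_mpred bj.
have [c [_ e]] := proj2 hqc j i.
rewrite (mon_pred x bj bmin) mulrA e -!mulrA; apply: sp_Z.
apply: (sp_ind (P := fun a => sp (fun m => m = madd (munit i) b) (x j * a)) _ _ _
  (IH i (mpred j b) _)) => [|u v|r l ->|]; last by rewrite -db.
- by rewrite mulr0; apply: sp_0.
- by rewrite mulrDr; apply: sp_D.
- have [c' e'] := qc_xiota j r; rewrite mulrA e' -mulrA; apply: sp_Z.
  rewrite mon_step; first by apply: sp_mon; rewrite maddCA mpredK.
  move=> k kj; rewrite !ffunE bmin // sub0n addn0; case: eqP => // ki.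
  by move: kj; rewrite ki ltnNge ltnW.
Qed.

Lemma qc_mon_iota_sp (a : mn) r : sp (fun m => m = a) (mon a * iota r).
Proof.
elim/mon_ind: a r => [|j a aj IH] r.
  by rewrite mon0 mul1r -[iota r]mulr1 -(mon0 x); apply: sp_U.
rewrite -mon_step // -mulrA.
apply: (sp_ind (P := fun a' => sp (fun m => m = madd (munit j) a) (x j * a')) _ _ _
  (IH r)) => [|u v|s l ->].
- by rewrite mulr0; apply: sp_0.
- by rewrite mulrDr; apply: sp_D.
- have [c' e'] := qc_xiota j s; rewrite mulrA e' -mulrA; apply: sp_Z.
  exact: qc_xmon.
Qed.

Lemma qc_mon_mon_sp (a b : mn) : sp (fun m => m = madd a b) (mon a * mon b).
Proof.
elim/mon_ind: a => [|j a aj IH].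
  by rewrite mon0 mul1r maddC madd0; apply: sp_mon.
rewrite -mon_step // -mulrA -maddA.
apply: (sp_ind (P := fun a' => sp (fun m => m = madd (munit j) (madd a b)) (x j * a')) _ _ _
  IH) => [|u v|s l ->].
- by rewrite mulr0; apply: sp_0.
- by rewrite mulrDr; apply: sp_D.
- have [c' e'] := qc_xiota j s; rewrite mulrA e' -mulrA; apply: sp_Z.
  exact: qc_xmon.
Qed.

(** Turns congruences modulo lower degree into equalities: quasi-commutativity confines an error
    term to the single monomial [m], and the general estimates put it in lower degree. *)
Lemma sp_lo0 a m : sp (fun l => l = m) a -> lo hfree (mdeg m) a -> a = 0.
Proof.
move=> h1 h2; apply: (cf_ext (hfree := hfree)) => l; rewrite cf0.
apply: contrapT => /eqP c; have := h2 _ c; rewrite (h1 _ c).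
by rewrite ltnn.
Qed.

Lemma qc_mon_mon (a b : mn) :
  exists u, two_sided_unit u /\ mon a * mon b = iota u * mon (madd a b).
Proof.
have [u [uu hu]] := mon_mon hfree hbij a b; exists u; split=> //.
apply/eqP; rewrite -subr_eq0; apply/eqP; rewrite -mdegD in hu.
by apply: sp_lo0 hu; apply: sp_B; [apply: qc_mon_mon_sp|apply: sp_U].
Qed.

Lemma qc_mon_iota (a : mn) r : mon a * iota r = iota (sg hfree hbij a r) * mon a.
Proof.
apply/eqP; rewrite -subr_eq0; apply/eqP.
apply: (sp_lo0 (m := a)); last exact: mon_iota.
by apply: sp_B; [apply: qc_mon_iota_sp|apply: sp_U].
Qed.

Lemma qc_sp_mul (Q1 Q2 Q : mn -> Prop) a b :
  (forall m l, Q1 m -> Q2 l -> Q (madd m l)) ->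
  sp Q1 a -> sp Q2 b -> sp Q (a * b).
Proof.
move=> hQ ha hb; move: a ha.
apply: (sp_ind (P := fun a => sp Q (a * b))) => [|u v|r m Qm].
- by rewrite mul0r; apply: sp_0.
- by rewrite mulrDl; apply: sp_D.
move: b hb.
apply: (sp_ind (P := fun b => sp Q (iota r * mon m * b))) => [|u v|s l Ql].
- by rewrite mulr0; apply: sp_0.
- by rewrite mulrDr; apply: sp_D.
- rewrite -mulrA; apply: sp_Z; rewrite mulrA qc_mon_iota -mulrA; apply: sp_Z.
  by apply: sp_sub (qc_mon_mon_sp (a := m) (b := l)) => _ ->; apply: hQ.
Qed.

Section Face.
Variable T : pred mn.
Hypotheses (T0 : T (mzero n)) (TD : forall m l, T (madd m l) = T m && T l).

Fact face_fin a : finsupp (fun m => if T m then cf a m else 0).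
Proof.
by have [s hs] := cf_supp hfree a; exists s => m /hs ->; rewrite if_same.
Qed.

(** [T] is a face of the monoid of exponents: a sum lies in [T] exactly when both summands do. In
    the quasi-commutative case the monomials in [T] then span a subring and the others a two-sided
    ideal, so this truncation is a ring morphism. *)
Definition face (a : A) : A := pbw_eval iota x (mkfree (face_fin a)).

Lemma cf_face a m : cf (face a) m = if T m then cf a m else 0.
Proof. by rewrite cfE pbw_evalK. Qed.

Lemma face_D a b : face (a + b) = face a + face b.
Proof.
apply: (cf_ext (hfree := hfree)) => m; rewrite cfD !cf_face cfD.
by case: ifP; rewrite ?addr0.
Qed.

Lemma face_id a : sp T a -> face a = a.
Proof.
move=> h; apply: (cf_ext (hfree := hfree)) => m; rewrite cf_face.
case: ifP => // /negbT; apply: contraNeq => c; apply: h.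
by rewrite eq_sym.
Qed.

Lemma face_sp a : sp T (face a).
Proof. by move=> m; rewrite cf_face; case: ifP => //; rewrite eqxx. Qed.

Lemma face0P a : face a = 0 <-> sp (fun m => ~~ T m) a.
Proof.
split=> [e m|h].
  by apply: contraNN => Tm; rewrite -[cf a m](ifT _ 0 Tm) -cf_face e cf0.
apply: (cf_ext (hfree := hfree)) => m; rewrite cf_face cf0.
by case: ifP => // Tm; apply/eqP; apply: contraTT Tm => /h.
Qed.

Lemma face_diff a : sp (fun m => ~~ T m) (a - face a).
Proof.
move=> m; rewrite cfB cf_face; case: ifP => // _.
by rewrite subrr eqxx.
Qed.

Lemma face_M a b : face (a * b) = face a * face b.
Proof.
have eqB u v : face (u - v) = 0 -> face u = face v.
  by move=> e; rewrite -[u](subrK v) face_D e add0r.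
have -> : face a * face b = face (face a * face b).
  apply/esym/face_id; apply: qc_sp_mul (@face_sp a) (@face_sp b) => m l Tm Tl.
  by rewrite TD Tm Tl.
apply: eqB; have -> : a * b - face a * face b = (a - face a) * b + face a * (b - face b).
  by rewrite mulrBl mulrBr addrA subrK.
apply/face0P; apply: sp_D.
  apply: (qc_sp_mul (Q2 := fun=> True)) (face_diff (a := a)) _ => // m l nT _.
  by rewrite TD negb_and nT.
apply: (qc_sp_mul (Q1 := fun=> True)) _ (face_diff (a := b)) => // m l _ nT.
by rewrite TD negb_and nT orbT.
Qed.

Definition face_ring_pred : {pred A} := fun a => `[< sp T a >].

Lemma face_ring_closed : GRing.subring_closed face_ring_pred.
Proof.
split=> [|a b /asboolP ha /asboolP hb|a b /asboolP ha /asboolP hb]; apply/asboolP.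
- by rewrite -(mon0 x); apply: sp_mon.
- exact: sp_B.
- by apply: qc_sp_mul ha hb => m l Tm Tl; rewrite TD Tm Tl.
Qed.

End Face.

Section OneVariable.
Variable i : 'I_n.
Local Notation z := (x i).

Lemma qc_z_left : exists u : mn -> R, (forall m, two_sided_unit (u m)) /\
  forall r m, z * (iota r * mon m) = iota (sig hbij i r * u m) * mon (madd (munit i) m).
Proof.
have h m : exists u, two_sided_unit u /\ z * mon m = iota u * mon (madd (munit i) m).
  by rewrite -monU; apply: qc_mon_mon.
exists (fun m => sval (cid (h m))); split=> [m|r m]; case: cid => u [uu e] //=.
rewrite rmorphM -[RHS]mulrA -e !mulrA; congr (_ * _).
have [c e'] := qc_xiota i r; rewrite e'; congr (iota _ * _).
by apply: (@sig_uniq _ _ _ _ _ hfree hbij i r c 0); rewrite rmorph0 addr0 e'.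
Qed.

Lemma qc_z_right : exists u : mn -> R, (forall m, two_sided_unit (u m)) /\
  forall r m, iota r * mon m * z = iota (r * u m) * mon (madd (munit i) m).
Proof.
have h m : exists u, two_sided_unit u /\ mon m * z = iota u * mon (madd (munit i) m).
  by rewrite -monU maddC; apply: qc_mon_mon.
exists (fun m => sval (cid (h m))); split=> [m|r m]; case: cid => u [uu e] //=.
by rewrite -mulrA e mulrA rmorphM.
Qed.

Lemma sg_sig0 r : (sig hbij i r == 0) = (r == 0).
Proof. by rewrite -[RHS](inj_eq (bij_inj (sig_bij hbij i))) (sig0 hfree). Qed.

Lemma unit_mul_eq0 (u r : R) : two_sided_unit u -> r * u = 0 -> r = 0.
Proof. by move=> uu e; apply/eqP; apply: contraPT e => /(unit_mul_neq0 uu)/eqP. Qed.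

Lemma qc_z_lreg a : z * a = 0 -> a = 0.
Proof.
have [u [uu hu]] := qc_z_left.
have e m : cf (z * a) (madd (munit i) m) = sig hbij i (cf a m) * u m.
  apply: (sp_ind (hfree := hfree) (Q := fun=> True) (P := fun a =>
    cf (z * a) (madd (munit i) m) = sig hbij i (cf a m) * u m)) => [|b c hb hc|r l _|//].
  - by rewrite mulr0 !cf0 (sig0 hfree) mul0r.
  - by rewrite mulrDr !cfD hb hc (sigD hfree) mulrDl.
  - rewrite hu !cfU; have [->|ml] := eqVneq m l; first by rewrite eqxx.
    rewrite (sig0 hfree) mul0r; case: eqP => // em.
    by rewrite -(madd_munitK i m) em madd_munitK eqxx in ml.
move=> za; apply: (cf_ext (hfree := hfree)) => m; apply/eqP; rewrite cf0 -sg_sig0.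
by apply/eqP/(unit_mul_eq0 (uu m)); rewrite -e za cf0.
Qed.

Lemma qc_z_rreg a : a * z = 0 -> a = 0.
Proof.
have [u [uu hu]] := qc_z_right.
have e m : cf (a * z) (madd (munit i) m) = cf a m * u m.
  apply: (sp_ind (hfree := hfree) (Q := fun=> True) (P := fun a =>
    cf (a * z) (madd (munit i) m) = cf a m * u m)) => [|b c hb hc|r l _|//].
  - by rewrite mul0r !cf0 mul0r.
  - by rewrite mulrDl !cfD hb hc mulrDl.
  - rewrite hu !cfU; have [->|ml] := eqVneq m l; first by rewrite eqxx.
    rewrite mul0r; case: eqP => // em.
    by rewrite -(madd_munitK i m) em madd_munitK eqxx in ml.
move=> za; apply: (cf_ext (hfree := hfree)) => m; rewrite cf0.
by apply: (unit_mul_eq0 (uu m)); rewrite -e za cf0.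
Qed.

Lemma qc_z_div a : sp (fun m => (0 < m i)%N) a -> exists b, a = z * b.
Proof.
have [u [uu hu]] := qc_z_left.
apply: (sp_ind (P := fun a => exists b, a = z * b)) => [|_ _ [b ->] [c ->]|r m mi].
- by exists 0; rewrite mulr0.
- by exists (b + c); rewrite mulrDr.
have [v [_ vu]] := uu (mpred i m); have [s sK Ks] := sig_bij hbij i.
exists (iota (s (r * v)) * mon (mpred i m)).
by rewrite hu Ks -mulrA vu mulr1 mpredK.
Qed.

Lemma qc_z_rl a : exists b, a * z = z * b.
Proof.
apply: qc_z_div; apply: (qc_sp_mul (Q1 := fun=> True) (Q2 := fun m => m = munit i)) => //.
  by move=> m l _ ->; rewrite !ffunE eqxx addn1.
by rewrite -monU; apply: sp_mon.
Qed.

Lemma qc_z_lr a : exists b, b * z = z * a.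
Proof.
have [u [uu hu]] := qc_z_left; have [v [uv hv]] := qc_z_right.
apply: (sp_ind (hfree := hfree) (Q := fun=> True) (P := fun a => exists b, b * z = z * a))
   => [|a1 a2 [b e] [c f]|r m _|//].
- by exists 0; rewrite mulr0 mul0r.
- by exists (b + c); rewrite mulrDl mulrDr e f.
have [w [_ wv]] := uv m.
exists (iota (sig hbij i r * u m * w) * mon m).
by rewrite hv hu -mulrA wv mulr1.
Qed.

(** Conjugation by the regular normal element [z]; the ring laws follow by cancelling [z] on the
    right. *)
Lemma qc_tau : exists tau : {rmorphism A -> A},
  (forall a, tau a * z = z * a) /\ forall a, exists b, tau b = a.
Proof.
pose t a := sval (cid (qc_z_lr a)).
have tE a : t a * z = z * a by rewrite /t; case: cid.
have inj a b : a * z = b * z -> a = b.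
  by move=> e; apply/eqP; rewrite -subr_eq0; apply/eqP/qc_z_rreg; rewrite mulrBl e subrr.
have tD a b : t (a + b) = t a + t b by apply: inj; rewrite mulrDl !tE mulrDr.
have tM a b : t (a * b) = t a * t b.
  by apply: inj; rewrite -mulrA !tE !mulrA tE.
have t1 : t 1 = 1 by apply: inj; rewrite tE mulr1 mul1r.
exists (mkrmorph tD tM t1); split=> [a|a]; first exact: tE.
by have [b e] := qc_z_rl a; exists b; apply: inj; rewrite e; apply: tE.
Qed.

End OneVariable.

Lemma qc_augmentation : exists rho : {rmorphism A -> R}, cancel iota rho.
Proof.
pose T : pred mn := fun m => m == mzero n.
have T0 : T (mzero n) by apply: eqxx.
have TD m l : T (madd m l) = T m && T l.
  apply/eqP/andP => [e|[/eqP -> /eqP ->]]; last by rewrite madd0.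
  have : (mdeg m + mdeg l = 0)%N by rewrite -mdegD e mdeg0.
  by move/eqP; rewrite addn_eq0 => /andP[/eqP/mdeg_eq0 -> /eqP/mdeg_eq0 ->]; split.
have fE a : face T a = iota (cf a (mzero n)).
  apply: (cf_ext (hfree := hfree)) => m; rewrite cf_face cf_iota /T.
  by case: eqP => [->|].
have inj r s : iota r = iota s -> r = s.
  by move=> /(congr1 (fun a => cf a (mzero n))); rewrite !cf_iota eqxx.
have rD a b : cf (a + b) (mzero n) = cf a (mzero n) + cf b (mzero n) by apply: cfD.
have rM a b : cf (a * b) (mzero n) = cf a (mzero n) * cf b (mzero n).
  by apply: inj; rewrite rmorphM -!fE face_M.
have r1 : cf 1 (mzero n) = 1 by rewrite -(mon0 x) cf_mon eqxx.
by exists (mkrmorph rD rM r1) => r; rewrite /= cf_iota eqxx.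
Qed.

(** Every [R]-module is the restriction of an [A]-module, namely itself through the augmentation,
    and restriction preserves projective modules. A finite bound for [A] thus passes to [R]. *)
Lemma qc_pdle_base d : (forall N : lmodType A, pdle d N) -> forall M : lmodType R, pdle d M.
Proof.
move=> hA M; have [rho rK] := qc_augmentation.
have := pdle_restr_pbw hfree (hA (restr rho M)).
have lin : linear (id : restr iota (restr rho M) -> M).
  by move=> a u v; rewrite !restr_scaleE rK.
by apply: (pdle_iso (f := mklin lin)); exists id.
Qed.

End QuasiCommutative.

(** * Subrings spanned by monomials, and removal of the last variable *)

Section Subring.
Variables (A : nzRingType) (P : {pred A}).

Definition subring_pred (h : GRing.subring_closed P) : {pred A} := P.

Variable hP : GRing.subring_closed P.
HB.instance Definition _ := GRing.isSubringClosed.Build A (subring_pred hP) hP.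

Record subring_of := SubringOf { subring_val : A; _ : subring_val \in subring_pred hP }.
HB.instance Definition _ := [isSub for subring_val].
HB.instance Definition _ := [Choice of subring_of by <:].
HB.instance Definition _ := [SubChoice_isSubNzRing of subring_of by <:].

Lemma subring_exists : exists (S : nzRingType) (j : {rmorphism S -> A}),
  injective j /\ forall a, a \in P <-> exists s, j s = a.
Proof.
exists subring_of, (\val : {rmorphism subring_of -> A}); split; first exact: val_inj.
move=> a; split=> [Pa|[s <-]]; last exact: (valP s).
by exists (@SubringOf a Pa).
Qed.

End Subring.

Lemma factor_rmorph (B S A : nzRingType) (j : {rmorphism S -> A}) (f : {rmorphism B -> A}) :
  injective j -> (forall b, exists s, j s = f b) ->
  exists g : {rmorphism B -> S}, forall b, j (g b) = f b.
Proof.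
move=> ji h; pose g b := sval (cid (h b)).
have gE b : j (g b) = f b by rewrite /g; case: cid.
have gD a b : g (a + b) = g a + g b by apply: ji; rewrite rmorphD !gE rmorphD.
have gM a b : g (a * b) = g a * g b by apply: ji; rewrite rmorphM !gE rmorphM.
have g1 : g 1 = 1 by apply: ji; rewrite gE !rmorph1.
by exists (mkrmorph gD gM g1).
Qed.

Lemma pbw_basisP (R A : nzRingType) (iota : {rmorphism R -> A}) n (x : 'I_n -> A) :
  (forall a, exists f, pbw_eval iota x f = a) ->
  (forall f, pbw_eval iota x f = 0 -> f = 0) -> pbw_basis iota x.
Proof.
move=> hs hi; split=> [a|s c us e m ms].
  by have [f <-] := hs a; exists (fsupp f), (co f).
have fin : finsupp (fun m => if m \in s then c m else 0).
  by exists s => k /negPf ->.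
have cE k : co (mkfree fin) k = if k \in s then c k else 0 by [].
have f0 : mkfree fin = 0.
  apply: hi; rewrite -[RHS]e /pbw_eval (fextE _ us).
  - by apply: eq_big_seq => k ks; rewrite cE ks.
  - by move=> k a b; rewrite rmorphD mulrDl.
  - by move=> k /negPf ks; rewrite cE ks.
by have := cE m; rewrite ms f0 co0.
Qed.

Section FaceRing.
Variables (R A : nzRingType) (iota : {rmorphism R -> A}).
Variables (n : nat) (x : 'I_n.+1 -> A).
Hypotheses (hfree : pbw_basis iota x) (hbij : pbw_bijective iota x).
Hypothesis hqc : pbw_quasi_commutative iota x.
Local Notation mn := {ffun 'I_n -> nat}.
Local Notation mn1 := {ffun 'I_n.+1 -> nat}.
Local Notation z := (x ord_max).

Let T : pred mn1 := fun m => m ord_max == 0%N.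
Let T0 : T (mzero n.+1). Proof. by rewrite /T ffunE. Qed.
Let TD m l : T (madd m l) = T m && T l.
Proof. by rewrite /T ffunE addn_eq0. Qed.

Definition mext (m : mn) : mn1 :=
  [ffun k => if unlift ord_max k is Some i then m i else 0%N].

Lemma mext_lift m i : mext m (lift ord_max i) = m i.
Proof. by rewrite ffunE liftK. Qed.

Lemma mext_max m : mext m ord_max = 0%N.
Proof. by rewrite ffunE unlift_none. Qed.

Lemma mext_inj : injective mext.
Proof. by move=> m l e; apply/ffunP=> i; rewrite -!mext_lift e. Qed.

Lemma mext_exists (m : mn1) : T m -> exists l, m = mext l.
Proof.
move=> /eqP m0; exists [ffun i => m (lift ord_max i)]; apply/ffunP=> k.
by rewrite ffunE; case: unliftP => [i ->|->]; rewrite ?ffunE.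
Qed.

Lemma widen_lift i : widen_ord (leqnSn n) i = lift ord_max i.
Proof. by apply/val_inj; rewrite /= /bump leqNgt ltn_ord. Qed.

(** A/zA is realized as the subring spanned by the monomials without [z]: [j] is the inclusion and
    [pi] the truncation, so the section needed for the change of rings is at hand. *)
Lemma face_ring : exists (S : nzRingType) (pi : {rmorphism A -> S})
  (j : {rmorphism S -> A}) (iotaS : {rmorphism R -> S}) (xS : 'I_n -> S),
  [/\ cancel j pi, pi z = 0, forall a, pi a = 0 -> exists b, a = z * b &
      [/\ pbw_basis iotaS xS, pbw_bijective iotaS xS & pbw_quasi_commutative iotaS xS]].
Proof.
have [S [j [ji js]]] := subring_exists (face_ring_closed hfree hbij hqc T0 TD).
have jin a : sp hfree T a -> exists s, j s = a by move=> h; apply/js/asboolP.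
have face1 : face hfree T 1 = 1.
  by apply: face_id; rewrite -(mon0 x); apply: sp_mon.
pose fr := mkrmorph (@face_D _ _ _ _ _ hfree T)
  (@face_M _ _ _ _ _ hfree hbij hqc T TD) face1.
have [pi piE] := factor_rmorph (f := fr) ji (fun a => jin _ (@face_sp _ _ _ _ _ hfree T a)).
have [iotaS iE] : exists iotaS : {rmorphism R -> S}, forall r, j (iotaS r) = iota r.
  apply: factor_rmorph => // r; apply: jin.
  by rewrite -[iota r]mulr1 -(mon0 x); apply: sp_U.
have xin i : exists s, j s = x (lift ord_max i).
  apply: jin; rewrite -monU; apply: sp_mon; rewrite /T ffunE.
  by rewrite (negPf (neq_lift _ _)).
pose xS i := sval (cid (xin i)).
have xE i : j (xS i) = x (lift ord_max i) by rewrite /xS; case: cid.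
have jsp s : sp hfree T (j s) by apply/asboolP/js; exists s.
have piK : cancel j pi.
  by move=> s; apply: ji; rewrite piE; apply: face_id; apply: jsp.
have pi0 a : pi a = 0 <-> face hfree T a = 0.
  have e := piE a; rewrite -[face _ _ a]/(fr a) -e.
  by split=> [->|e0]; [apply: rmorph0|apply: ji; rewrite e0 rmorph0].
have monE (m : mn) : j (pbw_mon xS m) = pbw_mon x (mext m).
  rewrite /pbw_mon rmorph_prod big_ord_recr /= mext_max expr0 mulr1.
  by apply: eq_bigr => i _; rewrite rmorphXn xE widen_lift mext_lift.
pose push (f : free_mod R mn) : free_mod R mn1 := fext (fun m r => fgen r (mext m)) f.
have genD k (r s : R) : fgen (r + s) (mext k) = fgen r (mext k) + fgen s (mext k).
  exact: fgenD.
have pushD f g : push (f + g) = push f + push g by apply: fextD.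
have pushU r m : push (fgen r m) = fgen r (mext m) by apply: fextU.
have push0 : push 0 = 0 by apply: fext0.
have push_co f m : co (push f) (mext m) = co f m.
  apply: (free_ind (P := fun f => co (push f) (mext m) = co f m)) => [|u v hu hv|k _].
  - by rewrite push0 !co0.
  - by rewrite pushD !coD hu hv.
  - by rewrite pushU !coU (inj_eq mext_inj).
have evE f : j (pbw_eval iotaS xS f) = pbw_eval iota x (push f).
  apply: (free_ind (P := fun f => j (pbw_eval iotaS xS f) = pbw_eval iota x (push f)))
     => [|u v hu hv|k _].
  - by rewrite push0 !pbw_eval0 rmorph0.
  - by rewrite pushD !pbw_evalD rmorphD hu hv.
  - by rewrite pushU !pbw_evalU rmorphM iE monE.
exists S, pi, j, iotaS, xS; split=> //.
- apply/pi0/face0P => m; rewrite -monU cf_mon /T.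
  by case: (m =P _) => [->|_]; rewrite ?eqxx // ffunE eqxx.
- move=> a /pi0/face0P ha; apply: (qc_z_div (hfree := hfree) hbij hqc).
  by apply: sp_sub ha => m; rewrite lt0n.
split.
- apply: pbw_basisP => [s|f f0].
    suff [f fE] : exists f, j (pbw_eval iotaS xS f) = j s by exists f; apply: ji.
    apply: (sp_ind (P := fun a => exists f, j (pbw_eval iotaS xS f) = a) _ _ _ (jsp s)).
    + by exists 0; rewrite pbw_eval0 rmorph0.
    + by move=> _ _ [f <-] [g <-]; exists (f + g); rewrite pbw_evalD rmorphD.
    + by move=> r m /mext_exists[l ->]; exists (fgen r l); rewrite pbw_evalU rmorphM iE monE.
  apply: co_inj => m; rewrite -push_co (_ : push f = 0) ?co0 //.
  by apply: (pbw_eval_inj hfree); rewrite -evE f0 rmorph0.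
- split=> [i|i k ik].
    exists (sig hbij (lift ord_max i)); split; last exact: sig_bij.
    move=> r; exists (delta hbij (lift ord_max i) r); apply: ji.
    by rewrite rmorphD !rmorphM !iE xE -xiota.
  have lk : (lift ord_max i < lift ord_max k)%N by rewrite !lift_max.
  (* [hbij] gives a unit up to affine terms and [hqc] an exact relation; [qc_mon_mon] gives one
     constant with both properties. *)
  have [u [uu ue]] := qc_mon_mon hfree hbij hqc (munit (lift ord_max k)) (munit (lift ord_max i)).
  exists u; split=> //; exists 0, (fun=> 0); rewrite rmorph0 add0r big1 => [|l _].
    apply: ji; rewrite rmorph0 rmorphB !rmorphM iE !xE.
    move: ue; rewrite !monU => ->; rewrite maddC -mon_step; first by rewrite monU subrr.
    move=> l li; rewrite ffunE; case: eqP => // e; move: li; rewrite e.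
    by rewrite ltnNge ltnW.
  by rewrite ?rmorph0 mul0r.
- split=> [i r r0|i k].
    have [c [c0 e]] := proj1 hqc (lift ord_max i) r r0; exists c; split=> //.
    by apply: ji; rewrite !rmorphM !iE xE.
  have [c [c0 e]] := proj2 hqc (lift ord_max i) (lift ord_max k); exists c; split=> //.
  by apply: ji; rewrite !rmorphM !iE !xE.
Qed.

End FaceRing.

(** Each removal of a variable lowers the bound by one. The finite bound for [S] that [kaplansky]
    requires comes from the bound [e] for [R] and the upper estimate [e + n]. *)
Theorem qc_pdle_lower n (R A : nzRingType) (iota : {rmorphism R -> A}) (x : 'I_n -> A) e :
  pbw_basis iota x -> pbw_bijective iota x -> pbw_quasi_commutative iota x ->
  (forall N : lmodType A, pdle e N) ->
  exists e', e = (e' + n)%N /\ forall M : lmodType R, pdle e' M.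
Proof.
elim: n R A iota x e => [|n IH] R A iota x e hf hb hq hA.
  exists e; rewrite addn0; split=> //.
  exact: qc_pdle_base hf hb hq _ hA.
have [S [pi [j [iS [xS [piK pz kerp [hf' hb' hq']]]]]]] := face_ring hf hb hq.
have [tau [tauE taus]] := qc_tau hf hb hq ord_max.
have hR := qc_pdle_base hf hb hq hA.
have hS (M : lmodType S) : pdle (e + n) M by apply: pdle_upper hf' hb' _ _ _; apply: hR.
have [e1 [-> hS1]] := kaplansky piK pz kerp (@qc_z_lreg _ _ _ _ _ hf hb hq ord_max)
  (@qc_z_rreg _ _ _ _ _ hf hb hq ord_max) tauE taus hS hA.
have [e2 [-> hR2]] := IH _ _ _ _ _ hf' hb' hq' hS1.
by exists e2; rewrite addnS.
Qed.

Lemma lgld_qc n (R A : nzRingType) (iota : {rmorphism R -> A}) (x : 'I_n -> A) :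
  pbw_basis iota x -> pbw_bijective iota x -> pbw_quasi_commutative iota x ->
  lgld A = (lgld R + (Posz n)%:E)%E.
Proof.
move=> hf hb hq; apply/le_anti; rewrite (lgld_upper hf hb) /=.
have [->|[e eE]] := lgld_cases A; first by rewrite leey.
have hA : forall N : lmodType A, pdle e N by apply/lgldP; rewrite eE.
have [e' [ee hR]] := qc_pdle_lower hf hb hq hA.
rewrite eE ee PoszD EFinD leeD2r //.
by apply/lgldP.
Qed.

(** * Semisimple rings *)

Section Semisimple.
Variable R : nzRingType.
Hypothesis hss : semisimple_ring R.
Local Open Scope classical_set_scope.

(** A subset maximal among those closed under combinations and meeting [K] at most in 0 is a
    complement: 1 is a sum of elements of simple left ideals, and a simple left ideal [S] with [S v]
    not inside K + C would allow C to be enlarged. *)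
Lemma semisimple_complement (F : lmodType R) (K : set F) : is_submodule K ->
  exists C : set F, [/\ is_submodule C, forall v, C v -> K v -> v = 0 &
    forall v, exists k c, [/\ K k, C c & v = k + c]].
Proof.
move=> hK.
(* Membership of 0 is left out so that the union of the empty chain qualifies. A maximal [C] is
   nonempty, since otherwise the zero submodule would be larger. *)
pose P (C : set F) := (forall a u v, C u -> C v -> C (a *: u + v)) /\
  (forall v, C v -> K v -> v = 0).
have [|C [[Ccl CK] Cmax]] := @Zorn_bigcup F P.
  move=> G GP tot; split=> [a u v [X GX Xu] [Y GY Yv]|v [X GX Xv] Kv].
    have [XY|YX] := tot X Y GX GY.
      by exists Y => //; have [cl _] := GP _ GY; apply: cl => //; apply: XY.
    by exists X => //; have [cl _] := GP _ GX; apply: cl => //; apply: YX.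
  by have [_ h] := GP _ GX; apply: h.
have [c0 Cc0] : exists c, C c.
  apply: contrapT => nex; apply: (Cmax [set 0]).
    split=> [c Cc|/(_ 0 erefl) C0]; first by case: nex; exists c.
    by apply: nex; exists 0.
  by split=> [a _ _ -> ->|v -> //]; rewrite /= scaler0 addr0.
have hC : is_submodule C.
  by split=> //; rewrite -(addNr c0) -scaleN1r; apply: Ccl.
exists C; split=> // v.
pose B : set F := fun v => exists k c, [/\ K k, C c & v = k + c].
have hB : is_submodule B.
  split=> [|a _ _ [k [c [Kk Cc ->]]] [k' [c' [Kk' Cc' ->]]]].
    by exists 0, 0; rewrite addr0; split=> //; apply: sub0.
  exists (a *: k + k'), (a *: c + c').
  by rewrite scalerDr addrACA; split=> //; [apply: (proj2 hK)|apply: (proj2 hC)].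
have [s [s1 sS]] := hss (1 : R^o).
rewrite -[v]scale1r [X in X *: v]s1 scaler_suml; apply: (sub_sum hB) => u /sS.
move=> [S [[hS S0 Smin] Su]]; apply: contrapT => nB.
(* By simplicity [N] is 0 or [S]. The second would put [u *: v] in [B]; with the first, [C'] still
   meets [K] only in 0 and contradicts maximality. *)
pose N : set R^o := fun r => S r /\ B ((r : R) *: v).
have hN : is_submodule N.
  split=> [|a r r' [Sr Br] [Sr' Br']].
    by split; [apply: sub0|rewrite scale0r; apply: sub0].
  split; first exact: (proj2 hS).
  by rewrite scalerDl -scalerA; apply: (proj2 hB).
have N0 r : S r -> B ((r : R) *: v) -> r = 0.
  move=> Sr Br; have [|e|e] := Smin N hN; first by move=> ? [].
    by have : N r by []; rewrite e.
  by have [_ /nB] : N u by rewrite e.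
pose C' : set F := fun w => exists c r, [/\ C c, S r & w = c + (r : R) *: v].
apply: (Cmax C').
  split=> [c Cc|/(_ (u *: v)) h].
    by exists c, 0; rewrite scale0r addr0; split=> //; apply: sub0.
  apply: nB; exists 0, (u *: v); rewrite add0r; split=> //; first exact: sub0.
  by apply: h; exists 0, u; rewrite add0r; split=> //; apply: sub0.
split=> [a _ _ [c [r [Cc Sr ->]]] [c' [r' [Cc' Sr' ->]]]|_ [c [r [Cc Sr ->]]] Kw].
  exists (a *: c + c'), (a *: r + r').
  rewrite scalerDr addrACA scalerA -scalerDl; split=> //.
    exact: (proj2 hC).
  exact: (proj2 hS).
have r0 : r = 0.
  apply: N0 => //; exists (c + (r : R) *: v), (- c).
  by split=> //; [apply: subN|rewrite addrC addKr].
by move: Kw; rewrite r0 scale0r addr0; apply: CK.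
Qed.

Lemma semisimple_projective (M : lmodType R) : projective_module M.
Proof.
pose p := free_cover M; have sp : surj p by apply: free_cover_surj.
have [C [hC CK KC]] := semisimple_complement (is_submodule_ker p).
have [D [i [ii iC]]] := submodule_exists hC.
have bi : injective (p \o i : {linear D -> M}).
  apply: linear_inj0 => d pd; apply: (linear_inj_eq0 ii); apply: CK => //.
  by apply/iC; exists d.
have bs : surj (p \o i : {linear D -> M}).
  move=> m; have [v <-] := sp m; have [k [c [Kk /iC[d dE] ->]]] := KC v.
  by exists d; transitivity (p (i d)) => //; rewrite dE linearD [p k]Kk add0r.
have [g [gK Kg]] := inv_linear bi bs.
apply: (projective_retract (s := i \o g : {linear M -> _}) (p := p)).
  exact: gK.
exact: projective_free.
Qed.

Lemma lgld_semisimple : lgld R = (Posz 0)%:E.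
Proof.
have : (lgld R <= (Posz 0)%:E)%E by apply/lgldP => M; apply: semisimple_projective.
have [->|[d ->]] := lgld_cases R; first by [].
by rewrite lee_fin lez_nat leqn0 => /eqP ->.
Qed.

End Semisimple.

(** * Deviation of preorders *)

Section Ordinals.

Lemma ord_le_refl a : ord_le a a.
Proof. by elim: a => X f IH /= i; exists i; apply: IH. Qed.

Lemma ord_le_trans b a c : ord_le a b -> ord_le b c -> ord_le a c.
Proof.
elim: a b c => X f IH [Y g] [Z h] /= ab bc i.
by have [j fg] := ab i; have [k gh] := bc j; exists k; apply: IH fg gh.
Qed.

(** [osup g] is a supremum of successors, so being below it means being at most some [g j]. *)
Definition ord_lt (a b : ord) : Prop :=
  let: osup Y g := b in exists j : Y, ord_le a (g j).

Lemma ord_ltW a b : ord_lt a b -> ord_le a b.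
Proof.
elim: a b => Z h IH [X f] [i] le /= z; exists i.
by move: le; case: (f i) => W g /= /(_ z); exact: (IH z (osup g)).
Qed.

Lemma ord_le_total a b : ord_le a b \/ ord_lt b a.
Proof.
elim: a b => X f IH [Y g].
have [h|/existsNP[i hi]] := pselect (forall i, exists j, ord_le (f i) (g j)); first by left.
right; exists i; have lt j : ord_lt (g j) (f i).
  by case: (IH i (g j)) => // fg; case: hi; exists j.
by move: lt; case: (f i) => Z h lt j; apply: lt.
Qed.

Lemma ord_min (P : ord -> Prop) : (exists a, P a) ->
  exists a, P a /\ forall b, P b -> ord_le a b.
Proof.
move=> [a Pa]; suff: forall a, (exists b, P b /\ ord_le b a) ->
    exists a, P a /\ forall b, P b -> ord_le a b.
  by apply; exists a; split=> //; apply: ord_le_refl.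
move=> {a Pa}; elim=> X f IH [b [Pb ba]].
have [[i [b' [Pb' b'i]]]|nex] := pselect (exists i b', P b' /\ ord_le b' (f i)).
  by apply: (IH i); exists b'.
exists b; split=> // b' Pb'; apply: ord_le_trans ba _.
have [|] := ord_le_total (osup f) b'; first by [].
by move=> [i h]; case: nex; exists i, b'.
Qed.

End Ordinals.

Definition pchain (T : Type) (dom : T -> Prop) (le : T -> T -> Prop) (lo hi : T)
  (C : nat -> T) : Prop :=
  forall k, [/\ dom (C k), le lo (C k), le (C k) hi & le (C k.+1) (C k)].

(* [dev_le] for the part of a preordered type that satisfies [dom]. *)
Fixpoint pdev (T : Type) (dom : T -> Prop) (le : T -> T -> Prop) (a : ord)
  (lo hi : T) {struct a} : Prop :=
  match a with
  | osup X f => forall C, pchain dom le lo hi C ->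
      exists m, forall k, (m <= k)%N ->
        le (C k) (C k.+1) \/ exists i : X, pdev dom le (f i) (C k.+1) (C k)
  end.

Definition pacc (T : Type) (dom : T -> Prop) (le : T -> T -> Prop) : Prop :=
  forall C : nat -> T, (forall k, dom (C k) /\ le (C k) (C k.+1)) ->
    exists m, forall k, (m <= k)%N -> le (C k) (C m).

Section Maps.
Variables (T1 T2 : Type) (dom1 : T1 -> Prop) (dom2 : T2 -> Prop).
Variables (le1 : T1 -> T1 -> Prop) (le2 : T2 -> T2 -> Prop) (phi : T1 -> T2).
Hypothesis tr1 : forall y x z, le1 x y -> le1 y z -> le1 x z.

Let inside lo hi x := [/\ dom1 x, le1 lo x & le1 x hi].

(** A map strictly monotone in this sense sends a chain to a chain and reflects its stationary
    steps. The conditions are asked inside [[lo, hi]] only, so the induction can pass to the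
    factors, with the images of their ends as new bounds. *)
Lemma pdev_map a lo hi lo2 hi2 :
  (forall x, inside lo hi x -> dom2 (phi x)) ->
  (forall x y, inside lo hi x -> inside lo hi y -> le1 x y -> le2 (phi x) (phi y)) ->
  (forall x y, inside lo hi x -> inside lo hi y -> le1 x y ->
     le2 (phi y) (phi x) -> le1 y x) ->
  (forall x, inside lo hi x -> le2 lo2 (phi x) /\ le2 (phi x) hi2) ->
  pdev dom2 le2 a lo2 hi2 -> pdev dom1 le1 a lo hi.
Proof.
elim: a lo hi lo2 hi2 => X f IH lo hi lo2 hi2 hd hm hr hb h C hC.
have inC k : inside lo hi (C k) by case: (hC k).
have [|m hm'] := h (phi \o C).
  move=> k; have [h1 h2] := hb _ (inC k); split=> //=; first exact: hd.
  by apply: hm => //; case: (hC k).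
exists m => k mk; have [l|[i hi']] := hm' k mk; [left|right].
  by apply: hr => //; case: (hC k).
exists i; apply: IH hi' => [x|x y|x y|x].
- by move=> [d l1 l2]; apply: hd; have [_ ? _] := inC k.+1; have [_ _ ?] := inC k;
     split=> //; [apply: tr1 l1|apply: tr1 l2 _].
all: have sub u : inside (C k.+1) (C k) u -> inside lo hi u by
  move=> [d l1 l2]; have [_ ? _] := inC k.+1; have [_ _ ?] := inC k;
     split=> //; [apply: tr1 l1|apply: tr1 l2 _].
- by move=> /sub ? /sub ?; apply: hm.
- by move=> /sub ? /sub ?; apply: hr.
- move=> ix; have [_ l1 l2] := ix.
  by split; apply: hm => //; apply: sub.
Qed.

Lemma pacc_map :
  (forall x, dom1 x -> dom2 (phi x)) ->
  (forall x y, dom1 x -> dom1 y -> le1 x y -> le2 (phi x) (phi y)) ->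
  (forall x y, dom1 x -> dom1 y -> le1 x y -> le2 (phi y) (phi x) -> le1 y x) ->
  (forall x, le1 x x) -> pacc dom2 le2 -> pacc dom1 le1.
Proof.
move=> hd hm hr refl1 h C hC.
have [|m hm'] := h (phi \o C).
  by move=> k; have [d l] := hC k; split; [apply: hd|apply: hm => //; case: (hC k.+1)].
exists m => k mk; apply: hr; [by case: (hC m)|by case: (hC k)| |exact: hm'].
rewrite -(subnKC mk); elim: (k - m)%N => [|i IH]; first by rewrite addn0.
by rewrite addnS; apply: tr1 IH _; case: (hC (m + i)%N).
Qed.

End Maps.

Section Deviation.
Variables (T : Type) (dom : T -> Prop) (le : T -> T -> Prop).
Hypothesis refl : forall x, le x x.
Hypothesis tr : forall y x z, le x y -> le y z -> le x z.
Local Notation pdev := (pdev dom le).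

Lemma pdev_sub a lo hi lo' hi' : le lo' lo -> le hi hi' ->
  pdev a lo' hi' -> pdev a lo hi.
Proof.
move=> l1 l2; apply: (pdev_map (phi := id) tr) => // [x []//|x [_ h1 h2]].
by split; [apply: tr l1 h1|apply: tr h2 l2].
Qed.

Lemma pdev_le a b lo hi : ord_le a b -> pdev a lo hi -> pdev b lo hi.
Proof.
elim: a b lo hi => X f IH [Y g] lo hi ab h C hC.
have [m hm] := h C hC; exists m => k /hm[l|[i hi']]; [by left|right].
by have [j fg] := ab i; exists j; apply: IH fg hi'.
Qed.

Lemma pdev_triv a lo hi : le hi lo -> pdev a lo hi.
Proof.
case: a => X f l C hC; exists 0%N => k _; left.
have [_ _ h1 _] := hC k; have [_ h2 _ _] := hC k.+1.
exact: tr h1 (tr l h2).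
Qed.

Lemma pchain_mono (C : nat -> T) : (forall k, le (C k) (C k.+1)) ->
  forall k l, (k <= l)%N -> le (C k) (C l).
Proof.
move=> h k l /subnKC <-; elim: (l - k)%N => [|i IH]; first by rewrite addn0.
by rewrite addnS; apply: tr IH _.
Qed.

End Deviation.

(** * Products, finite powers and increasing sequences *)

Section Product.
Variables (T1 T2 : Type) (dom1 : T1 -> Prop) (dom2 : T2 -> Prop).
Variables (le1 : T1 -> T1 -> Prop) (le2 : T2 -> T2 -> Prop).
Hypothesis tr1 : forall y x z, le1 x y -> le1 y z -> le1 x z.
Hypothesis tr2 : forall y x z, le2 x y -> le2 y z -> le2 x z.

Definition prod_dom (z : T1 * T2) := dom1 z.1 /\ dom2 z.2.
Definition prod_le (z w : T1 * T2) := le1 z.1 w.1 /\ le2 z.2 w.2.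

(** Far enough in a chain of pairs both factors are stationary or have deviation below [a]; ordinals
    being comparable, the larger of the two bounds serves both. *)
Lemma pdev_prod a lo1 hi1 lo2 hi2 :
  pdev dom1 le1 a lo1 hi1 -> pdev dom2 le2 a lo2 hi2 ->
  pdev prod_dom prod_le a (lo1, lo2) (hi1, hi2).
Proof.
elim: a lo1 hi1 lo2 hi2 => X f IH lo1 hi1 lo2 hi2 h1 h2 C hC.
have [|m1 hm1] := h1 (fst \o C); first by move=> k; case: (hC k) => -[? _] [? _] [? _] [? _].
have [|m2 hm2] := h2 (snd \o C); first by move=> k; case: (hC k) => -[_ ?] [_ ?] [_ ?] [_ ?].
exists (maxn m1 m2) => k; rewrite geq_max => /andP[/hm1 c1 /hm2 c2].
have eC l : C l = ((C l).1, (C l).2) by case: (C l).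
case: c1 c2 => [l1|[i d1]] [l2|[j d2]]; first by left.
- right; exists j; rewrite (eC k) (eC k.+1); apply: IH => //.
  exact: (pdev_triv _ tr1).
- right; exists i; rewrite (eC k) (eC k.+1); apply: IH => //.
  exact: (pdev_triv _ tr2).
- have [fij|fji] : ord_le (f i) (f j) \/ ord_le (f j) (f i).
    by have [|/ord_ltW] := ord_le_total (f i) (f j); [left|right].
  + by right; exists j; rewrite (eC k) (eC k.+1); apply: IH => //; apply: pdev_le fij d1.
  + by right; exists i; rewrite (eC k) (eC k.+1); apply: IH => //; apply: pdev_le fji d2.
Qed.

End Product.

Section FinitePower.
Variables (T : Type) (dom : T -> Prop) (le : T -> T -> Prop).
Hypothesis tr : forall y x z, le x y -> le y z -> le x z.

(** A finite power is made of functions on [nat] compared at the first [M] places only; antisymmetry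
    is lost, which is harmless for preorders. *)
Definition fin_dom M (f : nat -> T) := forall j, (j < M)%N -> dom (f j).
Definition fin_le M (f g : nat -> T) := forall j, (j < M)%N -> le (f j) (g j).

Lemma fin_le_trans M y x z : fin_le M x y -> fin_le M y z -> fin_le M x z.
Proof. by move=> h1 h2 j jM; apply: tr (h1 j jM) (h2 j jM). Qed.

Lemma pdev_fin M a lo hi : pdev dom le a lo hi ->
  pdev (fin_dom M) (fin_le M) a (fun=> lo) (fun=> hi).
Proof.
move=> h; elim: M => [|M IH]; first by apply: (pdev_triv _ (@fin_le_trans 0)).
apply: (pdev_map (phi := fun f : nat -> T => (f, f M)) (@fin_le_trans M.+1) _ _ _ _
  (pdev_prod (@fin_le_trans M) tr IH h)) => [f [d _ _]|f g _ _ l|f g _ _ l [l1 l2] j|f [d l1 l2]].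
- by split=> [j jM|]; apply: d => //; apply: ltnW.
- by split=> [j jM|]; apply: l => //; apply: ltnW.
- by rewrite ltnS leq_eqVlt => /predU1P[->|/l1].
- by split; (split=> [j jM|]; [apply: l1 || apply: l2|apply: l1 || apply: l2]) => //; apply: ltnW.
Qed.

End FinitePower.

Section Sequences.
Variables (T : Type) (dom : T -> Prop) (le : T -> T -> Prop).
Hypothesis refl : forall x, le x x.
Hypothesis tr : forall y x z, le x y -> le y z -> le x z.

Definition seq_dom (f : nat -> T) := (forall k, dom (f k)) /\ forall k, le (f k) (f k.+1).
Definition seq_le (f g : nat -> T) := forall k, le (f k) (g k).

Lemma seq_le_trans y x z : seq_le x y -> seq_le y z -> seq_le x z.
Proof. by move=> h1 h2 k; apply: tr (h1 k) (h2 k). Qed.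

(** Hilbert's basis argument: the diagonal [C k k] becomes stationary at some [m], which controls
    all places from [m] on, and the finitely many places before [m] become stationary one by one. *)
Lemma seq_pacc : pacc dom le -> pacc seq_dom seq_le.
Proof.
move=> ha C hC.
have row k : forall i j, (i <= j)%N -> le (C k i) (C k j).
  by apply: (pchain_mono refl tr); case: (hC k) => -[].
have col i : forall k l, (k <= l)%N -> le (C k i) (C l i).
  by apply: (pchain_mono refl tr (C := fun k => C k i)) => k; case: (hC k).
have [|m hm] := ha (fun k => C k k).
  move=> k; have [[d _] _] := hC k; split=> //.
  exact: tr (row k _ _ (leqnSn k)) (col k.+1 _ _ (leqnSn k)).
have cm j : exists mj, forall k, (mj <= k)%N -> le (C k j) (C mj j).
  apply: (ha (fun k => C k j)) => k; have [[d _] _] := hC k.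
  by split=> //; apply: col.
pose mj j := sval (cid (cm j)).
pose M := maxn m (\max_(j < m) mj j).
exists M => k Mk j; have [jm|mj'] := ltnP j m.
  have h1 : (mj j <= M)%N.
    by rewrite leq_max; apply/orP; right; apply: (leq_bigmax (Ordinal jm)).
  have h2 := leq_trans h1 Mk.
  apply: tr (col j _ _ h1); move: h2; rewrite /mj; case: cid => m' /= h; exact: h.
apply: (tr (y := C (maxn k j) (maxn k j))).
  by apply: tr (row _ _ _ (leq_maxr k j)); apply: col; apply: leq_maxl.
have mk : (m <= maxn k j)%N by rewrite leq_max mj' orbT.
apply: tr (hm _ mk) _; apply: tr (row _ _ _ mj') _.
by apply: col; apply: leq_maxl.
Qed.

(* Chains of eventually constant sequences: once the limit values differ by a
   factor of deviation below [a], so do the tails, by induction; the finitely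
   many remaining places contribute a finite power. *)
Lemma pdev_seq a lo hi : pacc dom le -> pdev dom le a lo hi ->
  pdev seq_dom seq_le (ord_succ a) (fun=> lo) (fun=> hi).
Proof.
move=> ha; elim: a lo hi => X F IH lo hi h C hC.
have row k : forall i j, (i <= j)%N -> le (C k i) (C k j).
  by apply: (pchain_mono refl tr); case: (hC k) => -[].
have cm k : exists mk, forall j, (mk <= j)%N -> le (C k j) (C k mk).
  by apply: ha => j; have [[d i] _ _ _] := hC k; split.
pose m k := sval (cid (cm k)).
have mP k j : le (C k j) (C k (m k)).
  have mk : forall j, (m k <= j)%N -> le (C k j) (C k (m k)).
    by rewrite /m; case: cid.
  have [jm|mj] := leqP j (m k); first exact: row.
  exact/mk/ltnW.
pose G k := C k (m k).
have [|m0 hm0] := h G.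
  move=> k; have [[d _] l1 l2 l3] := hC k.
  by split; [apply: d|apply: l1|apply: l2|apply: tr (l3 _) (mP _ _)].
exists m0 => k /hm0 hk; right; exists tt.
pose M := maxn (m k) (m k.+1).
have lM j : le (G k.+1) (C k.+1 (M + j)%N).
  by apply: row; apply: leq_trans (leq_maxr _ _) (leq_addr _ _).
pose dom2 := prod_dom (fin_dom dom M) seq_dom.
pose le2 := prod_le (fin_le le M) seq_le.
have tr2 : forall y x z, le2 x y -> le2 y z -> le2 x z.
  move=> y x z [a1 a2] [b1 b2]; split.
    exact: fin_le_trans a1 b1.
  exact: seq_le_trans a2 b2.
have hG : pdev dom2 le2 (osup F) (fun=> lo, fun=> G k.+1) (fun=> hi, fun=> G k).
  apply: pdev_prod; [exact: fin_le_trans|exact: seq_le_trans| |].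
    exact: pdev_fin.
  case: hk => [l|[i hi']].
    by apply: (pdev_triv _ seq_le_trans) => j.
  have := IH i _ _ hi'; apply: (pdev_le (b := osup F)) => _.
  by exists i; apply: ord_le_refl.
apply: (pdev_map (phi := fun f : nat -> T => (f, fun j => f (M + j)%N)) seq_le_trans
  _ _ _ _ hG) => [f [[d i] _ _]|f g _ _ l|f g _ _ l [l1 l2] j|f [_ l1 l2]].
- split=> /=; first by move=> j _; apply: d.
  by split=> j; rewrite ?addnS.
- by split=> j; [move=> _|]; apply: l.
- by have [/l1//|Mj] := ltnP j M; rewrite -(subnKC Mj); apply: l2.
- have [_ l3 _ _] := hC k.+1; have [_ _ l4 _] := hC k; split; split=> j.
  + by move=> _; apply: tr (l3 j) (l1 j).
  + exact: tr (lM j) (l1 _).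
  + by move=> _; apply: tr (l2 j) (l4 j).
  + exact: tr (l2 _) (mP _ _).
Qed.

(** The test chain consists of step sequences, equal to [lo] before place [k] and to [hi] from there
    on. Consecutive terms differ at a single place, so every factor contains a copy of [[lo, hi]],
    embedded by [psi]. *)
Lemma pdev_seq_inv (Y : Type) (g : Y -> ord) lo hi :
  dom lo -> dom hi -> le lo hi -> ~ le hi lo ->
  pdev seq_dom seq_le (osup g) (fun=> lo) (fun=> hi) ->
  exists j, pdev dom le (g j) lo hi.
Proof.
move=> dlo dhi lh nhl h.
pose C k (m : nat) := if (m < k)%N then lo else hi.
have [|m hm] := h C.
  move=> k; split; first split.
  - by move=> i; rewrite /C; case: ifP.
  - move=> i; rewrite /C; case: ltnP => [ik|ki]; last by rewrite ltnNge ltnW.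
    by case: ifP.
  - by move=> i; rewrite /C; case: ifP.
  - by move=> i; rewrite /C; case: ifP.
  - move=> i; rewrite /C; case: (ltnP i k) => [ik|ki]; first by rewrite ltnS ltnW.
    by case: ifP.
case: (hm m (leqnn _)) => [/(_ m)|[j hj]]; first by rewrite /C ltnn ltnSn.
exists j; pose psi (y : T) (i : nat) := if (i < m)%N then lo else if i == m then y else hi.
apply: (pdev_map (phi := psi) tr _ _ _ _ hj) => [y [d l1 l2]|y y' _ _ l|y y' _ _ l /(_ m)|y [_ l1 l2]].
- split=> i; rewrite /psi; first by case: ifP => // _; case: ifP.
  case: (ltngtP i m) => [im|mi|->].
  + by case: ifP => // _; case: ifP.
  + rewrite ltnNge (leqW (ltnW mi)) /=; case: eqP => // e.
    by move: mi; rewrite -e ltnNge leqW.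
  + by rewrite ltnNge leqnSn /= gtn_eqF.
- by move=> i; rewrite /psi; case: ifP => // _; case: ifP.
- by rewrite /psi ltnn eqxx.
- split=> i; rewrite /C /psi ?ltnS; case: (ltngtP i m) => [im|mi|im]; rewrite ?im //.
Qed.

End Sequences.

Section Powers.
Variables (T : Type) (dom : T -> Prop) (le : T -> T -> Prop).
Hypothesis refl : forall x, le x x.
Hypothesis tr : forall y x z, le x y -> le y z -> le x z.
Local Notation mn n := {ffun 'I_n -> nat}.

Definition pow_dom n (f : mn n -> T) := (forall a, dom (f a)) /\
  forall a b : mn n, (forall i, (a i <= b i)%N) -> le (f a) (f b).
Definition pow_le n (f g : mn n -> T) := forall a, le (f a) (g a).

Definition mcons n (k : nat) (a : mn n) : mn n.+1 :=
  [ffun i => if unlift ord0 i is Some j then a j else k].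
Definition mtail n (b : mn n.+1) : mn n := [ffun j => b (lift ord0 j)].

Lemma mconsK n (b : mn n.+1) : mcons (b ord0) (mtail b) = b.
Proof.
by apply/ffunP=> i; rewrite ffunE; case: unliftP => [j ->|->]; rewrite ?ffunE.
Qed.

Lemma mcons_le n k l (a b : mn n) : (k <= l)%N -> (forall i, (a i <= b i)%N) ->
  forall i, (mcons k a i <= mcons l b i)%N.
Proof. by move=> kl ab i; rewrite !ffunE; case: unliftP. Qed.

Lemma mn0 (a : mn 0) : a = mzero 0.
Proof. by apply/ffunP=> -[]. Qed.

Lemma pow_le_refl n (f : mn n -> T) : pow_le f f.
Proof. by move=> a; apply: refl. Qed.

Lemma pow_le_trans n (y x z : mn n -> T) : pow_le x y -> pow_le y z -> pow_le x z.
Proof. by move=> h1 h2 a; apply: tr (h1 a) (h2 a). Qed.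

Local Notation sdom n := (seq_dom (@pow_dom n) (@pow_le n)).
Local Notation sle n := (seq_le (@pow_le n)).

Definition curry n (f : mn n.+1 -> T) : nat -> mn n -> T := fun k a => f (mcons k a).

Lemma curry_dom n (f : mn n.+1 -> T) : pow_dom f -> sdom n (curry f).
Proof.
move=> [d m]; split=> k; last by move=> a; apply: m; apply: mcons_le.
by split=> [a|a b ab]; [apply: d|apply: m; apply: mcons_le].
Qed.

Lemma curry_le n (f g : mn n.+1 -> T) : pow_le f g <-> sle n (curry f) (curry g).
Proof. by split=> h; [move=> k a; apply: h|move=> b; rewrite -(mconsK b); apply: h]. Qed.

Lemma pow_pacc n : pacc dom le -> pacc (@pow_dom n) (@pow_le n).
Proof.
move=> h; elim: n => [|n IH].
  apply: (pacc_map (phi := fun f : mn 0 -> T => f (mzero 0)) (@pow_le_trans 0) _ _ _ _ h).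
  - by move=> f [d _]; apply: d.
  - by move=> f g _ _; apply.
  - by move=> f g _ _ _ e a; rewrite (mn0 a).
  - exact: pow_le_refl.
apply: (pacc_map (@pow_le_trans n.+1) _ _ _ _
  (seq_pacc (@pow_le_refl n) (@pow_le_trans n) IH)) => [f|f g _ _|f g _ _ _|f].
- exact: curry_dom.
- by move/curry_le.
- by move/curry_le.
- exact: pow_le_refl.
Qed.

Lemma pdev_pow n a lo hi : pacc dom le -> pdev dom le a lo hi ->
  pdev (@pow_dom n) (@pow_le n) (ord_addn a n) (fun=> lo) (fun=> hi).
Proof.
move=> ha h; elim: n => [|n IH].
  apply: (pdev_map (phi := fun f : mn 0 -> T => f (mzero 0)) (@pow_le_trans 0) _ _ _ _ h).
  - by move=> f [[d _] _ _]; apply: d.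
  - by move=> f g _ _; apply.
  - by move=> f g _ _ _ e b; rewrite (mn0 b).
  - by move=> f [_ l1 l2]; split; [apply: l1|apply: l2].
have := pdev_seq (@pow_le_refl n) (@pow_le_trans n) (@pow_pacc n ha) IH.
apply: (pdev_map (phi := @curry n) (@pow_le_trans n.+1)) => [f [d _ _]|f g _ _|f g _ _ _|f [_ l1 l2]].
- exact: curry_dom.
- by move/curry_le.
- by move/curry_le.
- by split=> k b; [apply: l1|apply: l2].
Qed.

(** Induction on [n]: by currying, a bound [osup g] for the power [n.+1] yields some [g j] that
    bounds the power [n], which is what [ord_succ] asks. *)
Lemma pdev_pow_min n a lo hi : dom lo -> dom hi -> le lo hi -> ~ le hi lo ->
  (forall b, pdev dom le b lo hi -> ord_le a b) ->
  forall b, pdev (@pow_dom n) (@pow_le n) b (fun=> lo) (fun=> hi) ->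
    ord_le (ord_addn a n) b.
Proof.
move=> dlo dhi lh nhl h; elim: n => [|n IH] b hb.
  apply: h; move: hb.
  apply: (pdev_map (phi := fun y (_ : mn 0) => y) tr) => [y [d _ _]|||].
  - by split.
  - by move=> y z _ _ l m.
  - by move=> y z _ _ _ /(_ (mzero 0)).
  - by move=> y [_ l1 l2]; split.
have hb' : pdev (sdom n) (sle n) b (fun _ _ => lo) (fun _ _ => hi).
  move: hb; apply: (pdev_map (phi := fun f (c : mn n.+1) => f (c ord0) (mtail c))
    (seq_le_trans (@pow_le_trans n))) => [f [[d m] _ _]|f g _ _ l c|f g _ _ _ l|f [_ l1 l2]].
  - split=> [c|c c' cc']; first by have [] := d (c ord0).
    have [_ mc] := d (c ord0); apply: (tr (y := f (c ord0) (mtail c'))).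
      by apply: mc => i; rewrite !ffunE.
    exact: (pchain_mono (@pow_le_refl n) (@pow_le_trans n) m).
  - exact: l.
  - move=> k c; have := l (mcons k c); rewrite ffunE unlift_none.
    have -> : mtail (mcons k c) = c by apply/ffunP=> i; rewrite !ffunE liftK.
    by [].
  - by split=> c; [apply: l1|apply: l2].
case: b hb' {hb} => Y g hb'.
have [|||c|j hj] := pdev_seq_inv (@pow_le_refl n) (@pow_le_trans n) _ _ _ _ hb'.
- by split.
- by split.
- by [].
- by apply: nhl; apply: (c (mzero n)).
- by move=> _; exists j; apply: IH.
Qed.

End Powers.

(** * Deviation of lattices of submodules *)

Section Submodules.
Variables (R : nzRingType) (M : lmodType R).
Local Open Scope classical_set_scope.
Local Notation subm := (@is_submodule R M).
Local Notation le := (@subset M).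

Lemma submodule_le_refl (N : set M) : N `<=` N. Proof. by []. Qed.
Lemma submodule_le_trans (N2 N1 N3 : set M) : N1 `<=` N2 -> N2 `<=` N3 -> N1 `<=` N3.
Proof. exact: subset_trans. Qed.

Lemma dev_leP a (N L : set M) : dev_le a N L <-> pdev subm le a N L.
Proof.
elim: a N L => X f IH N L; split=> h C hC.
  have [|m hm] := h C; first exact: hC.
  exists m => k /hm[->|[i hi]]; [by left|right].
  by exists i; apply/IH.
have [|m hm] := h C; first exact: hC.
exists m => k /hm[l|[i hi]]; [left|right].
  by apply/seteqP; split=> //; case: (hC k).
by exists i; apply/IH.
Qed.

Lemma noetherian_pacc : noetherian_module M -> pacc subm le.
Proof. by move=> h C hC; have [m hm] := h C hC; exists m => k /hm ->. Qed.

Lemma submodule0 : subm [set 0].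
Proof. by split=> // a _ _ -> ->; rewrite /= scaler0 addr0. Qed.

Lemma submoduleT : subm setT.
Proof. by []. Qed.

(** Noetherian induction on the lower end [N]. In a chain that never reaches [N], each factor lies
    above a submodule strictly larger than [N], so the supremum of the successors of the bounds for
    those larger submodules is a bound for [N]. *)
Lemma pacc_dev_exists : pacc subm le -> exists a, pdev subm le a [set 0] setT.
Proof.
move=> ha; pose good N := exists a, pdev subm le a N setT.
suff : forall N, subm N -> good N by apply; apply: submodule0.
suff step N : subm N -> (forall N', subm N' -> N `<=` N' -> ~ N' `<=` N -> good N') -> good N.
  move=> N0 hN0; apply: contrapT => bad0.
  have next (N : {N | subm N /\ ~ good N}) : {N' : {N' | subm N' /\ ~ good N'} |
      sval N `<=` sval N' /\ ~ sval N' `<=` sval N}.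
    case: N => N [hN nN] /=; apply: cid.
    apply: contrapT => nex; apply: nN; apply: step => // N' hN' l nl.
    apply: contrapT => ng; apply: nex.
    by exists (exist _ N' (conj hN' ng)).
  pose D k := iter k (fun N => sval (next N)) (exist _ N0 (conj hN0 bad0)).
  have [|m hm] := ha (fun k => sval (D k)).
    move=> k; split; first by case: (svalP (D k)).
    by rewrite /=; case: (next (D k)) => N' [].
  have := hm m.+1 (leqnSn m); rewrite /=; case: (next (D m)) => N' [_ nl] /=; exact: nl.
move=> hN hgood.
pose X := {N' : set M | [/\ subm N', N `<=` N' & ~ N' `<=` N]}.
have F (p : X) : {a | pdev subm le a (sval p) setT}.
  by case: p => N' [h1 h2 h3]; apply: cid; apply: hgood.
exists (osup (fun p => sval (F p))) => C hC.
have mono k l : (k <= l)%N -> C l `<=` C k.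
  move=> /subnKC <-; elim: (l - k)%N => [|i IH]; first by rewrite addn0.
  by rewrite addnS; apply: subset_trans IH; case: (hC (k + i)%N).
have [[m Cm]|nex] := pselect (exists m, C m `<=` N).
  exists m => k mk; left; apply: subset_trans (mono _ _ mk) _.
  by apply: subset_trans Cm _; case: (hC k.+1).
exists 0%N => k _; right.
have hp : [/\ subm (C k.+1), N `<=` C k.+1 & ~ C k.+1 `<=` N].
  by have [h1 h2 _ _] := hC k.+1; split=> // l; apply: nex; exists k.+1.
exists (exist (fun N' => [/\ subm N', N `<=` N' & ~ N' `<=` N]) _ hp); case: (F _) => a /= ha'.
by apply: (pdev_sub submodule_le_trans _ _ ha').
Qed.

End Submodules.

(** * Leading coefficients *)

Section Deglex.
Variable n : nat.
Local Notation mn := {ffun 'I_n -> nat}.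
Implicit Types a b c : mn.

Definition mlt a b : Prop := (mdeg a < mdeg b)%N \/ mdeg a = mdeg b /\
  exists i : 'I_n, (a i < b i)%N /\ forall j : 'I_n, (j < i)%N -> a j = b j.
Definition mle a b : Prop := mlt a b \/ a = b.

Lemma mlt_irr a : ~ mlt a a.
Proof. by case=> [|[_ [i []]]]; rewrite ltnn. Qed.

Lemma mlt_trans b a c : mlt a b -> mlt b c -> mlt a c.
Proof.
move=> [l1|[e1 [i [ai ei]]]] [l2|[e2 [j [bj ej]]]].
- by left; apply: ltn_trans l1 l2.
- by left; rewrite -e2.
- by left; rewrite e1.
right; split; first by rewrite e1.
case: (ltngtP i j) => [ij|ji|/ord_inj ij].
- exists i; rewrite -(ej i ij); split=> // k ki.
  by rewrite ei // ej // (ltn_trans ki).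
- exists j; rewrite (ei j ji); split=> // k kj.
  by rewrite ei ?ej // (ltn_trans kj).
- exists i; split=> [|k ki]; first by apply: ltn_trans ai _; rewrite ij.
  by rewrite ei // ej // -ij.
Qed.

Lemma mle_trans b a c : mle a b -> mle b c -> mle a c.
Proof.
move=> [h1|->] [h2|<-]; [left; exact: mlt_trans h2|by left|by left|by right].
Qed.

Lemma mle_lt_trans b a c : mle a b -> mlt b c -> mlt a c.
Proof. by move=> [h|->] // /(mlt_trans h). Qed.

Lemma mle_total a b : mle a b \/ mlt b a.
Proof.
case: (ltngtP (mdeg a) (mdeg b)) => [l|l|e]; [by left; left; left|by right; left|].
have [ab|ab] := eqVneq a b; first by left; right.
have [i0 ai0] : exists i, a i != b i.
  apply: contrapT => nex; move/eqP: ab; apply; apply/ffunP=> i.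
  by apply: contrapT => /eqP h; apply: nex; exists i.
have [i ai mi] := msupp_min (P := fun i => a i != b i) ai0.
have {}mi (j : 'I_n) : (j < i)%N -> a j = b j by move/mi; rewrite negbK => /eqP.
move: ai; rewrite neq_ltn => /orP[l|l]; [left; left|right]; right; split=> //.
  by exists i.
by exists i; split=> // j ji; rewrite mi.
Qed.

Lemma mlt_add a b c : mlt a b -> mlt (madd a c) (madd b c).
Proof.
move=> [l|[e [i [ai ei]]]]; [left|right]; rewrite !mdegD; first by rewrite ltn_add2r.
split; first by rewrite e.
by exists i; rewrite !ffunE ltn_add2r; split=> // j ji; rewrite !ffunE ei.
Qed.

Lemma mle_add a b c : mle a b -> mle (madd a c) (madd b c).
Proof. by move=> [/(@mlt_add _ _ c)|->]; [left|right]. Qed.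

(** Exponents of degree at most that of [a] fit in a finite box; [rk b] counts the members of the
    box below [b] and decreases strictly along [mlt]. *)
Lemma mlt_ind (P : mn -> Prop) :
  (forall a, (forall b, mlt b a -> P b) -> P a) -> forall a, P a.
Proof.
move=> h a; set d := mdeg a.
pose lift (c : {ffun 'I_n -> 'I_d.+1}) : mn := [ffun i => nat_of_ord (c i)].
have liftP b : (mdeg b <= d)%N -> exists u, lift u = b.
  move=> bd; exists [ffun i => inord (b i)]; apply/ffunP=> i; rewrite !ffunE inordK //.
  rewrite ltnS; apply: leq_trans bd; rewrite /mdeg (bigD1 i) //=; exact: leq_addr.
pose rk b := #|[pred u : {ffun 'I_n -> 'I_d.+1} | `[< mlt (lift u) b >]]|.
suff H k b : (mdeg b <= d)%N -> (rk b < k)%N -> P b by apply: (H (rk a).+1).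
elim: k b => // k IH b bd; rewrite ltnS => bk; apply: h => c cb.
have cd : (mdeg c <= d)%N by case: cb => [l|[-> _]] //; apply: leq_trans (ltnW l) bd.
apply: IH => //; apply: leq_trans bk; apply: proper_card; apply/properP; split.
  by apply/fintype.subsetP=> u /asboolP uc; apply/asboolP; apply: mlt_trans uc cb.
have [u uE] := liftP c cd; exists u; first by apply/asboolP; rewrite uE.
by apply/asboolP; rewrite uE; apply: mlt_irr.
Qed.

Definition mleb a b : bool := `[< mle a b >].

Lemma mleb_total : total mleb.
Proof.
move=> a b; apply/orP; have [h|h] := mle_total a b; [left|right]; apply/asboolP => //.
by left.
Qed.

Lemma mleb_trans : transitive mleb.
Proof.
by move=> b a c /asboolP h1 /asboolP h2; apply/asboolP; apply: mle_trans h2.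
Qed.

End Deglex.

Section Leading.
Variables (R A : nzRingType) (iota : {rmorphism R -> A}).
Variables (n : nat) (x : 'I_n -> A).
Hypotheses (hfree : pbw_basis iota x) (hbij : pbw_bijective iota x).
Local Notation mn := {ffun 'I_n -> nat}.
Local Notation mon := (pbw_mon x).
Local Notation cf := (cf hfree).
Local Notation sp := (sp hfree).
Local Notation sg := (sg hfree hbij).
Local Open Scope classical_set_scope.

Definition tlt (a : mn) := sp (fun m => mlt m a).
Definition tle (a : mn) := sp (fun m => mle m a).

Lemma lo_tlt a f : lo hfree (mdeg a) f -> tlt a f.
Proof. by apply: sp_sub => m h; left. Qed.

Lemma tle_max (P : mn -> Prop) f : sp P f -> f = 0 \/ exists a, [/\ P a, cf f a != 0 & tle a f].
Proof.
move=> Pf; have [->|/eqP f0] := pselect (f = 0); first by left.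
right; have [a ca] : exists a, cf f a != 0.
  apply: contrapT => nex; move/eqP: f0; apply.
  apply: (cf_ext (hfree := hfree)) => m; rewrite cf0.
  by apply: contrapT => /eqP c; apply: nex; exists m.
have [s hs] := cf_supp hfree f.
have ins m : cf f m != 0 -> m \in s by move=> c; apply: contraR c => /hs ->.
have [b [_ cb mb]] := seq_maximum (P := fun m => cf f m != 0)
  (@mleb_total n) (@mleb_trans n) (ins _ ca) ca.
exists b; split=> //; first exact: Pf.
by move=> m cm; apply/asboolP; apply: mb => //; apply: ins.
Qed.

Lemma mon_mul_tle r m s l : tle (madd m l) (iota r * mon m * (iota s * mon l)).
Proof.
rewrite -mulrA; apply: sp_Z; rewrite mulrA.
rewrite -(subrK (iota (sg m s) * mon m) (mon m * iota s)) mulrDl; apply: sp_D.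
  have := @mon_iota _ _ _ _ _ hfree hbij m s; move: (_ - _) => y hy.
  move: y hy; apply: (sp_ind (P := fun y => tle (madd m l) (y * mon l))) => [|u v|t k km].
  - by rewrite mul0r; apply: sp_0.
  - by rewrite mulrDl; apply: sp_D.
  - rewrite -mulrA; apply: sp_Z; have [u [_ hu]] := mon_mon hfree hbij k l.
    rewrite -(subrK (iota u * mon (madd k l)) (mon k * mon l)); apply: sp_D.
      apply: sp_sub hu => q hq; left; left; apply: ltn_trans hq _.
      by rewrite mdegD ltn_add2r.
    by apply: sp_U; left; left; rewrite !mdegD ltn_add2r.
rewrite -mulrA; apply: sp_Z; have [u [_ hu]] := mon_mon hfree hbij m l.
rewrite -(subrK (iota u * mon (madd m l)) (mon m * mon l)); apply: sp_D.
  by apply: sp_sub hu => q hq; left; left; rewrite mdegD.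
by apply: sp_U; right.
Qed.

Lemma sp_mul (Q1 Q2 Q : mn -> Prop) f g :
  (forall m l k, Q1 m -> Q2 l -> mle k (madd m l) -> Q k) ->
  sp Q1 f -> sp Q2 g -> sp Q (f * g).
Proof.
move=> hQ hf hg; move: f hf.
apply: (sp_ind (P := fun f => sp Q (f * g))) => [|u v|r m Qm].
- by rewrite mul0r; apply: sp_0.
- by rewrite mulrDl; apply: sp_D.
move: g hg; apply: (sp_ind (P := fun g => sp Q (iota r * mon m * g))) => [|u v|s l Ql].
- by rewrite mulr0; apply: sp_0.
- by rewrite mulrDr; apply: sp_D.
- by apply: sp_sub (mon_mul_tle (r := r) (m := m) (s := s) (l := l)) => k; apply: hQ.
Qed.

Lemma tlt_tle_mul a b f g : tlt a f -> tle b g -> tlt (madd a b) (f * g).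
Proof.
apply: sp_mul => m l k ma lb km; apply: mle_lt_trans km _.
have lb' : mle (madd m l) (madd m b) by rewrite ![madd m _]maddC; apply: mle_add.
exact: mle_lt_trans lb' (mlt_add _ ma).
Qed.

Lemma tle_tlt_mul a b f g : tle a f -> tlt b g -> tlt (madd a b) (f * g).
Proof.
apply: sp_mul => m l k ma lb km; apply: mle_lt_trans km _.
have ma' : mle (madd m l) (madd a l) by apply: mle_add.
by apply: mle_lt_trans ma' _; rewrite ![madd a _]maddC; apply: mlt_add.
Qed.

Lemma tlt_cf a f : tlt a f -> cf f a = 0.
Proof. by move=> h; apply: contrapT => /eqP/h/mlt_irr. Qed.

Lemma tle_split a f : tle a f -> tlt a (f - iota (cf f a) * mon a).
Proof.
move=> h m; rewrite cfB cfU; case: (m =P a) => [->|ma]; first by rewrite subrr eqxx.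
by rewrite subr0 => /h [].
Qed.

Lemma mon_iota_tlt a r : tlt a (mon a * iota r - iota (sg a r) * mon a).
Proof. by apply: lo_tlt; apply: mon_iota. Qed.

Lemma pbw_domain : is_domain R -> is_domain A.
Proof.
move=> dR f g fg; apply: contrapT => /negP; rewrite negb_or => /andP[f0 g0].
have [e|[a [_ ca ha]]] := tle_max (P := fun=> True) (f := f) (fun _ _ => I).
  by rewrite e eqxx in f0.
have [e|[b [_ cb hb]]] := tle_max (P := fun=> True) (f := g) (fun _ _ => I).
  by rewrite e eqxx in g0.
set c := cf f a in ca; set d := cf g b in cb.
have [u [uu hu]] := mon_mon hfree hbij a b.
(* Moving [d] past [mon a] twists it by [sg a], and multiplying the two monomials contributes the
   unit [u]. *)
have main : tlt (madd a b) (f * g - iota (c * sg a d * u) * mon (madd a b)).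
  have -> : f * g - iota (c * sg a d * u) * mon (madd a b) =
      (f - iota c * mon a) * g + (iota c * mon a) * (g - iota d * mon b) +
      iota c * ((mon a * iota d - iota (sg a d) * mon a) * mon b) +
      iota (c * sg a d) * (mon a * mon b - iota u * mon (madd a b)).
    by rewrite !(mulrBl, mulrBr) !rmorphM !mulrA !addrA !subrK.
  have hta : tle a (iota c * mon a) by apply: sp_U; right.
  apply: sp_D; first apply: sp_D; first apply: sp_D.
  - exact: tlt_tle_mul (tle_split ha) hb.
  - exact: tle_tlt_mul hta (tle_split hb).
  - apply: sp_Z; apply: (tlt_tle_mul (mon_iota_tlt (a := a) (r := d))).
    by apply: sp_mon; right.
  - by apply: sp_Z; apply: lo_tlt; rewrite mdegD.
have := tlt_cf main; rewrite fg cfB cf0 cfU eqxx sub0r => /eqP.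
rewrite oppr_eq0 => /eqP e.
have : c * sg a d * u != 0.
  apply: unit_mul_neq0 => //; apply: contra_neq ca => /dR /orP[/eqP//|].
  by rewrite sg_eq0 (negPf cb).
by rewrite e eqxx.
Qed.

(* With the coefficient on the right of the monomial, multiplying [I] by scalars
   or monomials on the left introduces no twist, so that [lcoef I] is an
   increasing family of left ideals. *)
Definition lcoef (I : set A) (a : mn) : set R :=
  fun r => exists f, I f /\ tlt a (f - mon a * iota r).

Local Notation RM := (R^o : lmodType R).
Local Notation AM := (A^o : lmodType A).

Lemma lcoef_dom (I : set AM) : @is_submodule A AM I ->
  pow_dom (@is_submodule R RM) (@subset R) (lcoef I).
Proof.
move=> [I0 hI]; split=> [a|a b ab r [f [If hf]]].
  split=> [|s u v [f [If hf]] [g [Ig hg]]].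
    by exists 0; rewrite rmorph0 mulr0 subr0; split=> //; apply: sp_0.
  (* Up to lower terms, [iota (sg a s) * mon a] is [mon a * iota s], so the right leading
     coefficient is multiplied by exactly [s]. *)
  exists (iota (sg a s) * f + g); split; first exact: hI.
  have -> : iota (sg a s) * f + g - mon a * iota (s *: u + v) =
      iota (sg a s) * (f - mon a * iota u) + (g - mon a * iota v) -
      (mon a * iota s - iota (sg a s) * mon a) * iota u.
    have idn (F G B X Y : A) : F + G - (X + Y) = F - B + (G - Y) - (X - B).
      by rewrite opprB [F - B + _]addrAC addrA subrK opprD [- X - Y]addrC !addrA.
    by rewrite rmorphD rmorphM mulrDr mulrBr mulrBl !mulrA; apply: idn.
  apply: sp_B; first by apply: sp_D => //; apply: sp_Z.
  by apply: lo_tlt; apply: lo_iota => //; apply: mon_iota.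
pose c : mn := [ffun i => (b i - a i)%N].
have cab : madd c a = b by apply/ffunP=> i; rewrite !ffunE subnK.
have [u [[v [uv vu]] hu]] := mon_mon hfree hbij c a.
(* [v] cancels the unit in [mon c * mon a], so the right coefficient [r] reappears unchanged at
   [b]. *)
exists (iota v * mon c * f); split.
  by have := hI (iota v * mon c) f 0 If I0; rewrite addr0.
have -> : iota v * mon c * f - mon b * iota r =
    iota v * mon c * (f - mon a * iota r) +
    iota v * (mon c * mon a - iota u * mon b) * iota r.
  rewrite !mulrBr mulrBl !mulrA -rmorphM vu rmorph1 mul1r.
  by rewrite addrA subrK.
rewrite cab -mdegD cab in hu; apply: sp_D.
  by rewrite -[b]cab; apply: tle_tlt_mul hf; apply: sp_U; right.
by apply: lo_tlt; apply: lo_iota => //; apply: sp_Z.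
Qed.

Lemma lcoef_mono (I J : set A) : I `<=` J -> pow_le (@subset R) (lcoef I) (lcoef J).
Proof. by move=> IJ a r [f [/IJ Jf hf]]; exists f. Qed.

(** An element of [J] with leading exponent [a] has the same right leading coefficient at [a] as
    some element of [I]; the difference lies in [J] with a smaller leading exponent, and [mlt] is
    well founded. *)
Lemma lcoef_reflect (I J : set AM) : @is_submodule A AM I -> @is_submodule A AM J ->
  I `<=` J -> pow_le (@subset R) (lcoef J) (lcoef I) -> J `<=` I.
Proof.
move=> sI sJ IJ h.
have H a : forall f : AM, J f -> tle a f -> I f.
  elim/mlt_ind: a => a IH f Jf hf.
  have [s sK Ks] := sg_bij hfree hbij a; pose r := s (cf f a).
  have fr : tlt a (f - mon a * iota r).
    have -> : f - mon a * iota r = (f - iota (cf f a) * mon a) -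
        (mon a * iota r - iota (sg a r) * mon a).
      by rewrite /r Ks opprB addrA subrK.
    by apply: sp_B; [apply: tle_split|apply: mon_iota_tlt].
  have [|g [Ig hg]] := h a r; first by exists f.
  have Jfg : J (f - g) by apply: (subB sJ) => //; apply: IJ.
  have fg : tlt a (f - g).
    have -> : f - g = (f - mon a * iota r) - (g - mon a * iota r).
      by rewrite opprB addrA subrK.
    exact: sp_B.
  rewrite -(subrK g f); apply: (subD sI) => //.
  have [->|[b [ba _ hb]]] := tle_max fg; first exact: (sub0 sI).
  exact: IH ba _ Jfg hb.
move=> f Jf; have [->|[a [_ _ ha]]] := tle_max (P := fun=> True) (f := f) (fun _ _ => Logic.I).
  exact: (sub0 sI).
exact: H ha.
Qed.

Lemma pbw_pacc : pacc (@is_submodule R RM) (@subset R) ->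
  pacc (@is_submodule A AM) (@subset A).
Proof.
move=> hR; have hp := pow_pacc (n := n) (@submodule_le_refl R RM) (@submodule_le_trans R RM) hR.
apply: (@pacc_map (set AM) (mn -> set RM) _ _ _ _ lcoef (@submodule_le_trans A AM)
  _ _ _ (@submodule_le_refl A AM) hp).
- by move=> I sI; apply: lcoef_dom.
- by move=> I J _ _; apply: lcoef_mono.
- by move=> I J sI sJ; apply: lcoef_reflect.
Qed.

Lemma pbw_pdev_upper a : pacc (@is_submodule R RM) (@subset R) ->
  pdev (@is_submodule R RM) (@subset R) a [set 0] setT ->
  pdev (@is_submodule A AM) (@subset A) (ord_addn a n) [set 0] setT.
Proof.
move=> hR ha.
apply: (pdev_map (phi := lcoef) (@submodule_le_trans A AM) _ _ _ _
  (pdev_pow (@submodule_le_refl R RM) (@submodule_le_trans R RM) n hR ha)).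
- by move=> I [sI _ _]; apply: lcoef_dom.
- by move=> I J _ _; apply: lcoef_mono.
- by move=> I J [sI _ _] [sJ _ _]; apply: lcoef_reflect.
- move=> I [sI _ _]; split=> b //.
  have [d _] := lcoef_dom sI; move=> _ ->; exact: (sub0 (d b)).
Qed.

Lemma pbw_pdev_lower b : pdev (@is_submodule A AM) (@subset A) b [set 0] setT ->
  pdev (@is_submodule R RM) (@subset R) b [set 0] setT.
Proof.
have [rho [rhoD rhoM rho1]] := right_retraction hfree hbij.
have rho0 : rho 0 = 0 by apply: (addrI (rho 0)); rewrite -rhoD !addr0.
pose phi (J : set R) : set A := fun a => forall N : set AM, is_submodule N ->
  (forall j, J j -> N (iota j)) -> N a.
have phiJ (J : set RM) a : is_submodule J -> phi J a -> J (rho a).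
  (* [phi J] is AJ, as an intersection of left ideals. It is tested on the largest left ideal that
     [rho] maps into [J], which contains [iota j] for every [j] in [J] because [rho] is right
     linear. *)
  move=> sJ pa; have := pa (fun a => forall b, J (rho (b * a)));
  move=> h; rewrite -[a]mul1r; apply: h => [|j Jj c].
    split=> [c|c u v hu hv d]; first by rewrite mulr0 rho0; apply: (sub0 sJ).
    by rewrite mulrDr mulrA rhoD; apply: (subD sJ).
  by rewrite rhoM; apply: (subZ sJ).
apply: (pdev_map (phi := phi) (@submodule_le_trans R RM)).
- move=> J _; split=> [N sN _|c u v hu hv N sN hN]; first exact: (sub0 sN).
  by apply: (proj2 sN); [apply: hu|apply: hv].
- by move=> J K _ _ JK a pa N sN hN; apply: pa => // j /JK; apply: hN.
- move=> J K [sJ _ _] [sK _ _] JK h j Kj.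
  have e : rho (iota j) = j by rewrite -[iota j]mul1r rhoM rho1 mul1r.
  have := @phiJ J (iota j) sJ; rewrite e; apply.
  by apply: h => N sN hN; apply: hN.
- by move=> J [sJ _ _]; split=> // _ -> N sN _; apply: (sub0 sN).
Qed.

Section QuasiCommutativeLower.
Hypothesis hqc : pbw_quasi_commutative iota x.

Lemma pbw_pdev_lower_qc b : pdev (@is_submodule A AM) (@subset A) b [set 0] setT ->
  pdev (pow_dom (n := n) (@is_submodule R RM) (@subset R)) (pow_le (n := n) (@subset R)) b
    (fun=> [set 0]) (fun=> setT).
Proof.
(* [sg a j] is the left coefficient of [mon a * iota j], so this is the sum of the
   [mon a * iota (J a)]. It is a left ideal because here a product of two terms is again a single
   term. *)
pose phi (J : mn -> set R) : set A := fun f => forall a, exists j, J a j /\ cf f a = sg a j.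
have sg_inj a := bij_inj (sg_bij hfree hbij a).
apply: (@pdev_map (mn -> set RM) (set AM) _ _ _ _ phi
  (@pow_le_trans (set RM) (@subset RM) (@submodule_le_trans R RM) n)).
- move=> J [[dJ mJ] _ _].
  have phiD f g : phi J f -> phi J g -> phi J (f + g).
    move=> hf hg a; have [j [Jj ej]] := hf a; have [k [Jk ek]] := hg a.
    by exists (j + k); rewrite cfD ej ek sgD; split=> //; apply: (subD (dJ a)).
  have phi0 : phi J 0.
    by move=> a; exists 0; rewrite cf0 sg0; split=> //; apply: (sub0 (dJ a)).
  suff phiM (c f : A) : phi J f -> phi J (c * f).
    by split=> // c f g hf hg; apply: phiD => //; apply: phiM.
  move=> hf.
  apply: (sp_ind (hfree := hfree) (Q := fun=> True) (P := fun c => phi J (c * f)))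
    => [|u v|r m _|//].
  - by rewrite mul0r.
  - by rewrite mulrDl; apply: phiD.
  rewrite -(pbw_coefK hfree f).
  apply: (free_ind (P := fun g => phi J (iota r * mon m * pbw_eval iota x g))) => [|u v|k _].
  - by rewrite pbw_eval0 mulr0.
  - by rewrite pbw_evalD mulrDr; apply: phiD.
  rewrite pbw_evalU; have [j [Jj ej]] := hf k; rewrite -/(cf f k) ej.
  have [u [_ ue]] := qc_mon_mon hfree hbij hqc m k.
  (* Writing the scalar [r * u] to the right of [mon (madd m k)] turns it into [s (r * u)], which
     acts on [j] from the left; the result stays in [J (madd m k)] since [J] is increasing. *)
  have [s sK Ks] := sg_bij hfree hbij (madd m k).
  have -> : iota r * mon m * (iota (sg k j) * mon k) =
      iota (sg (madd m k) (s (r * u) * j)) * mon (madd m k).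
    rewrite -(qc_mon_iota hfree hbij hqc k j) -!mulrA [mon m * _]mulrA ue.
    rewrite -(qc_mon_iota hfree hbij hqc (madd m k)) rmorphM [RHS]mulrA.
    by rewrite qc_mon_iota // Ks rmorphM !mulrA.
  move=> a; rewrite cfU; case: eqP => [->|_]; last first.
    by exists 0; rewrite sg0; split=> //; apply: (sub0 (dJ a)).
  exists (s (r * u) * j); split=> //; apply: (subZ (dJ _)).
  by apply: mJ Jj => i; rewrite ffunE leq_addl.
- by move=> J K _ _ JK f hf a; have [j [/JK Kj ej]] := hf a; exists j.
- move=> J K [[dJ _] _ _] [[dK _] _ _] JK h a j Kj.
  have [c|j' [Jj']] := h (iota (sg a j) * mon a) _ a.
    rewrite cfU; case: eqP => [->|_]; first by exists j.
    by exists 0; rewrite sg0; split=> //; apply: (sub0 (dK c)).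
  by rewrite cfU eqxx => /sg_inj ->.
- move=> J [[dJ _] _ _]; split=> // _ -> a.
  by exists 0; rewrite cf0 sg0; split=> //; apply: (sub0 (dJ a)).
Qed.

End QuasiCommutativeLower.

End Leading.

(** * Krull and Goldie dimensions *)

Section KrullDimension.
Local Open Scope classical_set_scope.
Local Notation devR R := (fun a => pdev (@is_submodule R R^o) (@subset R^o) a [set 0] setT).

Lemma is_lKdimP (R : nzRingType) a :
  is_lKdim R a <-> devR R a /\ forall b, devR R b -> ord_le a b.
Proof.
split=> [[_ /dev_leP h1 h2]|[h1 h2]].
  by split=> // b hb; apply: h2; apply/dev_leP.
split; [|exact/dev_leP|by move=> b /dev_leP; apply: h2].
by exists 1; apply/eqP; apply: oner_neq0.
Qed.

Lemma lKdim_exists (R : nzRingType) : (exists a, devR R a) -> exists a, is_lKdim R a.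
Proof. by move=> /ord_min[a ha]; exists a; apply/is_lKdimP. Qed.

Lemma field_submodule (R : nzRingType) (N : set R^o) :
  is_field R -> is_submodule N -> (exists2 r, N r & r <> 0) -> N = setT.
Proof.
move=> [_ hinv] sN [r Nr /eqP /hinv [s sr]]; apply/seteqP; split=> // y _.
by rewrite -[y]mulr1 -sr mulrA; apply: (subZ sN).
Qed.

Lemma field_pacc (R : nzRingType) : is_field R -> pacc (@is_submodule R R^o) (@subset R^o).
Proof.
move=> hF C hC; have [[m [r Cr r0]]|nex] := pselect (exists m, exists2 r, C m r & r <> 0).
  exists m => k _; rewrite (field_submodule hF (proj1 (hC m))) //.
  by exists r.
exists 0%N => k _ r Cr; have [->|/eqP r0] := eqVneq r 0; first exact: (sub0 (proj1 (hC 0%N))).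
by case: nex; exists k, r.
Qed.

(** [ord_zero] has no index, so chains must become stationary; they do, as 0 and the whole ring are
    the only left ideals. *)
Lemma field_dev (R : nzRingType) : is_field R -> devR R ord_zero.
Proof.
move=> hF C hC; have [[m hm]|nex] := pselect (exists m, C m `<=` [set 0]).
  exists m => k mk; left => r Cr.
  have sub l : C (m + l)%N `<=` [set 0].
    elim: l => [|l IH]; first by rewrite addn0.
    by rewrite addnS; apply: subset_trans IH; case: (hC (m + l)%N).
  have := sub (k - m)%N r; rewrite subnKC // => /(_ Cr) ->.
  by case: (hC k.+1) => h _ _ _; exact: (sub0 h).
exists 0%N => k _; left; have [hk _ _ _] := hC k.+1.
rewrite (field_submodule hF hk) //; apply: contrapT => nr; apply: nex.
by exists k.+1 => r Cr; apply: contrapT => r0; apply: nr; exists r.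
Qed.

Lemma lKdim_field (R : nzRingType) : is_field R -> is_lKdim R ord_zero.
Proof. by move=> hF; apply/is_lKdimP; split; [apply: field_dev|case=> X f _ []]. Qed.

Section PBW.
Variables (R A : nzRingType) (iota : {rmorphism R -> A}).
Variables (n : nat) (x : 'I_n -> A).
Hypotheses (hfree : pbw_basis iota x) (hbij : pbw_bijective iota x).

Lemma lKdim_upper kR kA : pacc (@is_submodule R R^o) (@subset R^o) ->
  is_lKdim R kR -> is_lKdim A kA -> ord_le kA (ord_addn kR n).
Proof.
move=> ha /is_lKdimP[hR _] /is_lKdimP[_ hA]; apply: hA.
exact: (pbw_pdev_upper hfree hbij ha hR).
Qed.

Lemma lKdim_lower kR kA : is_lKdim R kR -> is_lKdim A kA -> ord_le kR kA.
Proof.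
move=> /is_lKdimP[_ hR] /is_lKdimP[hA _]; apply: hR.
exact: (pbw_pdev_lower hfree hbij hA).
Qed.

Lemma pbw_lKdim_exists kR : pacc (@is_submodule R R^o) (@subset R^o) ->
  is_lKdim R kR -> exists kA, is_lKdim A kA.
Proof.
move=> ha /is_lKdimP[hR _]; apply: lKdim_exists; exists (ord_addn kR n).
exact: (pbw_pdev_upper hfree hbij ha hR).
Qed.

Lemma qc_dev_min kR b : pbw_quasi_commutative iota x ->
  is_lKdim R kR -> devR A b -> ord_le (ord_addn kR n) b.
Proof.
move=> hqc /is_lKdimP[_ hR] hb; have := pbw_pdev_lower_qc hfree hbij hqc hb.
apply: (pdev_pow_min (@submodule_le_refl R R^o) (@submodule_le_trans R R^o) _ _ _ _ hR).
- exact: submodule0.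
- exact: submoduleT.
- by [].
- by move=> /(_ 1 I) /eqP; rewrite oner_eq0.
Qed.

End PBW.

(* If [a] and [b] had no common nonzero left multiple, the left ideals
   generated by the [b * a ^+ i] would form a strictly increasing chain. *)
Lemma domain_ore (A : nzRingType) (a b : A) : is_domain A ->
  pacc (@is_submodule A A^o) (@subset A^o) -> a != 0 -> b != 0 ->
  exists c d, c * a = d * b /\ c * a != 0.
Proof.
move=> hd ha a0 b0; apply: contrapT => nex.
have ore c d : c * a = d * b -> c * a = 0.
  by move=> e; apply: contrapT => /eqP h; apply: nex; exists c, d.
have mul0 (u v : A) : u * v = 0 -> v != 0 -> u = 0.
  by move=> /hd /orP[/eqP//|/eqP ->]; rewrite eqxx.
(* The sum is [c 0%N * b] plus a left multiple of [a]. With no nonzero common multiple both parts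
   vanish, and cancelling [a] leaves a shorter relation. *)
have indep m (c : nat -> A) : \sum_(i < m) c i * (b * a ^+ i) = 0 ->
    forall i, (i < m)%N -> c i = 0.
  elim: m c => // m IH c; rewrite big_ord_recl expr0 mulr1 => e.
  have e1 : \sum_(i < m) c (lift ord0 i) * (b * a ^+ lift ord0 i) =
      (\sum_(i < m) c i.+1 * (b * a ^+ i)) * a.
    rewrite mulr_suml; apply: eq_bigr => i _.
    by rewrite /= /bump add1n exprSr !mulrA.
  rewrite e1 in e.
  have s0 : (\sum_(i < m) c i.+1 * (b * a ^+ i)) * a = 0.
    apply: (ore _ (- c 0%N)); rewrite mulNr; apply/eqP.
    by rewrite -addr_eq0 addrC e.
  move: e; rewrite s0 addr0 => /mul0 /(_ b0) c0.
  have sS := IH (fun i => c i.+1) (mul0 _ _ s0 a0).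
  by case=> [|i] //; rewrite ltnS => /sS.
pose C k : set A^o := fun f => exists c : nat -> A, f = \sum_(i < k) c i * (b * a ^+ i).
have [|m hm] := ha C.
  move=> k; split.
    split=> [|r _ _ [c ->] [d ->]].
      by exists (fun=> 0); rewrite big1 // => i _; rewrite mul0r.
    exists (fun i => r * c i + d i); rewrite -[_ *: _]/(r * _) mulr_sumr -big_split.
    by apply: eq_bigr => i _; rewrite mulrDl !mulrA.
  move=> _ [c ->]; exists (fun i => if (i < k)%N then c i else 0).
  rewrite big_ord_recr /= ltnn mul0r addr0; apply: eq_bigr => i _.
  by rewrite ltn_ord.
have [|c e] := hm m.+1 (leqnSn m) (b * a ^+ m).
  exists (fun i => if i == m then 1 else 0); rewrite big_ord_recr /= eqxx mul1r.
  by rewrite big1 ?add0r // => i _; rewrite ltn_eqF ?mul0r.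
have := indep m.+1 (fun i => if (i < m)%N then c i else -1).
rewrite big_ord_recr /= ltnn mulN1r.
have -> : \sum_(i < m) (if (i < m)%N then c i else -1) * (b * a ^+ i) = b * a ^+ m.
  by rewrite e; apply: eq_bigr => i _; rewrite ltn_ord.
rewrite subrr => /(_ erefl m (ltnSn m)); rewrite ltnn => /eqP.
by rewrite oppr_eq0 oner_eq0.
Qed.

(** The Ore condition makes the ring uniform as a left module over itself, so 1 is attained; 0 is
    excluded because the empty sum is zero and not essential. *)
Lemma ludim_domain (A : nzRingType) : is_domain A ->
  pacc (@is_submodule A A^o) (@subset A^o) -> ludim A = (1 : int)%:E.
Proof.
move=> hd ha.
have T0 : (setT : set A^o) <> [set 0].
  by move=> e; have : [set 0 : A^o] 1 by [rewrite -e]; move=> /eqP; rewrite oner_eq0.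
have nz (N : set A^o) : is_submodule N -> N <> [set 0] -> exists2 a, N a & a != 0.
  move=> sN N0; apply: contrapT => nex; apply: N0; apply/seteqP; split=> [a Na|_ ->].
    by apply: contrapT => /eqP a0; apply: nex; exists a.
  exact: (sub0 sN).
rewrite /ludim /udim /nat_inf; set P := (X in pselect X).
have P1 : exists U : 'I_1 -> set A^o, [/\ forall i, uniform_submodule (U i),
    independent_family U & essential_submodule (sum_family U)].
  exists (fun=> setT); split=> [_|u _|].
  - split=> // N1 N2 s1 _ n1 s2 _ n2.
    have [a Na a0] := nz _ s1 n1; have [b Nb b0] := nz _ s2 n2.
    have [c [d [e ca0]]] := domain_ore hd ha a0 b0 => e0.
    have : (N1 `&` N2) (c * a).
      by split; [apply: (subZ s1)|rewrite e; apply: (subZ s2)].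
    by rewrite e0 => /eqP; rewrite (negPf ca0).
  - by rewrite big_ord1 => u0 i; rewrite (ord1 i).
  - have -> : sum_family (fun _ : 'I_1 => (setT : set A^o)) = setT.
      apply/seteqP; split=> // v _; exists (fun=> v); split=> //.
      by rewrite big_ord1.
    by split=> // N sN N0; rewrite setIT.
case: pselect => [ex|nex]; last by case: nex; exists 1%N; apply/asboolP.
case: ex_minnP => m /asboolP[U [_ _ [_ ess]]] /(_ 1%N) m1.
have {}m1 : (m <= 1)%N by apply: m1; apply/asboolP.
case: m U ess m1 => [|[|//]] U ess _ //.
case: (ess setT) => //; rewrite setTI; apply/seteqP; split=> [_ [u [_ ->]]|_ ->].
  by rewrite big_ord0.
by exists (fun=> 0); split=> [[]|] //; rewrite big_ord0.
Qed.

End KrullDimension.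

Theorem theorem4p2 (R A : nzRingType) (iota : {rmorphism R -> A})
  (n : nat) (x : 'I_n -> A)
  (hA : skew_PBW iota x) (hbij : pbw_bijective iota x) :
  [/\ (* (i) *)
      [/\ (lgld R < +oo)%E ->
            (lgld R <= lgld A)%E /\ (lgld A <= lgld R + (Posz n)%:E)%E,
          pbw_quasi_commutative iota x ->
            lgld A = (lgld R + (Posz n)%:E)%E &
          pbw_quasi_commutative iota x -> semisimple_ring R ->
            lgld A = (Posz n)%:E],
      (* (ii) *)
      (left_noetherian R ->
         exists kR kA : ord,
           [/\ is_lKdim R kR, is_lKdim A kA,
               ord_le kR kA, ord_le kA (ord_addn kR n) &
               pbw_quasi_commutative iota x ->
                 ord_eq kA (ord_addn kR n)]) /\
      (pbw_quasi_commutative iota x -> is_field R ->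
         is_lKdim A (ord_of_nat n)) &
      (* (iii) *)
      left_noetherian R -> is_domain R -> ludim A = (1 : int)%:E].
Proof.
have hf := pbw_free hA; split.
- split=> [fin|hqc|hqc hss].
  + by split; [apply: (lgld_lower hf hbij)|apply: (lgld_upper hf hbij)].
  + exact: (lgld_qc hf hbij hqc).
  + by rewrite (lgld_qc hf hbij hqc) (lgld_semisimple hss) add0e.
- split=> [hN|hqc hF].
    have ha := noetherian_pacc hN.
    have [kR hR] := lKdim_exists (pacc_dev_exists ha).
    have [kA hKA] := pbw_lKdim_exists hf hbij ha hR.
    have up := lKdim_upper hf hbij ha hR hKA.
    exists kR, kA; split=> //; first exact: (lKdim_lower hf hbij hR hKA).
    move=> hqc; split=> //; have /is_lKdimP[hdev _] := hKA.
    exact: (qc_dev_min hf hbij hqc hR hdev).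
  (* [ord_of_nat n] is [ord_addn ord_zero n], and [ord_zero] is the Krull dimension of a field, so
     both bounds apply as they stand. *)
  apply/is_lKdimP; split.
    exact: (pbw_pdev_upper hf hbij (field_pacc hF) (field_dev hF)).
  by move=> b hb; apply: (qc_dev_min hf hbij hqc (lKdim_field hF) hb).
- move=> hN hD; apply: ludim_domain; first exact: (pbw_domain hf hbij hD).
  exact: (pbw_pacc hf hbij (noetherian_pacc hN)).
Qed.
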